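(* There exist absolute constants $\epsilon_1>0$ (small) and $C_*>0$ such that the following holds. Let $R>0$, let $K$ be a function with $0\le\inf_{B_{2R}}K\le\sup_{B_{2R}}K<\infty$, and let $w$ be an admissible solution of $$\sigma_2(g^{-1}\circ A_g)=K(x),\qquad g=e^{2w}g_0,$$ on $B_{4R}\subset\mathbb R^4$. If $$\left(\sup_{B_{2R}}K\right)\int_{B_{2R}}e^{4w}\,d\mathrm{vol}_{g_0}<\epsilon_1,$$ then $$\sup_{B_R}e^{w}\le C_*\left(\frac1{R^4}\int_{B_{2R}}e^{4w}\,d\mathrm{vol}_{g_0}\right)^{1/4}\qquad\text{and}\qquad \sup_{B_R}e^{w}\le C_*\inf_{B_R}e^{w}.$$
   Context: The background metric is the flat metric $g_0=|dx|^2$ on $\mathbb R^4$, with volume measure $d\mathrm{vol}_{g_0}$ (Lebesgue measure); $B_r$ denotes a ball of radius $r$, the balls $B_R$, $B_{2R}$, $B_{4R}$ being concentric. $K$ is a nonnegative function on $B_{4R}$. For $g=e^{2w}g_0$, the Weyl-Schouten tensor of $g$ in dimension $n=4$ is $A_g=\frac1{n-2}\{Ric_g-\frac{R_g}{2(n-1)}g\}$ ($Ric_g$ the Ricci tensor and $R_g$ the scalar curvature of $g$), which here equals $$A_g=-\left[\nabla^2w-dw\otimes dw+\tfrac12|\nabla w|^2g_0\right],$$ where $\nabla$ and $|\cdot|$ are taken with respect to $g_0$. For a $1$-$1$ tensor $\Lambda$, $\sigma_k(\Lambda)$ is the $k$-th elementary symmetric function of its eigenvalues. One has $\sigma_2(g^{-1}\circ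 A_g)=e^{-4w}\sigma_2(g_0^{-1}\circ A_g)$. The condition $A_g\in\Gamma_2^+$ at a point means $\sigma_1(g^{-1}\circ A_g)>0$ and $\sigma_2(g^{-1}\circ A_g)>0$ there. An admissible solution of the equation on $B_{4R}$ is a function $w\in C^2(B_{4R})$ such that at every point $A_g\in\Gamma_2^+$ and the equation holds. *)

(* Defs.v *)
From HB Require Import structures.
From mathcomp Require Import all_boot all_order all_algebra.
From mathcomp Require Import complex.
From mathcomp Require Import all_classical all_reals all_analysis.

Set Implicit Arguments.
Unset Strict Implicit.
Unset Printing Implicit Defensive.

Import Order.TTheory GRing.Theory Num.Theory.
Import numFieldNormedType.Exports.

Local Open Scope classical_set_scope.
Local Open Scope ring_scope.

(* The canonical norm of 'rV[R]_n is the sup norm (same topology), hence the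
   explicit Euclidean norm. *)
Definition enorm (R : realType) (n : nat) (x : 'rV[R]_n) : R :=
  Num.sqrt (\sum_i x 0 i ^+ 2).

Definition eball (R : realType) (n : nat) (c : 'rV[R]_n) (r : R)
    : set 'rV[R]_n :=
  [set x | enorm (x - c) < r].

Definition partial (R : realType) (n : nat) (i : 'I_n) (f : 'rV[R]_n -> R)
    : 'rV[R]_n -> R :=
  fun x => 'D_(delta_mx 0 i) f x.

(* f is of class C^k on the set U, which is meant to be open. *)
Fixpoint Ck_on (R : realType) (n : nat) (k : nat) (U : set 'rV[R]_n)
    (f : 'rV[R]_n -> R) : Prop :=
  (forall x, U x -> {for x, continuous f}) /\
  if k is k'.+1 then
    forall i : 'I_n,
      (forall x, U x -> derivable f x (delta_mx 0 i)) /\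
      Ck_on k' U (partial i f)
  else True.

(* Elementary symmetric functions of the eigenvalues. The eigenvalues are the
   roots in R[i], with multiplicity, of the (real, monic) characteristic
   polynomial, so the sum below is real and Re only changes its type. *)
Definition eigenvalues (R : realType) (n : nat) (L : 'M[R]_n) : seq R[i] :=
  sval (closed_field_poly_normal (map_poly (real_complex R) (char_poly L))).

Definition esymf (F : comNzRingType) (k : nat) (s : seq F) : F :=
  \sum_(I : {set 'I_(size s)} | #|I| == k) \prod_(i in I) s`_i.

Definition sigma (R : realType) (n : nat) (k : nat) (L : 'M[R]_n) : R :=
  complex.Re (esymf k (eigenvalues L)).

Definition Gamma2p (R : realType) (n : nat) (L : 'M[R]_n) : Prop :=
  0 < sigma 1 L /\ 0 < sigma 2 L.

(* A metric on (an open subset of) R^n is given by its matrix g_ij in the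
   standard coordinates. *)

(* christoffel g k i j is Gamma^k_ij. *)
Definition christoffel (R : realType) (n : nat) (g : 'rV[R]_n -> 'M[R]_n)
    (k i j : 'I_n) (x : 'rV[R]_n) : R :=
  2^-1 * \sum_l invmx (g x) k l *
    (partial i (fun y => g y j l) x + partial j (fun y => g y i l) x
     - partial l (fun y => g y i j) x).

(* Sign convention: the round sphere has positive Ricci curvature. *)
Definition ricci (R : realType) (n : nat) (g : 'rV[R]_n -> 'M[R]_n)
    (x : 'rV[R]_n) : 'M[R]_n :=
  \matrix_(i, j)
    (\sum_k partial k (christoffel g k i j) x
     - \sum_k partial j (christoffel g k i k) x
     + \sum_k \sum_l christoffel g k k l x * christoffel g l i j x
     - \sum_k \sum_l christoffel g k j l x * christoffel g l i k x).

Definition scalar_curvature (R : realType) (n : nat) (g : 'rV[R]_n -> 'M[R]_n)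
    (x : 'rV[R]_n) : R :=
  \tr (invmx (g x) *m ricci g x).

Definition schouten (R : realType) (n : nat) (g : 'rV[R]_n -> 'M[R]_n)
    (x : 'rV[R]_n) : 'M[R]_n :=
  (n%:R - 2)^-1 *:
    (ricci g x - (scalar_curvature g x / (2 * (n%:R - 1))) *: g x).

(* The matrix of e^{2w} |dx|^2. *)
Definition conf_metric (R : realType) (n : nat) (w : 'rV[R]_n -> R)
    (x : 'rV[R]_n) : 'M[R]_n :=
  (expR (2 * w x))%:M.

(* The 1-1 tensor g^{-1} o A_g for g = e^{2w} |dx|^2. *)
Definition conf_schouten (R : realType) (n : nat) (w : 'rV[R]_n -> R)
    (x : 'rV[R]_n) : 'M[R]_n :=
  invmx (conf_metric w x) *m schouten (conf_metric w) x.

Definition admissible_solution (R : realType) (U : set 'rV[R]_4)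
    (K w : 'rV[R]_4 -> R) : Prop :=
  Ck_on 2 U w /\
  forall x, U x ->
    Gamma2p (conf_schouten w x) /\ sigma 2 (conf_schouten w x) = K x.

(* The measurable structure of the library lives on iterated products of R
   rather than on 'rV[R]_4, so integrals over R^4 are taken in coordinates. *)
Definition vec4 (R : realType) (p : R * R * R * R) : 'rV[R]_4 :=
  \row_(i < 4) [:: p.1.1.1; p.1.1.2; p.1.2; p.2]`_i.

Definition lebesgue4 (R : realType) :=
  (((@lebesgue_measure R \x @lebesgue_measure R) \x @lebesgue_measure R)
   \x @lebesgue_measure R)%E.

Definition integral4 (R : realType) (D : set 'rV[R]_4)
    (f : 'rV[R]_4 -> \bar R) : \bar R :=
  (\int[@lebesgue4 R]_(p in @vec4 R @^-1` D) f (vec4 p))%E.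

(* Main.v *)
(* Put u = e^w and psi = e^(-w). The cone condition sigma_1 > 0 says Delta w + |grad w|^2 < 0, i.e. u is strictly
   superharmonic, and the equation turns into a quartic identity for (grad w, D^2 w) with right side 2 K e^(4w).

   Lower mass bound: if u <= 2 u(0) = 2 and 2 K u^4 <= 1 on the unit ball, then the integral of u there is bounded
   below by an absolute constant. To see this, slide the paraboloids t - 8 |x - y|^2 from below against psi. At a
   contact point N = D^2 psi + 16 is nonnegative with sigma_2(N) <= C tr N, so all its eigenvalues but one are
   bounded, and det N is at most C (1 + tr N) <= C (u - Delta u). As u is superharmonic, a test function moves the
   Laplacian off u, which bounds the measure of the set of vertices y by the integral of u.

   Choose x_0 maximizing u(x) ((3R/2)^2 - |x - c|^2)^4. Then u <= 2 u(x_0) on a ball B_d(x_0), d being comparable to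
   (3R/2)^2 - |x_0 - c|^2 over R. If the scale invariant quantity (sup K) u(x_0)^4 d^4 were not small, shrinking d
   until it is and applying the mass bound would contradict (sup K) int e^(4w) < eps. So the mass bound applies in
   B_d(x_0) itself; with Jensen's inequality it gives the first estimate, and with the mean value inequality for the
   superharmonic function u the second one.

   Integrals of u are replaced by sums over fine lattices: summation by parts and the counting of vertices are then
   finite, and only the lower Riemann sums of int e^(4w) are compared with the Lebesgue integral. *)
Require Import Defs.
From mathcomp Require Import all_boot all_order all_algebra.
From mathcomp Require Import all_classical all_reals all_analysis measurable_realfun.
From mathcomp Require Import ring lra zify complex.
Import Order.TTheory GRing.Theory Num.Theory.
Import numFieldNormedType.Exports.
Local Open Scope classical_set_scope.
Local Open Scope ring_scope.
Set Implicit Arguments.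
Unset Strict Implicit.
Unset Printing Implicit Defensive.

(** * Functions of class C^2 on open sets *)

(** The function w is only C^2 and K enters only through its supremum, so the equation cannot be
    differentiated and no bound on grad w or D^2 w is available in advance. At a contact point,
    however, the paraboloid fixes the gradient. Since D^2 psi = psi (dw dw - D^2 w) differs from a
    multiple of A_g only by a multiple of the identity, the equation then bounds sigma_2(N) linearly
    in tr N.

    Linear growth is the crucial order: tr N is controlled by -Delta u, which may be large but can
    be tested, while a higher power of it could not be moved off u. In place of the area formula,
    lattice vertices y are counted: those whose contact points share a cell of side h fill a tube
    whose width is bounded and whose length is O(1 + tr N), both in units of h. Only second
    differences of u are summed by parts, for which C^2 suffices.

    The exponent 4 of the weight in the choice of x_0 is the dimension: the mass bound gives a
    multiple of d^4 u(x_0), which is the maximized quantity up to powers of R. *)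

Definition box (R : realType) (n : nat) (x : 'rV[R]_n) (d : R) : set 'rV[R]_n :=
  [set y | forall i, `|y 0 i - x 0 i| < d].

Section Box.
Context {R : realType} {n : nat}.
Implicit Types (x y v : 'rV[R]_n) (U A : set 'rV[R]_n) (f : 'rV[R]_n -> R).

Lemma nbhs_boxP x A : nbhs x A <-> exists2 d : R, 0 < d & box x d `<=` A.
Proof.
split.
- move=> /nbhs_ballP[d /= d0 dA]; exists d => // y yx; apply: dA; split=> // i j.
  by rewrite (ord1 i) /ball /= distrC; exact: yx.
- move=> [d d0 dA]; apply/nbhs_ballP; exists d => // y yx; apply: dA => j.
  by case: yx => _ /(_ 0 j); rewrite /ball /= distrC.
Qed.

Lemma open_box U x : open U -> U x -> exists2 d : R, 0 < d & box x d `<=` U.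
Proof. by move=> oU Ux; apply/nbhs_boxP; exact: open_nbhs_nbhs. Qed.

Lemma continuous_box f x : {for x, continuous f} ->
  forall e : R, 0 < e -> exists2 d : R, 0 < d &
    forall y, box x d y -> `|f y - f x| < e.
Proof.
move=> /(cvgrPdist_lt (FF := nbhs_filter x)) fx e e0; have /nbhs_boxP[d d0 dA] := fx _ e0.
by exists d => // y /dA /=; rewrite distrC.
Qed.

Lemma box_continuous f x :
  (forall e : R, 0 < e -> exists2 d : R, 0 < d &
    forall y, box x d y -> `|f y - f x| < e) -> {for x, continuous f}.
Proof.
move=> H; apply/(cvgrPdist_lt (FF := nbhs_filter x)) => e e0; apply/nbhs_boxP.
have [d d0 dA] := H _ e0.
by exists d => // y yx; rewrite distrC; exact: dA.
Qed.

Lemma box_sub x y d1 d2 : box x d1 y -> box y d2 `<=` box x (d1 + d2).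
Proof.
move=> xy z yz i; rewrite -(subrK (y 0 i) (z 0 i)) -addrA.
by rewrite (le_lt_trans (ler_normD _ _))// [d1 + d2]addrC ltrD// ?yz ?xy.
Qed.

Lemma le_box x d1 d2 : d1 <= d2 -> box x d1 `<=` box x d2.
Proof. by move=> d12 y yx i; exact: lt_le_trans (yx i) d12. Qed.

Lemma box_refl x d : 0 < d -> box x d x.
Proof. by move=> d0 i; rewrite subrr normr0. Qed.

(** All passages from pointwise to uniform smallness of the lattice step go through this lemma. The
    near-covering form of compactness, applied to the filter of h tending to 0, avoids extracting a
    finite subcover. *)
Lemma compact_uniform A (P : 'rV[R]_n -> R -> Prop) : compact A ->
  (forall x, A x -> exists2 d : R, 0 < d &
     forall y (h : R), box x d y -> 0 < h -> h < d -> P y h) ->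
  exists2 h0 : R, 0 < h0 & forall x (h : R), A x -> 0 < h -> h < h0 -> P x h.
Proof.
move=> /compact_near_coveringP cA HP.
pose Q (h : R) x := 0 < h -> P x h.
have : \forall h \near (0 : R), A `<=` Q h.
  apply: (cA R (nbhs (0 : R)) Q _ _) => x Ax; have [d d0 dP] := HP _ Ax.
  exists (box x d, [set h : R | `|h| < d]); last first.
    by move=> [y h] /= [xy hd] h0; apply: dP => //; rewrite -(gtr0_norm h0).
  split; first by apply/nbhs_boxP; exists d.
  by apply/nbhs_ballP; exists d => // h; rewrite /ball /= sub0r normrN.
move=> /nbhs_ballP[d /= d0 dA]; exists d => // x h Ax h0 hd; apply: dA => //.
by rewrite /ball /= sub0r normrN gtr0_norm.
Qed.

Lemma is_derive_line f x v t df : is_derive (x + t *: v) v f df ->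
  is_derive t 1 (fun s : R => f (x + s *: v)) df.
Proof.
move=> [fx <-].
have E : (fun h : R => h^-1 *: (f (x + (h *: 1 + t) *: v) - f (x + t *: v))) =
    (fun h : R => h^-1 *: (f (h *: v + (x + t *: v)) - f (x + t *: v))).
  by apply/funext => h; rewrite scalerDl [h *: 1]mulr1 addrCA.
by apply: DeriveDef; rewrite /derivable /derive /shift /= E.
Qed.

(** Corners of a path from [x] to [x + xi] that changes one coordinate at a time, so that increments
    are controlled by partial derivatives alone. *)
Definition coord_path (x xi : 'rV[R]_n) (k : nat) : 'rV[R]_n :=
  \row_i (x 0 i + (if (i < k)%N then xi 0 i else 0)).

Lemma mvt_line f x v (g : R -> R) (t : R) :
  (forall s : R, 0 <= s <= 1 -> is_derive (x + (s * t) *: v) v f (g s)) ->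
  exists2 s : R, 0 <= s <= 1 & f (x + t *: v) - f x = t * g s.
Proof.
move=> H; pose G (r : R) := f (x + r *: v).
have dF (s : R) : 0 <= s <= 1 -> is_derive s 1 (G \o *%R^~ t) (t * g s).
  move=> s01; have dG : is_derive (s * t) 1 G (g s) by apply: is_derive_line; exact: H.
  have dm : is_derive s 1 (fun r : R => r * t) t.
    have -> : (fun r : R => r * t) = t \*: (@id R) by apply/funext => r /=; rewrite mulrC.
    by apply: is_derive_eq; rewrite scaler1.
  rewrite mulrC; exact: (@is_derive1_comp R G (fun r => r * t)).
have [| |] := @MVT_segment R (G \o *%R^~ t) (fun s => t * g s) 0 1 ler01.
- by move=> s; rewrite in_itv /= => /andP[s0 s1]; apply: dF; rewrite !ltW.
- apply: derivable_within_continuous => s; rewrite in_itv /= => s01.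
  by case: (dF _ s01).
move=> s; rewrite in_itv /= => s01.
rewrite /G /= mul1r mul0r scale0r addr0 subr0 mulr1 => ->.
by exists s.
Qed.

Lemma mvt_coord f (g : 'I_n -> 'rV[R]_n -> R) x (d : R) (xi : 'rV[R]_n) :
  (forall y, (forall i, `|y 0 i - x 0 i| <= d) ->
     forall i, is_derive y (delta_mx 0 i) f (g i y)) ->
  (forall i, `|xi 0 i| <= d) ->
  exists Z : 'I_n -> 'rV[R]_n, (forall k i, `|Z k 0 i - x 0 i| <= d) /\
    f (x + xi) - f x = \sum_i xi 0 i * g i (Z i).
Proof.
move=> df xid.
have d0 : 'I_n -> 0 <= d by move=> i; apply: le_trans (xid i).
have step (k : 'I_n) : exists z : 'rV[R]_n, (forall i, `|z 0 i - x 0 i| <= d) /\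
    f (coord_path x xi k.+1) - f (coord_path x xi k) = xi 0 k * g k z.
  pose p := coord_path x xi k.
  have inb (s : R) : 0 <= s <= 1 ->
      forall i, `|(p + (s * xi 0 k) *: delta_mx 0 k) 0 i - x 0 i| <= d.
    move=> /andP[s0 s1] i; rewrite !mxE eqxx /=.
    rewrite -(addrA (x 0 i)) addrAC subrr add0r.
    case: ltngtP => ik.
    - by rewrite -val_eqE /= ltn_eqF// mulr0 addr0.
    - by rewrite -val_eqE /= gtn_eqF// mulr0 addr0 normr0 d0.
    - rewrite -val_eqE /= ik eqxx mulr1 add0r normrM ger0_norm//.
      by rewrite (le_trans _ (xid k))// ler_piMl.
  have [s s01 E] := @mvt_line f p (delta_mx 0 k)
    (fun s => g k (p + (s * xi 0 k) *: delta_mx 0 k)) (xi 0 k)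
    (fun s s01 => df _ (inb s s01) k).
  exists (p + (s * xi 0 k) *: delta_mx 0 k); split; first exact: inb.
  rewrite -E; congr (f _ - _); apply/rowP => i; rewrite !mxE eqxx /= ltnS.
  rewrite -val_eqE /=; case: ltngtP => ik; rewrite ?mulr0 ?addr0 ?mulr1//.
  by congr (_ + _); congr (xi _ _); apply/val_inj.
have /choice[Z HZ] := step; exists Z; split; first by move=> k; case: (HZ k).
rewrite (eq_bigr _ (fun k _ => esym (HZ k).2)).
rewrite -(big_mkord xpredT (fun k => f (coord_path x xi k.+1) - f (coord_path x xi k))).
rewrite telescope_sumr//; congr (f _ - f _); apply/rowP => i; rewrite !mxE ?ltn_ord//.
by rewrite addr0.
Qed.

End Box.

Section C1.
Context {R : realType} {n : nat}.
Implicit Types (x y v xi : 'rV[R]_n) (U A : set 'rV[R]_n) (f : 'rV[R]_n -> R).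

(** The partial derivatives are carried as data, so that the rules of calculus below produce
    explicit formulas for them. *)
Definition C1on U f (g : 'I_n -> 'rV[R]_n -> R) : Prop :=
  forall x, U x -> forall i,
    is_derive x (delta_mx 0 i) f (g i x) /\ {for x, continuous (g i)}.

Definition C2on U f (g : 'I_n -> 'rV[R]_n -> R) (H : 'I_n -> 'I_n -> 'rV[R]_n -> R) : Prop :=
  C1on U f g /\ forall i, C1on U (g i) (H i).

Lemma near_family (I : finType) (g : I -> 'rV[R]_n -> R) x (e : R) :
  0 < e -> (forall i, {for x, continuous (g i)}) ->
  exists2 d : R, 0 < d & forall y, box x d y -> forall i, `|g i y - g i x| < e.
Proof.
move=> e0 cg.
have /choice[D HD] : forall i, exists d : R, 0 < d /\
    forall y, box x d y -> `|g i y - g i x| < e.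
  by move=> i; have [d d0 Hd] := continuous_box (cg i) e0; exists d.
exists (\big[Num.min/1]_i D i).
  by apply/bigmin_gtP; split=> [|i _]; [exact: ltr01|case: (HD i)].
move=> y xy i; apply: (HD i).2; apply: le_box xy; exact: bigmin_le.
Qed.

(** Differentiability made uniform in the base point: [y] varies near [x] along with the increment,
    which is the form [compact_uniform] asks for. *)
Lemma C1on_lin U f g x (e : R) : open U -> C1on U f g -> U x -> 0 < e ->
  exists2 d : R, 0 < d & forall y xi (h : R), box x d y -> 0 < h -> h < d ->
    (forall i, `|xi 0 i| <= h) ->
    `|f (y + xi) - f y - \sum_i xi 0 i * g i y| <= e * h.
Proof.
move=> oU fg Ux e0; pose N : R := n%:R + 1.
have N0 : 0 < N by rewrite ltr_wpDl.
have e'0 : 0 < e / N / 2 by rewrite !divr_gt0.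
have [d1 d10 H1] := near_family e'0 (fun i => (fg _ Ux i).2).
have [d2 d20 H2] := open_box oU Ux.
exists (Num.min d1 d2 / 2); first by rewrite divr_gt0// lt_min d10.
move=> y xi h xy h0 hd xih.
have near (z : 'rV[R]_n) : (forall i, `|z 0 i - y 0 i| <= h) -> box x d1 z /\ box x d2 z.
  move=> yz; have : box x (Num.min d1 d2 / 2 + Num.min d1 d2 / 2) z.
    by apply: box_sub xy _ _ => i; apply: le_lt_trans (yz i) hd.
  by rewrite -splitr => xz; split; apply: le_box xz; rewrite ge_min lexx ?orbT.
have [|Z [Zh ->]] := @mvt_coord R n f g y h xi _ xih.
  by move=> z yz i; case: (near z yz) => _ /H2 Uz; case: (fg _ Uz i).
rewrite -sumrB (le_trans (ler_norm_sum _ _ _))//.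
have -> : e * h = e / N * h * N by rewrite mulrAC divfK// gt_eqF.
rewrite (@le_trans _ _ (\sum_(i < n) e / N * h))//; last first.
  rewrite sumr_const card_ord -mulr_natr ler_wpM2l ?lerDl//.
  by rewrite !mulr_ge0// ?invr_ge0 ltW.
apply: ler_sum => i _; rewrite -mulrBr normrM mulrC ler_pM//.
have /H1/(_ i) a : box x d1 (Z i) by case: (near _ (Zh i)).
have /H1/(_ i) b : box x d1 y by case: (near y) => // j; rewrite subrr normr0 ltW.
rewrite -(subrKA (g i x)) (le_trans (ler_normD _ _))// (splitr (e / N)).
by rewrite lerD// ltW// distrC.
Qed.

Lemma C1on_bound U f g x : open U -> C1on U f g -> U x ->
  exists C : R, exists2 d : R, 0 < d & forall xi (h : R), 0 < h -> h < d ->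
    (forall i, `|xi 0 i| <= h) -> `|f (x + xi) - f x| <= C * h.
Proof.
move=> oU fg Ux; have [d d0 H] := C1on_lin oU fg Ux ltr01.
exists (\sum_i `|g i x| + 1), d => // xi h h0 hd xih.
have := H x xi h (box_refl _ d0) h0 hd xih.
rewrite -{2}(subrK (\sum_i xi 0 i * g i x) (f (x + xi) - f x)) => le1.
rewrite (le_trans (ler_normD _ _))// mulrDl addrC lerD//.
rewrite (le_trans (ler_norm_sum _ _ _))// mulr_suml ler_sum// => i _.
by rewrite normrM mulrC ler_wpM2l.
Qed.

Lemma C1on_continuous U f g x : open U -> C1on U f g -> U x -> {for x, continuous f}.
Proof.
move=> oU fg Ux; have [C [d d0 H]] := C1on_bound oU fg Ux.
apply: box_continuous => e e0; pose h := Num.min (d / 2) (e / (`|C| + 1) / 2).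
have C0 : 0 < `|C| + 1 by rewrite ltr_wpDl.
have h0 : 0 < h by rewrite lt_min !divr_gt0.
exists h => // y xy; have Ey : y = x + (y - x) by rewrite addrC subrK.
rewrite {1}Ey.
have hd : h < d by rewrite gt_min ltr_pdivrMr// ltr_pMr// ltr1n.
rewrite (le_lt_trans (H (y - x) h h0 hd _))//.
  by move=> i; rewrite !mxE; exact/ltW/xy.
rewrite (@le_lt_trans _ _ ((`|C| + 1) * h))//.
  by rewrite ler_wpM2r ?(ltW h0)// (le_trans (ler_norm C))// lerDl.
rewrite mulrC -ltr_pdivlMr// gt_min; apply/orP; right.
by rewrite ltr_pdivrMr// ltr_pMr ?divr_gt0// ltr1n.
Qed.

Lemma is_derive_eps (V : normedModType R) (f : V -> R) (x v : V) (l : R) :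
  (forall e : R, 0 < e -> exists2 d : R, 0 < d & forall h : R, `|h| < d ->
     `|f (x + h *: v) - f x - h * l| <= e * `|h|) -> is_derive x v f l.
Proof.
move=> H.
have cv : (fun h : R => h^-1 *: (f (h *: v + x) - f x)) @ 0^' --> l.
  apply/cvgrPdist_le => e e0; have [d d0 Hd] := H _ e0.
  near=> h; have h0 : h != 0 by near: h; exact: nbhs_dnbhs_neq.
  have hd : `|h| < d by near: h; exact: dnbhs0_lt.
  have -> : l - h^-1 *: (f (h *: v + x) - f x) =
      - (h^-1 * (f (x + h *: v) - f x - h * l)).
    by rewrite [x + _]addrC mulrBr mulKf// opprB.
  by rewrite normrN normrM normfV ler_pdivrMl ?normr_gt0// [leRHS]mulrC; exact: Hd.
by apply: DeriveDef; [apply/cvg_ex; exists l|exact: cvg_lim].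
Unshelve. all: by end_near. Qed.

Lemma is_derive_line0 f x v (l : R) :
  is_derive (0 : R) 1 (fun s : R => f (x + s *: v)) l <-> is_derive x v f l.
Proof.
have E : (fun h : R => h^-1 *: (f (x + (h *: 1 + 0) *: v) - f (x + 0 *: v))) =
    (fun h : R => h^-1 *: (f (h *: v + x) - f x)).
  by apply/funext => h; rewrite addr0 [h *: 1]mulr1 scale0r addr0 [x + _]addrC.
by split=> -[]; rewrite /derivable /derive /shift /= ?E => a b;
  apply: DeriveDef; rewrite /derivable /derive /shift /= ?E.
Qed.

Lemma C1on_dir U f g x v : open U -> C1on U f g -> U x ->
  is_derive x v f (\sum_i v 0 i * g i x).
Proof.
move=> oU fg Ux; apply: is_derive_eps => e e0.
pose V := \sum_i `|v 0 i| + 1.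
have V0 : 0 < V by rewrite ltr_wpDl// sumr_ge0.
have vV i : `|v 0 i| <= V.
  rewrite /V (bigD1 i)//= -addrA lerDl addr_ge0// sumr_ge0//.
have [d d0 H] := C1on_lin oU fg Ux (divr_gt0 e0 V0).
exists (d / V); first exact: divr_gt0.
move=> h hd; have [->|h0] := eqVneq h 0.
  by rewrite scale0r addr0 subrr mul0r subr0 normr0 mulr0.
have hh : 0 < `|h| * V by rewrite mulr_gt0// normr_gt0.
have := H x (h *: v) (`|h| * V) (box_refl _ d0) hh; rewrite -ltr_pdivlMr// => /(_ hd).
rewrite mulr_sumr (eq_bigr (fun i => h * (v 0 i * g i x))); last first.
  by move=> i _; rewrite mxE mulrA.
move=> /(_ _)/le_trans; apply.
  by move=> i; rewrite mxE normrM ler_wpM2l.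
by rewrite mulrCA divfK ?gt_eqF// mulrC.
Qed.

End C1.

Section C1Operations.
Context {R : realType} {n : nat}.
Implicit Types (x y v xi : 'rV[R]_n) (U A : set 'rV[R]_n) (f : 'rV[R]_n -> R).

Lemma C1on_ext U f g (f' : 'rV[R]_n -> R) (g' : 'I_n -> 'rV[R]_n -> R) :
  C1on U f g -> f =1 f' -> (forall i, g i =1 g' i) -> C1on U f' g'.
Proof.
move=> + ff gg; have -> : f' = f by apply/funext => x; rewrite ff.
by have -> : g' = g by apply/funext => i; apply/funext => x; rewrite gg.
Qed.

Lemma C1on_sub U V f g : U `<=` V -> C1on V f g -> C1on U f g.
Proof. by move=> UV fg x /UV; exact: fg. Qed.

Lemma C1on_cst U (c : R) : C1on U (fun=> c) (fun _ _ => 0).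
Proof.
move=> x Ux i; split; first exact: is_derive_cst.
exact: cst_continuous.
Qed.

Lemma C1on_add U f1 f2 g1 g2 : C1on U f1 g1 -> C1on U f2 g2 ->
  C1on U (fun x => f1 x + f2 x) (fun i x => g1 i x + g2 i x).
Proof.
move=> H1 H2 x Ux i; have [d1 c1] := H1 _ Ux i; have [d2 c2] := H2 _ Ux i.
by split; [exact: is_deriveD|exact: continuousD].
Qed.

Lemma C1on_mul U f1 f2 g1 g2 : open U -> C1on U f1 g1 -> C1on U f2 g2 ->
  C1on U (fun x => f1 x * f2 x) (fun i x => f1 x * g2 i x + f2 x * g1 i x).
Proof.
move=> oU H1 H2 x Ux i; have [d1 c1] := H1 _ Ux i; have [d2 c2] := H2 _ Ux i.
have e1 := C1on_continuous oU H1 Ux; have e2 := C1on_continuous oU H2 Ux.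
by split; [exact: is_deriveM|apply: continuousD; apply: continuousM].
Qed.

Lemma C1on_sum U (I : finType) (F : I -> 'rV[R]_n -> R) (G : I -> 'I_n -> 'rV[R]_n -> R) :
  (forall k, C1on U (F k) (G k)) ->
  C1on U (fun x => \sum_k F k x) (fun i x => \sum_k G k i x).
Proof.
move=> H; elim: (index_enum I) => [|k s IH].
  by apply: (C1on_ext (C1on_cst (U:=U) 0)) => [x|i x]; rewrite big_nil.
by apply: (C1on_ext (C1on_add (H k) IH)) => [x|i x]; rewrite big_cons.
Qed.

Lemma C1on_coord U (i : 'I_n) : C1on U (fun x => x 0 i) (fun j _ => (i == j)%:R).
Proof.
move=> x Ux j; split; last exact: cst_continuous.
apply: is_derive_eps => e e0; exists 1 => // h _.
by rewrite !mxE eqxx /= addrAC addrK subrr normr0 mulr_ge0// ltW.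
Qed.

Lemma C1on_comp U f g (G G' : R -> R) : open U -> C1on U f g ->
  (forall x, U x -> is_derive (f x) 1 G (G' (f x)) /\ {for f x, continuous G'}) ->
  C1on U (G \o f) (fun i x => G' (f x) * g i x).
Proof.
move=> oU fg HG x Ux i; have [df cg] := fg _ Ux i; have [dG cG'] := HG _ Ux.
have cf := C1on_continuous oU fg Ux.
split; last by apply: continuousM => //; exact: continuous_comp.
apply/is_derive_line0; apply: (@is_derive1_comp R G (fun s => f (x + s *: _))).
  by rewrite scale0r addr0.
exact/is_derive_line0.
Qed.

Lemma C1on_affine U f g (a : 'rV[R]_n) (r : R) : open U -> C1on U f g ->
  C1on [set y | U (a + r *: y)] (fun y => f (a + r *: y)) (fun i y => r * g i (a + r *: y)).
Proof.
move=> oU fg y Uy i; have [df cg] := fg _ Uy i.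
have ca : {for y, continuous (fun y : 'rV[R]_n => a + r *: y)}.
  by apply: continuousD; [exact: cst_continuous|exact: scaler_continuous].
split; last first.
  apply: continuousM; first exact: cst_continuous.
  exact: (@continuous_comp _ _ _ (fun y => a + r *: y) (g i)).
apply/is_derive_line0.
have -> : (fun s : R => f (a + r *: (y + s *: delta_mx 0 i))) =
    (fun s => f (a + r *: y + s *: (r *: delta_mx 0 i))).
  by apply/funext => s; rewrite scalerDr addrA !scalerA (mulrC s).
apply/is_derive_line0.
have := C1on_dir (r *: delta_mx 0 i) oU fg Uy.
rewrite (bigD1 i)//= big1 ?addr0; first by rewrite !mxE !eqxx mulr1.
by move=> j ji; rewrite !mxE eqxx (negPf ji) mulr0 mul0r.
Qed.

End C1Operations.

Section C2.
Context {R : realType} {n : nat}.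
Implicit Types (x y v xi : 'rV[R]_n) (U A : set 'rV[R]_n) (f : 'rV[R]_n -> R)
  (g : 'I_n -> 'rV[R]_n -> R) (H : 'I_n -> 'I_n -> 'rV[R]_n -> R).

Lemma C2on_comp U f g H (G G' G'' : R -> R) : open U -> C2on U f g H ->
  (forall x, U x -> [/\ is_derive (f x) 1 G (G' (f x)),
     is_derive (f x) 1 G' (G'' (f x)) & {for f x, continuous G''}]) ->
  C2on U (G \o f) (fun i x => G' (f x) * g i x)
    (fun i j x => G'' (f x) * g i x * g j x + G' (f x) * H i j x).
Proof.
move=> oU [fg gH] HG; split.
  apply: C1on_comp => // x Ux; case: (HG _ Ux) => d1 d2 _; split=> //.
  apply/differentiable_continuous/derivable1_diffP; by case: d2.
move=> i; have H1 : C1on U (G' \o f) (fun i x => G'' (f x) * g i x).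
  by apply: C1on_comp => // x Ux; case: (HG _ Ux).
apply: (C1on_ext (C1on_mul oU H1 (gH i))) => // j x /=.
by rewrite addrC mulrCA mulrA.
Qed.

Lemma C2on_affine U f g H a (r : R) : open U -> C2on U f g H ->
  C2on [set y | U (a + r *: y)] (fun y => f (a + r *: y))
    (fun i y => r * g i (a + r *: y)) (fun i j y => r ^+ 2 * H i j (a + r *: y)).
Proof.
move=> oU [fg gH]; split; first exact: C1on_affine.
move=> i; have oV : open [set y | U (a + r *: y)].
  apply: open_comp oU => y _.
  by apply: continuousD; [exact: cst_continuous|exact: scaler_continuous].
have := C1on_mul oV (C1on_cst r) (C1on_affine (a := a) (r := r) oU (gH i)).
by move=> /C1on_ext; apply=> // j y; rewrite mulr0 addr0 mulrA expr2.
Qed.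

Lemma C2on_sub U V f g H : U `<=` V -> C2on V f g H -> C2on U f g H.
Proof. by move=> UV [fg gH]; split=> [|i]; apply: C1on_sub UV _. Qed.

Definition sqn (x : 'rV[R]_n) : R := \sum_i x 0 i ^+ 2.

Lemma C2on_sqn U (c : 'rV[R]_n) : C2on U (fun x => sqn (x - c))
  (fun i x => 2 * (x 0 i - c 0 i)) (fun i j _ => 2 * (i == j)%:R).
Proof.
apply: (@C2on_sub U setT) => //.
have Hc (i : 'I_n) : C1on setT (fun x : 'rV[R]_n => x 0 i - c 0 i) (fun j _ => (i == j)%:R).
  by apply: (C1on_ext (C1on_add (C1on_coord i) (C1on_cst (- c 0 i)))) => // j x;
    rewrite addr0.
split.
  apply: (C1on_ext (C1on_sum (fun i => C1on_mul openT (Hc i) (Hc i)))) => [x|k x].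
    by apply: eq_bigr => i _; rewrite !mxE -expr2.
  rewrite (bigD1 k)//= big1 ?addr0; first by rewrite eqxx !mulr1 -mulr2n mulr_natl.
  by move=> i /negPf ->; rewrite mulr0 addr0.
move=> i; apply: (C1on_ext (C1on_mul openT (C1on_cst (2 : R)) (Hc i))) => // j x.
by rewrite mulr0 addr0.
Qed.

Lemma C2on_add U f1 f2 g1 g2 H1 H2 : C2on U f1 g1 H1 -> C2on U f2 g2 H2 ->
  C2on U (fun x => f1 x + f2 x) (fun i x => g1 i x + g2 i x)
    (fun i j x => H1 i j x + H2 i j x).
Proof. by move=> [a1 b1] [a2 b2]; split=> [|i]; apply: C1on_add. Qed.

Lemma C2on_scale U (k : R) f g H : open U -> C2on U f g H ->
  C2on U (fun x => k * f x) (fun i x => k * g i x) (fun i j x => k * H i j x).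
Proof.
move=> oU [a b]; split=> [|i].
  by apply: (C1on_ext (C1on_mul oU (C1on_cst k) a)) => // i x; rewrite mulr0 addr0.
by apply: (C1on_ext (C1on_mul oU (C1on_cst k) (b i))) => // j x; rewrite mulr0 addr0.
Qed.

Lemma mvt_closed (F F' : R -> R) (a b : R) : a <= b ->
  (forall t, a <= t <= b -> is_derive t 1 F (F' t)) ->
  exists2 t, a <= t <= b & F b - F a = F' t * (b - a).
Proof.
move=> ab dF; have [| |t] := @MVT_segment R F F' a b ab.
- by move=> t; rewrite in_itv /= => /andP[a1 a2]; apply: dF; rewrite !ltW.
- apply: derivable_within_continuous => s; rewrite in_itv /= => sab.
  by case: (dF _ sab).
by rewrite in_itv /=; exists t.
Qed.

Lemma is_derive_val (F : R -> R) (t a b : R) : a = b -> is_derive t 1 F a -> is_derive t 1 F b.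
Proof. by move=> ->. Qed.

(** The mean value theorem is applied to the symmetrized F(t) + F(-t) - c t^2, then to F' on
    [-s, s]. Only the oscillation of F'' enters, so no third derivative is required. *)
Lemma second_difference (F F' F'' : R -> R) (h c e : R) : 0 <= h ->
  (forall t : R, `|t| <= h -> [/\ is_derive t 1 F (F' t), is_derive t 1 F' (F'' t) &
     `|F'' t - c| <= e]) ->
  `|F h + F (- h) - 2 * F 0 - h ^+ 2 * c| <= 2 * e * h ^+ 2.
Proof.
move=> h0 HF.
have e0 : 0 <= e by have [|_ _] := HF 0; [rewrite normr0|exact: le_trans].
pose P (t : R) := F t + F (- t) - t ^+ 2 * c.
pose P' (t : R) := F' t - F' (- t) - 2 * t * c.
have dP (t : R) : 0 <= t <= h -> is_derive t 1 P (P' t).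
  move=> /andP[t0 th]; have [|d1 _ _] := HF t; first by rewrite ger0_norm.
  have [|d2 _ _] := HF (- t); first by rewrite normrN ger0_norm.
  have d3 : is_derive t 1 (F \o -%R) (F' (- t) * -1) by exact: is_derive1_comp.
  have d4 : is_derive t 1 (fun s : R => s ^+ 2 * c) (2 * t * c).
    have := is_deriveM (is_deriveX 2 (is_derive_id t (1 : R))) (is_derive_cst c t (1 : R)).
    by apply: is_derive_val; rewrite scaler0 add0r expr1 [(_ * t)%:A]mulr1; exact: mulrC.
  have := is_deriveB (is_deriveD d1 d3) d4.
  by apply: is_derive_val; rewrite /P' mulrN1.
have [s /andP[s0 sh] E] := mvt_closed h0 dP.
have -> : F h + F (- h) - 2 * F 0 - h ^+ 2 * c = P h - P 0.
  by rewrite /P oppr0 expr0n mul0r subr0 mulr_natl mulr2n addrAC.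
rewrite E subr0 normrM (ger0_norm h0).
have [||z /andP[z1 z2] E'] := @mvt_closed F' F'' (- s) s; first by rewrite ge0_cp.
  move=> t /andP[t1 t2]; have [|//] := HF t.
  by rewrite (le_trans _ sh)// ler_norml t1.
have -> : P' s = 2 * s * (F'' z - c) by rewrite /P' E'; ring.
rewrite !normrM (ger0_norm s0) ger0_norm// expr2 mulrA ler_wpM2r//.
rewrite mulrAC -!mulrA ler_wpM2l// [leRHS]mulrC mulrC ler_pM//.
by have [|] := HF z => //; rewrite (le_trans _ sh)// ler_norml z1.
Qed.

(** The second-difference stencil without the factor h^-2: it approximates h^2 times the
    Laplacian. *)
Definition lap h f x : R :=
  \sum_i (f (x + h *: delta_mx 0 i) + f (x - h *: delta_mx 0 i) - 2 * f x).

End C2.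

Section C2Local.
Context {R : realType} {n : nat}.
Implicit Types (x y v xi : 'rV[R]_n) (U A : set 'rV[R]_n) (f : 'rV[R]_n -> R)
  (g : 'I_n -> 'rV[R]_n -> R) (H : 'I_n -> 'I_n -> 'rV[R]_n -> R).

Lemma C2on_line2 U f g H x v (t : R) : open U -> C2on U f g H ->
  U (x + t *: v) ->
  is_derive t 1 (fun s : R => \sum_i v 0 i * g i (x + s *: v))
    (\sum_i \sum_j v 0 i * v 0 j * H i j (x + t *: v)).
Proof.
move=> oU [_ gH] Ux.
have c1 : C1on U (fun y => \sum_i v 0 i * g i y) (fun j y => \sum_i v 0 i * H i j y).
  apply: C1on_sum => i.
  by apply: (C1on_ext (C1on_mul oU (C1on_cst (v 0 i)) (gH i))) => // j y; rewrite mulr0 addr0.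
have := is_derive_line (C1on_dir v oU c1 Ux).
apply: is_derive_val; rewrite exchange_big /=; apply: eq_bigr => i _.
by rewrite mulr_sumr; apply: eq_bigr => j _; rewrite mulrA (mulrC (v 0 i)).
Qed.

(** The shift [xi] is there because the stencil sits at a lattice point while the Hessian is known
    at a nearby contact point. *)
Lemma C2on_lap U f g H x (e : R) : open U -> C2on U f g H -> U x -> 0 < e ->
  exists2 d : R, 0 < d & forall y (h : R), box x d y -> 0 < h -> h < d ->
    forall xi, (forall i, `|xi 0 i| <= h) ->
    `|lap h f (y + xi) - h ^+ 2 * \sum_i H i i y| <= e * h ^+ 2.
Proof.
move=> oU fH Ux e0; pose N : R := n%:R + 1.
have N0 : 0 < N by rewrite ltr_wpDl.
have e'0 : 0 < e / N / 2 / 2 by rewrite !divr_gt0.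
have [d1 d10 H1] := near_family e'0 (fun i => (fH.2 i _ Ux i).2).
have [d2 d20 H2] := open_box oU Ux.
(* One third each for the distance from [x] to [y], for the shift [xi] and for the stencil. *)
pose d := Num.min d1 d2 / 3.
have d0 : 0 < d by rewrite divr_gt0// lt_min d10.
exists d => // y h xy h0 hd xi xih.
have near (z : 'rV[R]_n) : (forall i, `|z 0 i - y 0 i| <= 2 * h) -> box x d1 z /\ box x d2 z.
  move=> yz; have : box x (d + (d + d)) z.
    apply: box_sub xy _ _ => i; apply: le_lt_trans (yz i) _.
    by rewrite mulr_natl mulr2n ltrD.
  have -> : d + (d + d) = Num.min d1 d2 by rewrite /d; field.
  by move=> xz; split; apply: le_box xz; rewrite ge_min lexx ?orbT.
have ybox : box x d1 y.
  by case: (near y) => // i; rewrite subrr normr0 mulr_ge0// ltW.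
rewrite /lap mulr_sumr -sumrB (le_trans (ler_norm_sum _ _ _))//.
rewrite (@le_trans _ _ (\sum_(i < n) e / N * h ^+ 2))//; last first.
  rewrite sumr_const card_ord -mulr_natr mulrAC ler_wpM2r ?exprn_ge0 ?ltW//.
  by rewrite mulrAC ltr_pdivrMr// ltr_pM2l// ltrDl.
apply: ler_sum => i _.
have pt (t : R) : `|t| <= h -> forall j, `|(y + xi + t *: delta_mx 0 i) 0 j - y 0 j| <= 2 * h.
  move=> th j; rewrite !mxE eqxx /= -(addrA (y 0 j)) addrAC subrr add0r.
  rewrite (le_trans (ler_normD _ _))// mulr_natl mulr2n lerD// normrM.
  by case: (j == i); rewrite ?normr1 ?mulr1// normr0 mulr0 ltW.
have := @second_difference R (fun s => f (y + xi + s *: delta_mx 0 i))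
  (fun s => g i (y + xi + s *: delta_mx 0 i)) (fun s => H i i (y + xi + s *: delta_mx 0 i))
  h (H i i y) (e / N / 2) (ltW h0).
rewrite scale0r addr0 scaleNr (mulrCA 2) divff// mulr1; apply.
move=> t th; have [b1 b2] := near _ (pt t th); have Uz := H2 _ b2.
split.
- by apply: is_derive_line; case: (fH.1 _ Uz i).
- by apply: is_derive_line; case: (fH.2 i _ Uz i).
rewrite -(subrKA (H i i x)) (le_trans (ler_normD _ _))// (splitr (e / N / 2)).
by rewrite lerD// ltW//; [exact: H1|rewrite distrC; exact: H1].
Qed.

Lemma C2on_min U f g H x (d : R) : open U -> C2on U f g H -> U x -> 0 < d ->
  (forall y, box x d y -> f x <= f y) ->
  (forall i, g i x = 0) /\ (forall v, 0 <= \sum_i \sum_j v 0 i * v 0 j * H i j x).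
Proof.
move=> oU fH Ux d0 fmin; split=> [i|v].
  (* The increment is taken with the sign opposite to (-1)^b; minimality and the first order
     expansion then give (-1)^b g_i <= e. *)
  have key (b : bool) : (-1) ^+ b * g i x <= 0.
    apply/ler_addgt0Pl => e e0; rewrite addr0.
    have [d1 d10 H1] := C1on_lin oU fH.1 Ux e0.
    have [h h0 hd] : exists2 h : R, 0 < h & h < d /\ h < d1.
      have m0 : 0 < Num.min d d1 by rewrite lt_min d0.
      exists (Num.min d d1 / 2); first by rewrite divr_gt0.
      by apply/andP; rewrite -lt_min ltr_pdivrMr// ltr_pMr ?ltr1n.
    pose xi : 'rV[R]_n := ((-1) ^+ (~~ b) * h) *: delta_mx 0 i.
    have xih j : `|xi 0 j| <= h.
      rewrite !mxE eqxx /= !normrM normr_sign mul1r (gtr0_norm h0).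
      by case: (j == i); rewrite ?normr1 ?mulr1// normr0 mulr0 ltW.
    have := H1 x xi h (box_refl _ d10) h0 hd.2 xih.
    rewrite (bigD1 i)//= big1 ?addr0; last first.
      by move=> j /negPf ji; rewrite !mxE ji andbF mulr0 mul0r.
    rewrite !mxE !eqxx mulr1 => /ler_normlP[_ le1].
    have le0 : 0 <= f (x + xi) - f x.
      rewrite subr_ge0; apply: fmin => j; rewrite mxE addrAC subrr add0r.
      by rewrite (le_lt_trans (xih j))// hd.1.
    have : (-1) ^+ b * g i x * h <= e * h.
      rewrite (le_trans _ le1)// mulrAC; case: (b) le0; rewrite /= ?expr1 ?expr0; lra.
    by rewrite ler_pM2r.
  have := key true; have := key false; rewrite expr0 expr1; lra.
apply/ler_addgt0Pl => e e0.
pose V : R := \sum_i \sum_j `|v 0 i * v 0 j| + 1.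
have V0 : 0 < V by rewrite ltr_wpDl// sumr_ge0// => i _; rewrite sumr_ge0.
pose W : R := \sum_i `|v 0 i| + 1.
have W0 : 0 < W by rewrite ltr_wpDl// sumr_ge0.
have vW i : `|v 0 i| < W.
  by rewrite /W (bigD1 i)//= -addrA ltrDl ltr_wpDl// sumr_ge0.
have e'0 : 0 < e / 2 / V by rewrite !divr_gt0.
have [d1 d10 H1] := near_family e'0 (fun p : 'I_n * 'I_n => (fH.2 p.1 _ Ux p.2).2).
have [d2 d20 H2] := open_box oU Ux.
have [h h0 hb] : exists2 h : R, 0 < h & h * W < Num.min d (Num.min d1 d2).
  have m0 : 0 < Num.min d (Num.min d1 d2) by rewrite !lt_min d0 d10.
  exists (Num.min d (Num.min d1 d2) / W / 2); first by rewrite !divr_gt0.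
  by rewrite mulrAC divfK ?gt_eqF// ltr_pdivrMr// ltr_pMr ?ltr1n.
have near (t : R) : `|t| <= h -> [/\ box x d (x + t *: v), box x d1 (x + t *: v) &
    box x d2 (x + t *: v)].
  move=> th; have xz : box x (Num.min d (Num.min d1 d2)) (x + t *: v).
    move=> i; rewrite !mxE addrAC subrr add0r normrM (le_lt_trans _ hb)//.
    by rewrite ler_pM// ltW.
  by split; apply: le_box xz; rewrite !ge_min lexx ?orbT.
pose F (t : R) := f (x + t *: v).
have := @second_difference R F (fun t => \sum_i v 0 i * g i (x + t *: v))
  (fun t => \sum_i \sum_j v 0 i * v 0 j * H i j (x + t *: v)) h
  (\sum_i \sum_j v 0 i * v 0 j * H i j x) (e / 2) (ltW h0).
have F0 : F 0 = f x by rewrite /F scale0r addr0.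
have Fh : F 0 <= F h.
  by rewrite F0; apply: fmin; case: (near h) => //; rewrite ger0_norm// ltW.
have Fh' : F 0 <= F (- h).
  by rewrite F0; apply: fmin; case: (near (- h)) => //; rewrite normrN ger0_norm// ltW.
move=> /(_ _)/ler_normlP[].
  move=> t th; have [_ b1 b2] := near t th; have Uz := H2 _ b2; split.
  - by apply: is_derive_line; apply: (C1on_dir v oU fH.1 Uz).
  - exact: (C2on_line2 oU fH Uz).
  rewrite -sumrB (le_trans (ler_norm_sum _ _ _))//.
  have -> : e / 2 = e / 2 / V * V by rewrite divfK// gt_eqF.
  rewrite (@le_trans _ _ (e / 2 / V * \sum_i \sum_j `|v 0 i * v 0 j|))//; last first.
    by rewrite ler_wpM2l ?lerDl// ltW.
  rewrite mulr_sumr ler_sum// => i _.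
  rewrite -sumrB (le_trans (ler_norm_sum _ _ _))// mulr_sumr ler_sum// => j _.
  by rewrite -mulrBr normrM mulrC ler_wpM2r// ltW//; exact: (H1 _ b1 (i, j)).
move=> _; set q := \sum_i _ => le1.
have : 0 <= (q + e) * h ^+ 2 by move: le1; nra.
by rewrite pmulr_lge0 ?exprn_gt0// addrC.
Qed.

Lemma is_derive_shift f x c v (l : R) : is_derive (x + c) v f l ->
  is_derive x v (fun y => f (y + c)) l.
Proof.
move=> /is_derive_line0 df; apply/is_derive_line0.
by under eq_fun do rewrite addrAC.
Qed.

(** The mixed difference f(x + h e_i + h e_j) - f(x + h e_i) - f(x + h e_j) + f(x) is symmetric in i
    and j, and equals h^2 H_ij up to e h^2 in either order. *)
Lemma C2on_sym U f g H x i j : open U -> C2on U f g H -> U x -> H i j x = H j i x.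
Proof.
move=> oU fH Ux.
suff key (e : R) (i' j' : 'I_n) : 0 < e -> exists2 d : R, 0 < d & forall h : R, 0 < h -> h < d ->
    `|f (x + h *: delta_mx 0 i' + h *: delta_mx 0 j') - f (x + h *: delta_mx 0 i') -
      f (x + h *: delta_mx 0 j') + f x - h ^+ 2 * H i' j' x| <= e * h ^+ 2.
  apply/eqP; rewrite -subr_eq0 -normr_eq0 eq_le normr_ge0 andbT.
  apply/ler_addgt0Pl => e e0; rewrite addr0.
  have [d1 d10 H1] := key (e / 2) i j (divr_gt0 e0 (ltr0Sn R 1)).
  have [d2 d20 H2] := key (e / 2) j i (divr_gt0 e0 (ltr0Sn R 1)).
  have [h h0 /andP[h1 h2]] : exists2 h : R, 0 < h & (h < d1) && (h < d2).
    have m0 : 0 < Num.min d1 d2 by rewrite lt_min d10.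
    exists (Num.min d1 d2 / 2); first by rewrite divr_gt0.
    by rewrite -lt_min ltr_pdivrMr// ltr_pMr ?ltr1n.
  have := H1 h h0 h1; have := H2 h h0 h2; rewrite (addrAC x).
  set a := f (x + _ + _); set b := f (x + h *: _); set c := f (x + h *: _).
  move=> /ler_normlP[A1 A2] /ler_normlP[A3 A4].
  have hh : 0 < h ^+ 2 by rewrite exprn_gt0.
  by rewrite -(ler_pM2r hh) -(gtr0_norm hh) -normrM; apply/ler_normlP; split; rewrite (gtr0_norm hh); nra.
move=> e0.
have [d1 d10 H1] := C1on_lin oU (fH.2 i') Ux (divr_gt0 e0 (ltr0Sn R 1)).
have [d2 d20 H2] := near_family (divr_gt0 e0 (ltr0Sn R 1)) (fun p : 'I_n * 'I_n => (fH.2 p.1 _ Ux p.2).2).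
have [d3 d30 H3] := open_box oU Ux.
have [d d0 [D1 D2 D3]] : exists2 d : R, 0 < d & [/\ d <= d1, 2 * d <= d2 & 2 * d <= d3].
  have m0 : 0 < Num.min d1 (Num.min d2 d3) by rewrite !lt_min d10 d20.
  exists (Num.min d1 (Num.min d2 d3) / 2); first by rewrite divr_gt0.
  rewrite (mulrCA 2) divff// mulr1 !ge_min !lexx !orbT; split=> //.
  by rewrite (@le_trans _ _ (Num.min d1 (Num.min d2 d3)))// ?ler_pdivrMr ?ler_pMr ?ler1n// ge_min lexx.
exists d => // h h0 hd.
have dl (t : R) k l : `|t| <= h -> `|(t *: delta_mx 0 k : 'rV[R]_n) 0 l| <= h.
  move=> th; rewrite !mxE eqxx /= normrM.
  by case: (l == k); rewrite ?normr1 ?mulr1// normr0 mulr0 ltW.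
pose P y := f (y + h *: delta_mx 0 j') - f y.
have near (s : R) : 0 <= s <= 1 -> box x d (x + (s * h) *: delta_mx 0 i').
  move=> /andP[s0 s1] k; rewrite mxE addrAC subrr add0r (le_lt_trans _ hd)// dl//.
  by rewrite ger0_norm ?mulr_ge0 ?(ltW h0)// ler_piMl ?(ltW h0).
have near2 (s : R) (b : bool) : 0 <= s <= 1 -> box x (2 * d) (x + (s * h) *: delta_mx 0 i' + (b%:R * h) *: delta_mx 0 j').
  move=> s01; rewrite mulr_natl mulr2n.
  apply: (box_sub (near s s01)) => l; rewrite mxE addrAC subrr add0r (le_lt_trans _ hd)// dl//.
  by case: b; rewrite ?mul1r ?mul0r ?normr0 ?(ltW h0)// ger0_norm// ltW.
have [|s s01 E] := @mvt_line R n P x (delta_mx 0 i')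
    (fun s => g i' (x + (s * h) *: delta_mx 0 i' + h *: delta_mx 0 j') -
       g i' (x + (s * h) *: delta_mx 0 i')) h.
  move=> s s01.
  have U1 : U (x + (s * h) *: delta_mx 0 i').
    by have := near2 s false s01; rewrite mul0r scale0r addr0 => /(le_box D3)/H3.
  have U2 : U (x + (s * h) *: delta_mx 0 i' + h *: delta_mx 0 j').
    by have := near2 s true s01; rewrite mul1r => /(le_box D3)/H3.
  apply: is_deriveB; last by case: (fH.1 _ U1 i').
  by apply: is_derive_shift; case: (fH.1 _ U2 i').
set z := x + (s * h) *: delta_mx 0 i' in E.
have -> : f (x + h *: delta_mx 0 i' + h *: delta_mx 0 j') - f (x + h *: delta_mx 0 i') -
      f (x + h *: delta_mx 0 j') + f x = P (x + h *: delta_mx 0 i') - P x by rewrite /P; ring.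
rewrite E.
have := H1 z (h *: delta_mx 0 j') h (le_box D1 (near s s01)) h0 (lt_le_trans hd D1).
move=> /(_ (fun l => dl h j' l _)).
rewrite (bigD1 j')//= big1 ?addr0; last first.
  by move=> k /negPf kj; rewrite !mxE kj andbF mulr0 mul0r.
rewrite !mxE !eqxx mulr1 => /(_ _)/ler_normlP[]; first by rewrite ger0_norm// ltW.
set a := g i' _ - _ => A1 A2.
have := H2 z (le_box _ (near s s01)) => /(_ _ (i', j'))/ltW/ler_normlP[|B1 B2]; first lra.
by rewrite expr2; apply/ler_normlP; split; nra.
Qed.
End C2Local.

(** * The conformal Schouten equation *)

Section Sigma.

Lemma esymf1 (F : comNzRingType) (s : seq F) : esymf 1 s = \sum_(z <- s) z.
Proof.
rewrite /esymf (big_nth 0) big_mkord.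
rewrite (eq_bigl (fun I => I \in [set [set i] | i : 'I_(size s)]%SET)); last first.
  move=> I; apply/idP/imsetP => [/cards1P[i ->]|[i _ ->]]; last by rewrite cards1.
  by exists i.
rewrite big_imset /=; last by move=> i j _ _; exact: finset.set1_inj.
by apply: eq_bigr => i _; rewrite big_set1.
Qed.

Lemma esymf2 (F : comNzRingType) (s : seq F) :
  esymf 2 s *+ 2 = (\sum_(z <- s) z) ^+ 2 - \sum_(z <- s) z ^+ 2.
Proof.
rewrite /esymf [\sum_(z <- s) z](big_nth 0) [\sum_(z <- s) z ^+ 2](big_nth 0) !big_mkord; set n := size s.
pose z (i : 'I_n) := s`_i.
rewrite -[LHS]/((\sum_(I : {set 'I_n} | #|I| == 2) \prod_(i in I) z i) *+ 2).
rewrite -[X in _ = X ^+ 2 - _]/(\sum_i z i) -[X in _ = _ - X]/(\sum_i z i ^+ 2).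
(* Double counting: each two-element set occurs once for each of its elements. *)
have -> : (\sum_(I : {set 'I_n} | #|I| == 2) \prod_(i in I) z i) *+ 2 =
    \sum_(i : 'I_n) \sum_(I : {set 'I_n} | (#|I| == 2) && (i \in I)) \prod_(k in I) z k.
  rewrite -sumrMnl (exchange_big_dep (fun I : {set 'I_n} => #|I| == 2)) /=; last first.
    by move=> i I _ /andP[].
  apply: eq_bigr => I /eqP I2.
  rewrite [RHS](eq_bigl (fun i => i \in I)); last by move=> i; rewrite I2 eqxx.
  by rewrite sumr_const I2.
rewrite expr2 mulr_suml -sumrB; apply: eq_bigr => i _.
rewrite (bigD1 i)//= mulrDr expr2 addrAC subrr add0r mulr_sumr.
rewrite (eq_bigl (fun I => I \in [set [set i; j] | j in [set~ i]]%SET)); last first.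
  move=> I; apply/andP/imsetP => [[/cards2P[x [y [xy ->]]]]|[j + ->]].
    rewrite !inE => /orP[/eqP->|/eqP->]; [exists y|exists x] => //.
      by rewrite !inE eq_sym.
      by rewrite !inE.
    by rewrite finset.setUC.
  by rewrite !inE eqxx => ji; split=> //; rewrite cards2 [i == j]eq_sym ji.
rewrite big_imset /=.
  apply: eq_big => [j|j]; first by rewrite !inE.
  by rewrite !inE => ji; rewrite big_setU1 ?inE 1?eq_sym// big_set1.
move=> j k; rewrite !inE => ji ki E.
have : j \in [set i; k]%SET by rewrite -E !inE eqxx orbT.
by rewrite !inE (negPf ji) => /eqP.
Qed.

Lemma char_poly_conj (F : fieldType) n (P A : 'M[F]_n) : P \in unitmx ->
  char_poly (P *m A *m invmx P) = char_poly A.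
Proof.
move=> Pu; rewrite /char_poly /char_poly_mx.
have E : map_mx polyC P *m map_mx polyC (invmx P) = 1%:M.
  by rewrite -map_mxM mulmxV// map_mx1.
have -> : 'X%:M - map_mx polyC (P *m A *m invmx P) =
    map_mx polyC P *m ('X%:M - map_mx polyC A) *m map_mx polyC (invmx P).
  rewrite !map_mxM mulmxBr mulmxBl; congr (_ - _).
  by rewrite scalar_mxC -mulmxA E mulmx1.
by rewrite !det_mulmx mulrAC -det_mulmx E det1 mul1r.
Qed.

(** By Schur's theorem L is unitarily triangular over R[i]. The diagonal then lists the eigenvalues,
    and squaring a triangular matrix squares its diagonal, so both power sums are traces. *)
Lemma eigen_power_sums (R : realType) n (L : 'M[R]_n.+1) :
  \sum_(z <- eigenvalues L) z = (\tr L)%:C%C /\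
  \sum_(z <- eigenvalues L) z ^+ 2 = (\tr (L *m L))%:C%C.
Proof.
pose M := map_mx (real_complex R) L.
have HM : char_poly M = \prod_(z <- eigenvalues L) ('X - z%:P).
  rewrite /eigenvalues; case: closed_field_poly_normal => s /= E.
  have Ec : map_poly (real_complex R) (char_poly L) = char_poly M by exact: map_char_poly.
  by rewrite Ec (monicP (char_poly_monic M)) scale1r in E.
have [P Pu] := Schur M (ltn0Sn n).
have Puu := unitarymx_unit Pu.
move=> trT0; pose T := P *m M *m invmx P.
have trT : is_trig_mx T by rewrite /T -conjumx.

have HT : \prod_(i <- [seq T i i | i <- index_enum 'I_n.+1]) ('X - i%:P) = \prod_(z <- eigenvalues L) ('X - z%:P).
  by rewrite -HM -(char_poly_conj M Puu) char_poly_trig// big_map.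
have pe := prod_XsubC_eq HT.
rewrite -!(perm_big _ pe) /= !big_map.
have trE : \tr T = \tr M by rewrite /T mxtrace_mulC mulmxA mulVmx// mul1mx.
split; first by rewrite -/(\tr T) trE /M -trace_map_mx.
have -> : \sum_i T i i ^+ 2 = \tr (T *m T).
  apply: eq_bigr => i _; rewrite [RHS]mxE (bigD1 i)//= big1 ?addr0 ?expr2// => j ji.
  have := ji; rewrite neq_ltn => /orP[] ij; move/is_trig_mxP: trT => H.
    by rewrite (H j i)// mulr0.
  by rewrite (H i j)// mul0r.
have -> : T *m T = P *m (M *m M) *m invmx P.
  rewrite /T -!mulmxA; congr (P *m (M *m _)).
  by rewrite (mulmxA (invmx P)) mulVmx// mul1mx.
by rewrite mxtrace_mulC mulmxA mulVmx// mul1mx /M -map_mxM trace_map_mx.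
Qed.

Lemma sigma1E (R : realType) n (L : 'M[R]_n.+1) : sigma 1 L = \tr L.
Proof. by rewrite /sigma esymf1 (eigen_power_sums L).1. Qed.

Lemma sigma2E (R : realType) n (L : 'M[R]_n.+1) :
  2 * sigma 2 L = (\tr L) ^+ 2 - \tr (L *m L).
Proof.
have := esymf2 (eigenvalues L); have [-> ->] := eigen_power_sums L.
move=> /(congr1 (@complex.Re R)); rewrite /sigma raddfMn /= mulr_natl => ->.
by rewrite /= mulr0 subr0 expr2.
Qed.

End Sigma.

Section Conformal.
Context {R : realType} {n : nat}.
Implicit Types (U : set 'rV[R]_n) (w : 'rV[R]_n -> R).

Local Notation D i j := ((i == j)%:R : R).

Lemma sum_delta (f : 'I_n -> R) i : \sum_k D k i * f k = f i.
Proof.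
rewrite (bigD1 i)//= eqxx mul1r big1 ?addr0// => k /negPf ->.
by rewrite mul0r.
Qed.

Lemma sum_delta1 (i : 'I_n) : \sum_k D k i = 1.
Proof. by rewrite (bigD1 i)//= eqxx big1 ?addr0// => k /negPf ->. Qed.

Lemma partialE f g U x i : C1on U f g -> U x -> partial i f x = g i x.
Proof. by move=> fg Ux; case: (fg x Ux i) => df _; rewrite /partial derive_val. Qed.

Lemma Ck_on2 U w : Ck_on 2 U w ->
  C2on U w (fun i => partial i w) (fun i j => partial j (partial i w)).
Proof.
move=> [_ H]; split=> [x Ux i|i x Ux j].
  have [d [c _]] := H i; split; last exact: c.
  by apply: DeriveDef => //; exact: d.
have [_ [_ /(_ j)[d [c _]]]] := H i; split; last exact: c.
by apply: DeriveDef => //; exact: d.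
Qed.

Lemma C1on_conf_metric U w g (j l : 'I_n) : open U -> C1on U w g ->
  C1on U (fun y => conf_metric w y j l)
    (fun i y => D j l * (2 * g i y * expR (2 * w y))).
Proof.
move=> oU wg.
have w2 : C1on U (fun y => 2 * w y) (fun i y => 2 * g i y).
  by apply: (C1on_ext (C1on_mul oU (C1on_cst (2 : R)) wg)) => // i y; rewrite mulr0 addr0.
have e2 : C1on U (expR \o (fun y => 2 * w y)) (fun i y => expR (2 * w y) * (2 * g i y)).
  apply: C1on_comp => // x Ux; split; first exact: is_derive_expR.
  exact: continuous_expR.
apply: (C1on_ext (C1on_mul oU (C1on_cst (D j l)) e2)) => [y|i y].
  by rewrite /conf_metric mxE /= mulr_natl.
by rewrite mulr0 addr0 [expR _ * _]mulrC.
Qed.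

Lemma conf_christoffel U w g k i j y : open U -> C1on U w g -> U y ->
  christoffel (conf_metric w) k i j y = D k j * g i y + D k i * g j y - D i j * g k y.
Proof.
move=> oU wg Uy; rewrite /christoffel /conf_metric invmx_scalar.
have dE (m a b : 'I_n) : partial m (fun y => (expR (2 * w y))%:M a b) y =
    D a b * (2 * g m y * expR (2 * w y)).
  exact: (partialE m (C1on_conf_metric a b oU wg) Uy).
rewrite (eq_bigr (fun l => D l k * (2 * (D k j * g i y + D k i * g j y - D i j * g k y)))); last first.
  move=> l _; rewrite !mxE eq_sym; have [->|_] := eqVneq l k; last by rewrite !mul0r.
  rewrite mul1r mulr1n !dE.
  have e0 : expR (2 * w y) != 0 by rewrite gt_eqF ?expR_gt0.
  by rewrite (eq_sym j k) (eq_sym i k); field.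
by rewrite -mulr_suml sum_delta1; field.
Qed.

Lemma partial_christoffel U w g H k i j m x : open U -> C2on U w g H -> U x ->
  partial m (christoffel (conf_metric w) k i j) x =
  D k j * H i m x + D k i * H j m x - D i j * H k m x.
Proof.
move=> oU [wg gH] Ux.
have c1 : C1on U (fun y => D k j * g i y + (D k i * g j y + (- D i j) * g k y))
   (fun m x => D k j * H i m x + (D k i * H j m x + (- D i j) * H k m x)).
  have cc (c : R) a : C1on U (fun y => c * g a y) (fun m y => c * H a m y).
    by apply: (C1on_ext (C1on_mul oU (C1on_cst c) (gH a))) => // b y; rewrite mulr0 addr0.
  by do 2 (apply: C1on_add; first exact: cc).
have := partialE m c1 Ux; rewrite addrA mulNr => <-.
rewrite /partial; apply: near_eq_derive; apply/nbhs_boxP.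
have [d d0 dU] := open_box oU Ux; exists d => // y /dU Uy.
by rewrite (conf_christoffel _ _ _ oU wg Uy) addrA mulNr.
Qed.

(** The Christoffel symbols of e^(2w) |dx|^2 when [p] is the gradient of w, see [conf_christoffel].
    The quadratic sums in the Ricci tensor are computed for arbitrary [p]. *)
Let G (p : 'I_n -> R) k a b : R := D k b * p a + D k a * p b - D a b * p k.

Lemma trace_christoffel_mul (p : 'I_n -> R) i j :
  \sum_k \sum_l G p k k l * G p l i j =
  n%:R * (2 * p i * p j - D i j * \sum_k p k ^+ 2).
Proof.
rewrite (eq_bigr (fun=> 2 * p i * p j - D i j * \sum_k p k ^+ 2)).
  by rewrite sumr_const card_ord [RHS]mulr_natl.
move=> k _; rewrite (eq_bigr (fun l => D l j * (p i * p l) + D l i * (p j * p l) - D i j * p l ^+ 2)).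
  rewrite big_split /= big_split /= sumrN -mulr_sumr.
  rewrite (sum_delta (fun l => p i * p l)) (sum_delta (fun l => p j * p l)); ring.
by move=> l _; rewrite /G eqxx mul1r; ring.
Qed.

Lemma christoffel_mul_inner (p : 'I_n -> R) i j k :
  \sum_l G p k j l * G p l i k =
  p j * p i + D k j * (p i * p k + p i * p k - D k i * \sum_l p l ^+ 2)
     + D k i * (p j * p k - p j * p k + p k * p j) - D k j * (p k * p i) - D i j * p k ^+ 2.
Proof.
rewrite (eq_bigr (fun l => D l k * (p j * (p i + D k i * p k - D i k * p k)) +
      D k j * (D l k * (p i * p l) + D l i * (p k * p l) - D i k * p l ^+ 2) -
      D l j * (p k * (D l k * p i + D l i * p k - D i k * p l)))).
  rewrite big_split /= big_split /= sumrN -mulr_suml -mulr_sumr sum_delta1.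
  rewrite big_split /= big_split /= sumrN -mulr_sumr.
  rewrite (sum_delta (fun l => p i * p l)) (sum_delta (fun l => p k * p l)).
  rewrite (sum_delta (fun l => p k * (D l k * p i + D l i * p k - D i k * p l))).
  rewrite (eq_sym i k) (eq_sym j k) (eq_sym j i); ring.
move=> l _; rewrite /G (eq_sym k l) (eq_sym j l).
by have [->|lk] := eqVneq l k; rewrite ?eqxx ?mul1r ?mul0r; ring.
Qed.

Lemma christoffel_mul (p : 'I_n -> R) i j :
  \sum_k \sum_l G p k j l * G p l i k =
  (n%:R + 2) * (p i * p j) - 2 * D i j * \sum_k p k ^+ 2.
Proof.
rewrite (eq_bigr _ (fun k _ => christoffel_mul_inner p i j k)).
rewrite sumrB sumrB big_split /= big_split /= sumr_const card_ord -mulr_sumr.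
rewrite (sum_delta (fun k => (p i * p k + p i * p k - D k i * \sum_l p l ^+ 2))).
rewrite (sum_delta (fun k => (p j * p k - p j * p k + p k * p j))).
rewrite (sum_delta (fun k => p k * p i)) -mulr_natl (eq_sym j i); ring.
Qed.

(** The conformal change formula with flat background. The four terms of the intermediate expression
    are the values of the four sums defining [ricci]. *)
Lemma conf_ricci U w g H x i j : open U -> C2on U w g H -> U x ->
  ricci (conf_metric w) x i j =
  (2 - n%:R) * (H i j x - g i x * g j x) -
  D i j * (\sum_k H k k x + (n%:R - 2) * \sum_k g k x ^+ 2).
Proof.
move=> oU wH Ux; have [wg _] := wH.
pose p a := g a x.
have cG k a b : christoffel (conf_metric w) k a b x = G p k a b.
  exact: (conf_christoffel k a b oU wg Ux).
rewrite /ricci mxE.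
transitivity ((H i j x + H j i x - D i j * \sum_k H k k x) - n%:R * H i j x +
  n%:R * (2 * p i * p j - D i j * \sum_k p k ^+ 2) -
  ((n%:R + 2) * (p i * p j) - 2 * D i j * \sum_k p k ^+ 2)); last first.
  have -> : H j i x = H i j x by exact: (C2on_sym j i oU wH Ux).
  rewrite -!/(p _); ring.
congr (_ - _ + _ - _).
- transitivity (\sum_k (D k j * H i k x + D k i * H j k x - D i j * H k k x)).
    by apply: eq_bigr => k _; exact: (partial_christoffel k i j k oU wH Ux).
  by rewrite sumrB big_split /= -mulr_sumr (sum_delta (fun k => H i k x)) (sum_delta (fun k => H j k x)).
- transitivity (\sum_(k < n) H i j x); last by rewrite sumr_const card_ord mulr_natl.
  apply: eq_bigr => k _; rewrite (partial_christoffel _ _ _ _ oU wH Ux) eqxx mul1r (eq_sym k i).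
  by rewrite addrK.
- by rewrite -trace_christoffel_mul; apply: eq_bigr => k _; apply: eq_bigr => l _; rewrite !cG.
- by rewrite -christoffel_mul; apply: eq_bigr => k _; apply: eq_bigr => l _; rewrite !cG.
Qed.

End Conformal.

Section Equation.
Context {R : realType}.
Implicit Types (U : set 'rV[R]_4) (w : 'rV[R]_4 -> R).

Lemma conf_schoutenE U w g H x i j : open U -> C2on U w g H -> U x ->
  conf_schouten w x i j = expR (- 2 * w x) *
    (g i x * g j x - H i j x - (i == j)%:R * (\sum_k g k x ^+ 2 / 2)).
Proof.
move=> oU wH Ux; rewrite /conf_schouten /schouten /scalar_curvature.
have Rc i' j' := conf_ricci i' j' oU wH Ux.
move: (ricci (conf_metric w) x) Rc => Rm Rc.
have i2 : expR (- 2 * w x) = (expR (2 * w x))^-1 by rewrite mulNr expRN.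
have e0 : expR (2 * w x) != 0 by rewrite gt_eqF ?expR_gt0.
rewrite /conf_metric invmx_scalar -i2 !mul_scalar_mx.
(* The scalar curvature in dimension 4, where the factor is -2(n - 1) = -6. *)
have -> : \tr (expR (- 2 * w x) *: Rm) =
    expR (- 2 * w x) * (- 6 * (\sum_k H k k x + \sum_k g k x ^+ 2)).
  rewrite mxtraceZ /mxtrace; congr (_ * _).
  rewrite (eq_bigr (fun k => (2 - 4) * (H k k x - g k x ^+ 2) -
     (\sum_k H k k x + (4 - 2) * \sum_k g k x ^+ 2))).
    rewrite sumrB -mulr_sumr sumrB sumr_const card_ord -mulr_natl; ring.
  by move=> k _; rewrite Rc eqxx mul1r expr2.
rewrite !mxE Rc -[_ *+ (i == j)]mulr_natl i2 -mulr_suml; field.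
by rewrite e0.
Qed.

(** Up to e^(-2w), g^-1 A_g is dw dw - D^2 w - |dw|^2 / 2 times the identity, and 2 sigma_2 = (tr)^2
    - tr of the square. The |dw|^4 terms of the two parts cancel, which leaves the quartic
    identity. *)
Lemma conf_equation U (K w : 'rV[R]_4 -> R) : open U -> admissible_solution U K w ->
  exists g H, C2on U w g H /\ forall x, U x ->
    \sum_i H i i x + \sum_i g i x ^+ 2 < 0 /\
    (\sum_i H i i x) ^+ 2 - \sum_i \sum_j H i j x ^+ 2 +
    (\sum_i g i x ^+ 2) * (\sum_i H i i x) + 2 * \sum_i \sum_j H i j x * (g i x * g j x) =
    2 * K x * expR (4 * w x).
Proof.
move=> oU [/Ck_on2 wH HK]; eexists; eexists; split; first exact: wH.
move=> x Ux; have [[s1 _] s2] := HK _ Ux.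
set g := fun i => partial i w in wH *; set H := fun i j => partial j (partial i w) in wH *.
have AE i j := conf_schoutenE i j oU wH Ux.
set e := expR (- 2 * w x) in AE.
have e0 : 0 < e by exact: expR_gt0.
set S := \sum_i H i i x; set Q := \sum_i g i x ^+ 2.
have q2 : \sum_k g k x ^+ 2 / 2 = Q / 2 by rewrite -mulr_suml.
have trE : \tr (conf_schouten w x) = - e * (S + Q).
  rewrite /mxtrace (eq_bigr (fun i => e * (g i x ^+ 2 - H i i x - Q / 2))); last first.
    by move=> i _; rewrite AE eqxx mul1r -expr2 q2.
  rewrite -mulr_sumr sumrB sumrB sumr_const card_ord -mulr_natl -/S -/Q.
  by field.
have tr2E : \tr (conf_schouten w x *m conf_schouten w x) =
   e ^+ 2 * (\sum_i \sum_j H i j x ^+ 2 - 2 * \sum_i \sum_j H i j x * (g i x * g j x) + Q ^+ 2 + Q * S).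
  transitivity (\sum_i \sum_j e ^+ 2 * (H i j x ^+ 2 - 2 * (H i j x * (g i x * g j x)) +
      g i x ^+ 2 * g j x ^+ 2 + (j == i)%:R * (Q ^+ 2 / 4 - Q * (g i x * g j x - H i j x)))).
    apply: eq_bigr => i _; rewrite mxE; apply: eq_bigr => j _; rewrite !AE q2.
    have -> : H j i x = H i j x by exact: (C2on_sym j i oU wH Ux).
    rewrite (eq_sym i j); have [->|_] := eqVneq j i; rewrite ?eqxx ?mul1r ?mul0r; last by ring.
    by field.
  transitivity (e ^+ 2 * \sum_i (\sum_j H i j x ^+ 2 - 2 * (\sum_j H i j x * (g i x * g j x)) +
      g i x ^+ 2 * Q + (Q ^+ 2 / 4 - Q * (g i x ^+ 2 - H i i x)))).
    rewrite mulr_sumr; apply: eq_bigr => i _; rewrite -mulr_sumr; congr (_ * _).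
    rewrite big_split big_split /= sumrB -mulr_sumr -mulr_sumr.
    by rewrite (sum_delta (fun j => Q ^+ 2 / 4 - Q * (g i x * g j x - H i j x))) expr2.
  congr (_ * _); rewrite !big_split /= !sumrN sumr_const card_ord -[_ *+ 4]mulr_natl.
  rewrite -!mulr_sumr -mulr_suml sumrB -/S -/Q.
  by field.
have sg1 : S + Q < 0 by move: s1; rewrite sigma1E trE mulNr oppr_gt0 pmulr_rlt0.
split=> //; move: (sigma2E (conf_schouten w x)); rewrite s2 trE tr2E => E2.
have -> : expR (4 * w x) = (e ^+ 2)^-1.
  by rewrite /e -expRM_natl -expRN; congr expR; ring.
rewrite E2 -/S -/Q; field.
by rewrite gt_eqF.
Qed.

End Equation.

(** * Lattice sums *)

Section Lattice.
Context {R : realType} {n : nat}.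
Implicit Types (x y o : 'rV[R]_n) (f u phi : 'rV[R]_n -> R).

(** Indices lie in the cyclic groups ['I_m], so that translating a summation index is a
    bijection. *)
Definition lpt m o (h : R) (z : 'rV['I_m]_n) : 'rV[R]_n :=
  \row_i (o 0 i + h * (z 0 i)%:R).

(** Half-open, so that the cells at the points of a lattice are disjoint. *)
Definition cell o (h : R) : set 'rV[R]_n := [set x | forall i, o 0 i <= x 0 i < o 0 i + h].

Lemma lpt_succ m o (h : R) (z : 'rV['I_m.+2]_n) (i : 'I_n) : (z 0%R i < m.+1)%N ->
  lpt o h (z + delta_mx 0 i) = lpt o h z + h *: delta_mx 0 i.
Proof.
move=> zi; apply/rowP => j; rewrite !mxE eqxx /= -addrA; congr (_ + _).
have [->|ji] := eqVneq j i; last by rewrite mulr0 addr0 /= addn0 modn_small.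
rewrite mulr1 /= [(1 %% _)%N]modn_small// addn1 modn_small ?ltnS//.
by rewrite -natr1 mulrDr mulr1.
Qed.

Lemma sum_shift m o (h : R) phi u (i : 'I_n) : 0 < h ->
  (forall x, phi x != 0 -> o 0 i < x 0 i < o 0 i + h * m.+1%:R) ->
  \sum_(z : 'rV['I_m.+2]_n) phi (lpt o h z) * u (lpt o h z + h *: delta_mx 0 i) =
  \sum_(z : 'rV['I_m.+2]_n) phi (lpt o h z - h *: delta_mx 0 i) * u (lpt o h z).
Proof.
move=> h0 supp.
rewrite [RHS](reindex_inj (addIr (delta_mx 0 i))) /=; apply: eq_bigr => z _.
have [zi|zi] := ltnP (z 0%R i) m.+1; first by rewrite lpt_succ// addrK.
have zm : (z 0 i : nat) = m.+1 by apply/eqP; rewrite eqn_leq zi -ltnS ltn_ord.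
have -> : phi (lpt o h z) = 0.
  by apply/eqP/negPn/negP => /supp; rewrite mxE zm ltxx andbF.
rewrite mul0r; suff -> : phi (lpt o h (z + delta_mx 0 i) - h *: delta_mx 0 i) = 0 by rewrite mul0r.
apply/eqP/negPn/negP => /supp /andP[+ _]; rewrite !mxE !eqxx /= zm.
rewrite [(1 %% _)%N]modn_small// addn1 modnn mulr0 addr0 mulr1 ltrDl oppr_gt0.
by rewrite ltNge (ltW h0).
Qed.

Lemma sum_lap m o (h : R) phi u : 0 < h ->
  (forall x, phi x != 0 -> forall i, o 0 i + h < x 0 i < o 0 i + h * m%:R) ->
  \sum_(z : 'rV['I_m.+2]_n) phi (lpt o h z) * lap h u (lpt o h z) =
  \sum_(z : 'rV['I_m.+2]_n) u (lpt o h z) * lap h phi (lpt o h z).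
Proof.
move=> h0 supp; rewrite /lap.
have m1 : h * m%:R < h * m.+1%:R by rewrite ltr_pM2l// ltr_nat.
transitivity (\sum_(i < n) \sum_(z : 'rV['I_m.+2]_n)
    (phi (lpt o h z) * u (lpt o h z + h *: delta_mx 0 i) +
     phi (lpt o h z) * u (lpt o h z - h *: delta_mx 0 i) -
     2 * (phi (lpt o h z) * u (lpt o h z)))).
  rewrite exchange_big /=; apply: eq_bigr => z _; rewrite mulr_sumr.
  by apply: eq_bigr => i _; ring.
transitivity (\sum_(i < n) \sum_(z : 'rV['I_m.+2]_n)
    (phi (lpt o h z - h *: delta_mx 0 i) * u (lpt o h z) +
     phi (lpt o h z + h *: delta_mx 0 i) * u (lpt o h z) -
     2 * (phi (lpt o h z) * u (lpt o h z)))); last first.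
  rewrite exchange_big /=; apply: eq_bigr => z _; rewrite mulr_sumr.
  by apply: eq_bigr => i _; ring.
apply: eq_bigr => i _; rewrite !sumrB !big_split /=; congr (_ + _ - _).
  apply: sum_shift => // x /supp/(_ i)/andP[a b].
  by rewrite (le_lt_trans _ a) ?lerDl ?ltW//= (lt_trans b)// ltrD2l.
(* The backward shift of the pair ([phi], [u]) is the forward shift of this translated pair, read
   from right to left. *)
pose psi x := phi (x + h *: delta_mx 0 i).
pose v x := u (x - h *: delta_mx 0 i).
have E : \sum_(z : 'rV['I_m.+2]_n) psi (lpt o h z) * v (lpt o h z + h *: delta_mx 0 i) =
    \sum_(z : 'rV['I_m.+2]_n) psi (lpt o h z - h *: delta_mx 0 i) * v (lpt o h z).
  apply: sum_shift => // x.
  rewrite /psi => /supp/(_ i)/andP[]; rewrite !mxE !eqxx mulr1 ltrD2r => -> a.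
  by move: a m1 h0 => /=; lra.
rewrite /psi /v in E.
transitivity (\sum_(z : 'rV['I_m.+2]_n) phi (lpt o h z - h *: delta_mx 0 i + h *: delta_mx 0 i) * u (lpt o h z - h *: delta_mx 0 i)).
  by apply: eq_bigr => z _; rewrite subrK.
by rewrite -E; apply: eq_bigr => z _; rewrite addrK.
Qed.

(** The map z -> (key z, z - off (key z)) is injective on A. A constant key counts a cube; a varying
    one counts a skew tube, sliced by its position along the axis. *)
Lemma card_tube m (A : {set 'rV['I_m]_n}) (key : 'rV['I_m]_n -> nat)
    (off : nat -> 'I_n -> int) D1 D2 :
  (forall z, z \in A -> (key z < D1)%N) ->
  (forall z, z \in A -> forall j, off (key z) j <= (z 0 j : nat)%:Z < off (key z) j + D2%:Z) ->
  (#|A| <= D1 * D2 ^ n)%N.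
Proof.
move=> H1 H2.
have [->|/set0Pn[z0 z0A]] := eqVneq A finset.set0; first by rewrite cards0.
case: D1 H1 => [|D1] H1; first by have := H1 _ z0A.
(* Width 0 contradicts [z0] being in A, except in dimension 0, where D2 ^ n is 1 and A has at most
   one element. *)
case: D2 H2 => [|D2] H2.
  case: n z0 A key off H1 z0A H2 => [|k] z0 A key off H1 z0A H2.
    by rewrite expn0 muln1 (leq_trans (max_card _))// card_mx card_ord muln0 expn0.
  by have := H2 _ z0A ord0; rewrite addr0 => /andP[]; lia.
pose F (z : 'rV['I_m]_n) : 'I_D1.+1 * {ffun 'I_n -> 'I_D2.+1} :=
  (inord (key z), [ffun j => inord (absz ((z 0%R j : nat)%:Z - off (key z) j))]).
have Finj : {in A &, injective F}.
  move=> z z' zA z'A [] /(congr1 val); rewrite /= !inordK ?H1// => Ek.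
  move=> /ffunP Ef; apply/rowP => j; apply/val_inj/eqP => /=.
  have := H2 _ zA j; have := H2 _ z'A j; rewrite -Ek => /andP[a1 a2] /andP[b1 b2].
  have absE (c : int) : off (key z) j <= c -> c < off (key z) j + D2.+1%:Z ->
      (absz (c - off (key z) j) < D2.+1)%N /\ Posz (absz (c - off (key z) j)) = c - off (key z) j.
    by move=> c1 c2; rewrite gez0_abs ?subr_ge0//; split=> //; lia.
  have [l1 E1] := absE _ b1 b2; have [l2 E2] := absE _ a1 a2.
  have := congr1 val (Ef j); rewrite !ffunE /= -Ek (inordK l1) (inordK l2).
  by move=> /(congr1 Posz); rewrite E1 E2 => /addIr[] ->.
rewrite -(card_in_imset Finj) (leq_trans (max_card _))//.
by rewrite card_prod card_ffun !card_ord.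
Qed.

(** Each axis contributes at most 2/h + 1 <= 3/h lattice points of the open cube (-1, 1)^n. *)
Lemma card_ball m o (h : R) : 0 < h -> h <= 1 ->
  #|[set z : 'rV['I_m]_n | [forall i, `|lpt o h z 0 i| < 1]]%SET|%:R * h ^+ n <= 3 ^+ n.
Proof.
move=> h0 h1; set A := finset _.
have h20 : 0 <= 2 / h by rewrite divr_ge0 ?ltW.
pose D := (Num.truncn (2 / h)).+1.
have cA : (#|A| <= 1 * D ^ n)%N.
  apply: (@card_tube m A (fun=> 0%N) (fun _ j => Num.ceil ((- 1 - o 0 j) / h))) => // z.
  rewrite inE => /forallP zA j; have := zA j; rewrite mxE ltr_norml => /andP[a b].
  apply/andP; split; first by rewrite ceil_le_int ler_pdivrMr// -pmulrn; lra.
  rewrite -(ltr_int R) rmorphD /= -!pmulrn.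
  apply: lt_le_trans (_ : (1 - o 0 j) / h <= _).
    by rewrite ltr_pdivlMr//; lra.
  have -> : (1 - o 0 j) / h = (- 1 - o 0 j) / h + 2 / h by rewrite -mulrDl; congr (_ / _); ring.
  by rewrite lerD ?ceil_ge// ltW// truncnS_gt.
have DD : D%:R * h <= 3.
  have := truncn_le (2 / h); rewrite h20 ler_pdivlMr// => /= hD.
  by rewrite /D -natr1 mulrDl mul1r; lra.
rewrite mul1n in cA.
rewrite (@le_trans _ _ ((D ^ n)%:R * h ^+ n))//.
  by rewrite ler_wpM2r ?ler_nat// exprn_ge0// ltW.
by rewrite natrX -exprMn lerXn2r// ?nnegrE// mulr_ge0// ltW.
Qed.

End Lattice.

(** * Lower Riemann sums and the Lebesgue integral on R^4 *)

Section Riemann.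
Context {R : realType}.

(** The integral of a nonnegative function is a supremum over simple functions below it, so
    monotonicity holds without measurability. The domain and integrand thus never have to be shown
    measurable. *)
Lemma ge0_le_integral_nomeas d (T : measurableType d) (mu : {measure set T -> \bar R})
  (f g : T -> \bar R) : (forall x, 0 <= g x)%E -> (forall x, g x <= f x)%E ->
  (\int[mu]_x g x <= \int[mu]_x f x)%E.
Proof.
move=> g0 gf; have f0 x : (0 <= f x)%E by apply: le_trans (gf x).
rewrite !ge0_integralTE//; apply: ereal_sup_le => _ [h hg <-]; exists h => // x.
exact: le_trans (hg x) (gf x).
Qed.

Let mu := @lebesgue4 R.

Lemma vec4E (p : R * R * R * R) : [/\ vec4 p 0 (inord 0) = p.1.1.1, vec4 p 0 (inord 1) = p.1.1.2,
  vec4 p 0 (inord 2) = p.1.2 & vec4 p 0 (inord 3) = p.2].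
Proof. by rewrite !mxE !inordK. Qed.

Lemma cell_vec4 (o : 'rV[R]_4) (h : R) : @vec4 R @^-1` cell o h =
  ((`[o 0 (inord 0), o 0 (inord 0) + h[ `*` `[o 0 (inord 1), o 0 (inord 1) + h[) `*`
    `[o 0 (inord 2), o 0 (inord 2) + h[) `*` `[o 0 (inord 3), o 0 (inord 3) + h[.
Proof.
apply/seteqP; split=> p /=; have [e0 e1 e2 e3] := vec4E p.
- by move=> H; rewrite !in_itv /= -e0 -e1 -e2 -e3; do 3 (split; last exact: H); exact: H.
- rewrite !in_itv /= -e0 -e1 -e2 -e3 => -[[[a0 a1] a2] a3] i.
  have [|||] : [\/ i = inord 0, i = inord 1, i = inord 2 | i = inord 3].
    case: i => [[|[|[|[|//]]]] hi]; [constructor 1|constructor 2|constructor 3|constructor 4];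
      by apply/val_inj; rewrite /= inordK.
  all: by move=> ->.
Qed.

Lemma measurable_cell o h : measurable (@vec4 R @^-1` cell o h).
Proof.
rewrite cell_vec4; do 3 (apply: measurableX; last exact: measurable_itv).
exact: measurable_itv.
Qed.

Lemma mu_cell o h : 0 < h -> mu (@vec4 R @^-1` cell o h) = (h ^+ 4)%:E.
Proof.
move=> h0; rewrite cell_vec4 /mu /lebesgue4.
have m1 i : @lebesgue_measure R `[o 0 i, o 0 i + h[%classic = h%:E.
  by rewrite lebesgue_measure_itv /= lte_fin ltrDl h0 -EFinB addrAC subrr add0r.
have mA i : measurable (`[o 0 i, o 0 i + h[%classic : set R) by exact: measurable_itv.
pose A k := `[o 0 (inord k), o 0 (inord k) + h[%classic : set R.
have E2 : (@lebesgue_measure R \x @lebesgue_measure R)%E (A 0 `*` A 1) = (h ^+ 2)%:E.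
  apply: etrans; first by apply: product_measure1E; exact: mA.
  by rewrite [X in (X * _)%E]m1 [X in (_ * X)%E]m1 -EFinM expr2.
have E3 : ((@lebesgue_measure R \x @lebesgue_measure R) \x @lebesgue_measure R)%E
    (A 0 `*` A 1 `*` A 2) = (h ^+ 3)%:E.
  apply: etrans; first by apply: product_measure1E; [apply: measurableX|]; exact: mA.
  by rewrite [X in (X * _)%E]E2 [X in (_ * X)%E]m1 -EFinM -exprSr.
apply: etrans; first by apply: product_measure1E; [apply: measurableX; [apply: measurableX|]|]; exact: mA.
by rewrite [X in (X * _)%E]E3 [X in (_ * X)%E]m1 -EFinM -exprSr.
Qed.

Lemma sum_indic_le_integral d (T : measurableType d) (nu : {measure set T -> \bar R})
    (I : finType) (Z : pred I) (C : I -> set T) (c : R) (m : I -> R) (F : T -> \bar R) :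
  (forall i, measurable (C i)) -> (forall i, Z i -> nu (C i) = c%:E) ->
  (forall i j x, Z i -> Z j -> C i x -> C j x -> i = j) ->
  (forall i, Z i -> 0 <= m i) -> (forall x, (0 <= F x)%E) ->
  (forall i x, Z i -> C i x -> ((m i)%:E <= F x)%E) ->
  ((\sum_(i | Z i) c * m i)%:E <= \int[nu]_x F x)%E.
Proof.
move=> mC muC disj m0 F0 Hm.
pose g p := (\sum_(i <- enum Z) (m i)%:E * (\1_(C i) p)%:E)%E.
have enumZ i : i \in enum Z -> Z i by rewrite mem_enum.
have m1 i : measurable_fun setT (fun p => (\1_(C i) p : R)%:E).
  by apply/measurable_EFinP; exact: measurable_indic (mC i).
(* Truncation makes every term nonnegative, also for indices outside Z, where nothing is known about
   [m]. *)
pose g' i p := ((Num.max (m i) 0)%:E * (\1_(C i) p)%:E)%E.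
have mm i : Z i -> Num.max (m i) 0 = m i by move=> Zi; apply/max_idPl; exact: m0.
have mg' i : measurable_fun setT (g' i) by exact/measurable_funeM/m1.
have g'0 i p : (0 <= g' i p)%E.
  by rewrite mule_ge0// lee_fin ?le_max ?lexx ?orbT// indicE; case: (_ \in _).
have gE p : g p = (\sum_(i <- enum Z) g' i p)%E.
  by apply: eq_big_seq => i /enumZ Zi; rewrite /g' mm.
have -> : ((\sum_(i | Z i) c * m i)%:E = \int[nu]_p g p)%E.
  rewrite (eq_integral (fun p => \sum_(i <- enum Z) g' i p)%E); last by move=> p _; exact: gE.
  rewrite ge0_integral_sum// -sumEFin -big_enum /=; apply: eq_big_seq => i /enumZ Zi.
  rewrite /g' mm// ge0_integralZl_EFin//; last by exact: m0.
  by rewrite integral_indic// setIT muC// -EFinM mulrC.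
apply: ge0_le_integral_nomeas => p; first by rewrite gE sume_ge0.
have [[i Zi Cip]|nC] := pselect (exists2 i, Z i & C i p).
  have -> : g p = (m i)%:E.
    rewrite /g (bigD1_seq i) ?mem_enum ?enum_uniq//= indicE mem_set// mule1.
    rewrite big_seq_cond big1 ?adde0// => j /andP[/enumZ Zj ji].
    rewrite indicE memNset ?mule0// => Cjp.
    by have := disj i j _ Zi Zj Cip Cjp => ij; rewrite ij eqxx in ji.
  exact: Hm Zi Cip.
have -> : g p = 0%E.
  rewrite /g big_seq big1// => i /enumZ Zi.
  by rewrite indicE memNset ?mule0// => Cip; apply: nC; exists i.
exact: F0.
Qed.

Lemma riemann_le_integral4 (I : finType) (Z : pred I) (o : I -> 'rV[R]_4) (h : R) (m : I -> R)
    (D : set 'rV[R]_4) (f : 'rV[R]_4 -> \bar R) : 0 < h ->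
  (forall x, (0 <= f x)%E) ->
  (forall i j x, Z i -> Z j -> cell (o i) h x -> cell (o j) h x -> i = j) ->
  (forall i, Z i -> 0 <= m i) ->
  (forall i x, Z i -> cell (o i) h x -> D x /\ ((m i)%:E <= f x)%E) ->
  ((\sum_(i | Z i) h ^+ 4 * m i)%:E <= integral4 D f)%E.
Proof.
move=> h0 f0 disj m0 Hm; rewrite /integral4 integral_mkcond /lebesgue4.
have := @sum_indic_le_integral _ _ (((@lebesgue_measure R \x @lebesgue_measure R) \x @lebesgue_measure R)
   \x @lebesgue_measure R)%E I Z (fun i => @vec4 R @^-1` cell (o i) h) (h ^+ 4) m.
apply => //.
- by move=> i; exact: measurable_cell.
- by move=> i _; exact: mu_cell.
- by move=> i j p; exact: disj.
- by move=> p; rewrite /patch; case: ifP.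
- by move=> i p Zi Cip; have [Dp mf] := Hm i _ Zi Cip; rewrite /patch mem_set.
Qed.

End Riemann.

(** * Mean value inequality for superharmonic functions *)

Section TestFunction.
Context {R : realType}.
Implicit Types (a s t : R).

Local Notation pos t := (Num.max 0 t).

Lemma is_derive_pos2 (t : R) : is_derive t 1 (fun t : R => pos t ^+ 2) (2 * pos t).
Proof.
apply: is_derive_eps => e e0; exists e => // h he.
rewrite [h *: 1]mulr1.
have hh : `|h| * `|h| <= e * `|h| by rewrite ler_wpM2r// ltW.
apply: le_trans hh; rewrite -normrM -expr2 (ger0_norm (sqr_ge0 h)) ler_norml.
by case: (lerP 0 t) => t0; case: (lerP 0 (t + h)) => th; apply/andP; split; nra.
Qed.

Lemma continuous_pos (t : R) : {for t, continuous (fun t : R => pos t)}.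
Proof. by apply: continuous_max; [exact: cst_continuous|exact: id]. Qed.

Lemma pos3E (t : R) : pos t ^+ 3 = t * pos t ^+ 2.
Proof. by case: (lerP 0 t) => t0; [rewrite exprS|rewrite !expr0n mulr0]. Qed.

Lemma is_derive_pos3 (t : R) : is_derive t 1 (fun t : R => pos t ^+ 3) (3 * pos t ^+ 2).
Proof.
have -> : (fun t : R => pos t ^+ 3) = (fun t => t * pos t ^+ 2).
  by apply/funext => s; exact: pos3E.
have := is_deriveM (is_derive_id t (1 : R)) (is_derive_pos2 t).
apply: is_derive_val.
have E : t * (2 * pos t) = 2 * pos t ^+ 2.
  by case: (lerP 0 t) => t0; [ring|rewrite expr0n /= !mulr0].
transitivity (t * (2 * pos t) + pos t ^+ 2); last by rewrite E; ring.
by rewrite [_ *: 1]mulr1.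
Qed.

(** With s = |x|^2 and t = s + a this is (1 - t)^3 / t cut off at t = 1. The pole 1/t regularizes
    1/|x|^2, the Newtonian potential of R^4 up to a factor, and the cube makes the cut-off C^2. *)
Definition bumpG (a s : R) : R := pos (1 - s - a) ^+ 3 / (s + a).
Definition bumpG' (a s : R) : R :=
  - (3 * pos (1 - s - a) ^+ 2 / (s + a) + pos (1 - s - a) ^+ 3 / (s + a) ^+ 2).
Definition bumpG'' (a s : R) : R :=
  6 * pos (1 - s - a) / (s + a) + 6 * pos (1 - s - a) ^+ 2 / (s + a) ^+ 2 +
  2 * pos (1 - s - a) ^+ 3 / (s + a) ^+ 3.

Lemma is_derive_affine1 (F : R -> R) (s l : R) a : is_derive (1 - s - a) 1 F l ->
  is_derive s 1 (fun s => F (1 - s - a)) (- l).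
Proof.
move=> dF; have d1 : is_derive s 1 (fun s : R => 1 - s - a) (-1).
  have := is_deriveB (is_deriveB (is_derive_cst (1 : R) s 1) (is_derive_id s (1 : R))) (is_derive_cst a s 1).
  by apply: is_derive_val; rewrite sub0r subr0.
by rewrite -[- l]mulrN1; exact: (@is_derive1_comp R F (fun s => 1 - s - a)).
Qed.

Lemma is_derive_inv (s a : R) : s + a != 0 ->
  is_derive s 1 (fun s => (s + a)^-1) (- (s + a) ^- 2) /\
  is_derive s 1 (fun s => ((s + a) ^+ 2)^-1) (- (2 * (s + a) ^- 3)).
Proof.
move=> sa; have d1 : is_derive s 1 (fun s : R => s + a) 1.
  have := is_deriveD (is_derive_id s (1 : R)) (is_derive_cst a s 1).
  by apply: is_derive_val; rewrite addr0.
have d2 : is_derive s 1 (fun s : R => (s + a) ^+ 2) (2 * (s + a)).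
  by have := is_deriveX 2 d1; apply: is_derive_val; rewrite [_ *: 1]mulr1.
split.
  have := @is_deriveV R (fun s => s + a) s _ 1 sa d1.
  by apply: is_derive_val; rewrite [_ *: 1]mulr1.
have := @is_deriveV R (fun s => (s + a) ^+ 2) s _ 1 (expf_neq0 _ sa) d2.
apply: is_derive_val.
transitivity (- ((s + a) ^+ 2) ^- 2 * (2 * (s + a))); first by [].
by field.
Qed.

Lemma bump_derive a s : s + a != 0 -> is_derive s 1 (bumpG a) (bumpG' a s) /\
  is_derive s 1 (bumpG' a) (bumpG'' a s).
Proof.
move=> sa.
have [i1 i2] := is_derive_inv sa.
have p3 := is_derive_affine1 (is_derive_pos3 (1 - s - a)).
have p2 := is_derive_affine1 (is_derive_pos2 (1 - s - a)).
split.
  have := is_deriveM p3 i1; apply: is_derive_val; set P := pos _.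
  transitivity (P ^+ 3 * (- (s + a) ^- 2) + (s + a)^-1 * (- (3 * P ^+ 2))); first by [].
  rewrite /bumpG' -/P; field.
  by rewrite sa.
have := is_deriveN (is_deriveD (is_deriveM (is_deriveM (is_derive_cst (3 : R) s 1) p2) i1) (is_deriveM p3 i2)).
apply: is_derive_val; set P := pos _.
transitivity (- ((3 * P ^+ 2) * (- (s + a) ^- 2) + (s + a)^-1 * (3 * (- (2 * P)) + P ^+ 2 * 0) +
  (P ^+ 3 * (- (2 * (s + a) ^- 3)) + ((s + a) ^+ 2)^-1 * (- (3 * P ^+ 2))))); first by [].
rewrite /bumpG'' -/P; field.
by rewrite sa.
Qed.

Lemma continuous_bumpG'' a s : s + a != 0 -> {for s, continuous (bumpG'' a)}.
Proof.
move=> sa.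
have cp : {for s, continuous (fun s => pos (1 - s - a))}.
  apply: (@continuous_comp _ _ _ (fun s => 1 - s - a) (fun t => pos t)); last exact: continuous_pos.
  apply: continuousB; last exact: cst_continuous.
  by apply: continuousB; [exact: cst_continuous|exact: id].
have ci : {for s, continuous (fun s => s + a)}.
  by apply: continuousD; [exact: id|exact: cst_continuous].
have cc (c : R) : {for s, continuous (fun=> c)} by exact: cst_continuous.
have cX (f : R -> R) k : {for s, continuous f} -> {for s, continuous (fun s => f s ^+ k)}.
  move=> cf; elim: k => [|k IH]; first exact: cst_continuous.
  suff : continuous_at s (fun s => f s ^+ k.+1) by [].
  have -> : (fun s => f s ^+ k.+1) = (fun s => f s * f s ^+ k).
    by apply/funext => t; rewrite exprS.
  exact: (cvgM cf IH).
have cV k : {for s, continuous (fun s => ((s + a) ^+ k)^-1)}.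
  by apply: continuousV; [exact: expf_neq0|exact: cX].
have cV1 : {for s, continuous (fun s => (s + a)^-1)} by exact: continuousV.
apply: continuousD; last by apply: continuousM => //; apply: continuousM => //; exact: cX.
apply: continuousD; last by apply: continuousM => //; apply: continuousM => //; exact: cX.
by apply: continuousM => //; apply: continuousM.
Qed.

End TestFunction.

Section Bump.
Context {R : realType}.
Implicit Types (x : 'rV[R]_4) (a : R).

Definition bump a x : R := bumpG a (sqn x).
Definition bump_hess a (i j : 'I_4) x : R :=
  bumpG'' a (sqn x) * (2 * x 0 i) * (2 * x 0 j) + bumpG' a (sqn x) * (2 * (i == j)%:R).

Lemma sqn_ge0 n (x : 'rV[R]_n) : 0 <= sqn x.
Proof. by apply: sumr_ge0 => i _; exact: sqr_ge0. Qed.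

Lemma C2on_bump a : 0 < a -> C2on setT (bump a)
  (fun i x => bumpG' a (sqn x) * (2 * x 0 i)) (bump_hess a).
Proof.
move=> a0; have H := C2on_sqn setT (0 : 'rV[R]_4).
have : C2on setT (fun x : 'rV[R]_4 => sqn x) (fun i x => 2 * x 0 i) (fun i j _ => 2 * (i == j)%:R).
  have E : (fun x : 'rV[R]_4 => sqn (x - 0)) = (fun x => sqn x) by apply/funext => x; rewrite subr0.
  have E' : (fun (i : 'I_4) (x : 'rV[R]_4) => 2 * (x 0 i - (0 : 'rV[R]_4) 0 i)) = (fun i x => 2 * x 0 i).
    by apply/funext => i; apply/funext => x; rewrite mxE subr0.
  by rewrite E E' in H.
move=> /(C2on_comp openT); apply => x _.
have sa : sqn x + a != 0 by rewrite gt_eqF// ltr_wpDl// sqn_ge0.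
have [d1 d2] := bump_derive sa; split=> //; exact: continuous_bumpG''.
Qed.

Lemma bump_ge0 a x : 0 < a -> 0 <= bump a x.
Proof.
move=> a0; rewrite divr_ge0// ?exprn_ge0 ?le_max ?lexx//.
by rewrite addr_ge0 ?sqn_ge0 ?ltW.
Qed.

Lemma bump_eq0 a x : 1 - a <= sqn x -> bump a x = 0.
Proof.
move=> ax; rewrite /bump /bumpG (_ : Num.max _ _ = 0) ?expr0n ?mul0r//.
by apply/max_idPl; lra.
Qed.

(** For t = |x|^2 + a < 1, the function is 1/t - 3 + 3 t - t^2. The polynomial contributes 24 (1 -
    t) + 8 a, and 1/t contributes -8 a / t^3, which approximates a negative Dirac mass as a tends to
    0. *)
Lemma bump_lap a x : 0 < a -> \sum_i bump_hess a i i x =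
  if sqn x + a < 1 then 24 * (1 - (sqn x + a)) + 8 * a - 8 * a / (sqn x + a) ^+ 3 else 0.
Proof.
move=> a0.
have s0 : 0 < sqn x + a by rewrite ltr_wpDl// sqn_ge0.
have -> : \sum_i bump_hess a i i x = 4 * bumpG'' a (sqn x) * sqn x + 8 * bumpG' a (sqn x).
  rewrite /bump_hess big_split /= mulr_sumr; congr (_ + _).
    by apply: eq_bigr => i _; ring.
  rewrite (eq_bigr (fun=> bumpG' a (sqn x) * 2)); last by move=> i _; rewrite eqxx mulr1.
  by rewrite sumr_const card_ord -mulr_natl; ring.
rewrite /bumpG' /bumpG''; case: ifPn => [s1|].
  have -> : Num.max 0 (1 - sqn x - a) = 1 - (sqn x + a) by rewrite max_r; lra.
  have -> : sqn x = (sqn x + a) - a by rewrite addrK.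
  move: (sqn x + a) s0 => s s0; rewrite !subrK; field.
  by rewrite gt_eqF.
rewrite -leNgt => s1; have -> : Num.max 0 (1 - sqn x - a) = 0 by rewrite max_l; lra.
by rewrite !expr0n /= !mulr0 !mul0r !addr0 oppr0 !mulr0 mul0r addr0.
Qed.

End Bump.

Section Sqn.
Context {R : realType} {n : nat}.
Implicit Types (x y c : 'rV[R]_n).

Lemma sqr_coord_le x i : x 0 i ^+ 2 <= sqn x.
Proof.
rewrite /sqn (bigD1 i)//= lerDl sumr_ge0// => j _; exact: sqr_ge0.
Qed.

Lemma coord_le x i (r : R) : 0 <= r -> sqn x <= r ^+ 2 -> `|x 0 i| <= r.
Proof.
move=> r0 xr; have := le_trans (sqr_coord_le x i) xr.
by rewrite -real_normK ?num_real// ler_sqr ?nnegrE.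
Qed.

Lemma coord_lt x i (r : R) : 0 <= r -> sqn x < r ^+ 2 -> `|x 0 i| < r.
Proof.
move=> r0 xr; have := le_lt_trans (sqr_coord_le x i) xr.
by rewrite -real_normK ?num_real// ltr_sqr ?nnegrE.
Qed.

Lemma continuous_sqn c : continuous (fun x => sqn (x - c)).
Proof. by move=> x; exact: (C1on_continuous openT (C2on_sqn setT c).1). Qed.

Lemma compact_sqn c (r : R) : compact [set x | sqn (x - c) <= r].
Proof.
apply: bounded_closed_compact.
  pose b := `|r| + 1.
  have b0 : 0 <= b by rewrite addr_ge0.
  exists (b + `|c|); split; first exact: num_real.
  move=> M bM x /= xr; rewrite (le_trans _ (ltW bM))//.
  rewrite -(subrK c x) (le_trans (ler_normD _ _))// lerD2r.
  rewrite /Num.norm /= mx_normrE; apply: bigmax_le => // -[k i] _ /=.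
  rewrite (ord1 k); apply: coord_le => //; rewrite (le_trans xr)// /b.
  have := ler_norm r; have := normr_ge0 r; nra.
apply: (@preimage_closed _ _ (fun x => sqn (x - c)) [set t | t <= r]); last exact: closed_le.
by move=> x _; exact: continuous_sqn.
Qed.

Lemma open_sqn c (r : R) : open [set x | sqn (x - c) < r].
Proof.
apply: (@open_comp _ _ (fun x => sqn (x - c)) [set t | t < r]); last exact: open_lt.
by move=> x _; exact: continuous_sqn.
Qed.

(* AM-GM with weight [b / a] gives the triangle inequality for [sqrt sqn]. *)
Lemma sqn_add x y (a b : R) : 0 < a -> 0 < b -> sqn x <= a ^+ 2 -> sqn y <= b ^+ 2 ->
  sqn (x + y) <= (a + b) ^+ 2.
Proof.
move=> a0 b0 xa yb.
have E : (a + b) ^+ 2 = (1 + b / a) * a ^+ 2 + (1 + a / b) * b ^+ 2 by field; rewrite !gt_eqF.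
rewrite E (@le_trans _ _ ((1 + b / a) * sqn x + (1 + a / b) * sqn y))//; last first.
  by apply: lerD; rewrite ler_wpM2l// addr_ge0// divr_ge0// ltW.
rewrite /sqn !mulr_sumr -big_split /=; apply: ler_sum => i _; rewrite mxE.
rewrite -subr_ge0; set s := x 0 i; set t := y 0 i.
have -> : (1 + b / a) * s ^+ 2 + (1 + a / b) * t ^+ 2 - (s + t) ^+ 2 =
  (b * s - a * t) ^+ 2 / (a * b) by field; rewrite !gt_eqF.
by rewrite divr_ge0 ?sqr_ge0// mulr_ge0// ltW.
Qed.

Lemma sqn_add_lt x y (a b : R) : 0 < a -> 0 < b -> sqn x < a ^+ 2 -> sqn y <= b ^+ 2 ->
  sqn (x + y) < (a + b) ^+ 2.
Proof.
move=> a0 b0 xa yb.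
have E : (a + b) ^+ 2 = (1 + b / a) * a ^+ 2 + (1 + a / b) * b ^+ 2 by field; rewrite !gt_eqF.
rewrite E (@le_lt_trans _ _ ((1 + b / a) * sqn x + (1 + a / b) * sqn y))//; last first.
  apply: ltr_leD; first by rewrite ltr_pM2l// ltr_wpDr ?divr_ge0 ?ltW.
  by rewrite ler_wpM2l// addr_ge0// divr_ge0// ltW.
rewrite /sqn !mulr_sumr -big_split /=; apply: ler_sum => i _; rewrite mxE.
rewrite -subr_ge0; set s := x 0 i; set t := y 0 i.
have -> : (1 + b / a) * s ^+ 2 + (1 + a / b) * t ^+ 2 - (s + t) ^+ 2 =
  (b * s - a * t) ^+ 2 / (a * b) by field; rewrite !gt_eqF.
by rewrite divr_ge0 ?sqr_ge0// mulr_ge0// ltW.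
Qed.

Lemma sqnZ (k : R) x : sqn (k *: x) = k ^+ 2 * sqn x.
Proof. by rewrite /sqn mulr_sumr; apply: eq_bigr => i _; rewrite mxE exprMn. Qed.

Lemma sqnN x : sqn (- x) = sqn x.
Proof. by rewrite /sqn; apply: eq_bigr => i _; rewrite mxE sqrrN. Qed.

Lemma sqn0 : sqn (0 : 'rV[R]_n) = 0.
Proof. by rewrite /sqn big1// => i _; rewrite mxE expr0n. Qed.

Lemma eball_sqn c (r : R) x : 0 < r -> eball c r x <-> sqn (x - c) < r ^+ 2.
Proof.
move=> r0; rewrite /eball /enorm /= -/(sqn (x - c)).
have s0 : 0 <= sqn (x - c) by apply: sumr_ge0 => i _; exact: sqr_ge0.
rewrite -[X in _ <-> (_ < X) = true]/(r ^+ 2) -{2}(sqr_sqrtr s0) ltr_sqr ?nnegrE ?sqrtr_ge0 ?(ltW r0)//.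
Qed.

End Sqn.

Section MeanValue.
Context {R : realType}.
Implicit Types (x o : 'rV[R]_4) (a h : R) (U : set 'rV[R]_4).

(** The cube [-2, 2]^4 leaves room around the unit ball, so that bumps vanish near the faces where
    indices wrap around. *)
Definition covers o h m := forall i, o 0 i <= - 2 /\ 2 <= o 0 i + h * m%:R.

Lemma bump_margin a o h m : 0 < h -> h <= 1 -> covers o h m -> 0 < a ->
  forall x, bump a x != 0 -> forall i, o 0 i + h < x 0 i < o 0 i + h * m%:R.
Proof.
move=> h0 h1 cov a0 x bx i.
have x1 : sqn x < 1 ^+ 2.
  by rewrite expr1n ltNge; apply: contraNN bx => x1; rewrite bump_eq0//; lra.
have := coord_lt i ler01 x1; rewrite ltr_norml => /andP[x2 x3].
by have [c1 c2] := cov i; apply/andP; split; lra.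
Qed.

(** The bump already vanishes for |x|^2 >= 1 - a. If |x_i| <= 2, a step of length at most a/4 along
    axis i lowers |x|^2 by at most a; if |x_i| > 2, the square of x_i alone keeps the point
    outside. *)
Lemma lap_bump_out a h x : 0 < h -> h <= 1 -> 4 * h <= a -> 1 <= sqn x ->
  lap h (bump a) x = 0.
Proof.
move=> h0 h1 ha x1; rewrite /lap big1// => i _.
have out (t : R) : `|t| <= h -> bump a (x + t *: delta_mx 0 i) = 0.
  move=> th; apply: bump_eq0.
  have -> : sqn (x + t *: delta_mx 0 i) = sqn x + 2 * t * x 0 i + t ^+ 2.
    rewrite /sqn (bigD1 i)//= [in RHS](bigD1 i)//= !mxE !eqxx mulr1.
    rewrite (eq_bigr (fun j => x 0 j ^+ 2)); first ring.
    by move=> j ji; rewrite !mxE (negPf ji) andbF mulr0 addr0.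
  have := sqr_coord_le x i; move: th; rewrite ler_norml => /andP[t1 t2].
  have [|] := lerP `|x 0 i| 2; rewrite ?ler_norml.
    by move=> /andP[y1 y2] _; nra.
  move=> y2 y3; have : `|x 0 i| ^+ 2 <= sqn x by rewrite real_normK ?num_real.
  have : - (h * `|x 0 i|) <= t * x 0 i.
    by rewrite lerNl (le_trans (ler_norm _))// normrN normrM ler_wpM2r// ler_norml t1.
  by move: (`|x 0 i|) y2 => y y2; nra.
have hh : `|h| <= h by rewrite ger0_norm// ltW.
have e1 := out h hh.
have e2 : bump a (x - h *: delta_mx 0 i) = 0 by rewrite -scaleNr; apply: out; rewrite normrN.
have e3 : bump a x = 0.
  by have := out 0; rewrite normr0 scale0r addr0; apply; exact: ltW.
by rewrite e1 e2 e3 mulr0 subr0 addr0.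
Qed.

Lemma hess_trace_near U f g (H : 'I_4 -> 'I_4 -> 'rV[R]_4 -> R) x (e : R) : C2on U f g H -> U x -> 0 < e ->
  exists2 d : R, 0 < d & forall y, box x d y -> `|\sum_i H i i y - \sum_i H i i x| <= e.
Proof.
move=> fH Ux e0; have e4 : 0 < e / 4 by rewrite divr_gt0.
have [d d0 Hd] := near_family e4 (fun i => (fH.2 i _ Ux i).2).
exists d => // y xy; rewrite -sumrB (le_trans (ler_norm_sum _ _ _))//.
rewrite (@le_trans _ _ (\sum_(i < 4) e / 4))//; last by rewrite sumr_const card_ord -mulr_natl; lra.
by apply: ler_sum => i _; exact/ltW/Hd.
Qed.

Lemma lap_neg U f g (H : 'I_4 -> 'I_4 -> 'rV[R]_4 -> R) K : open U -> C2on U f g H -> compact K -> K `<=` U ->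
  (forall x, K x -> \sum_i H i i x < 0) ->
  exists2 h0 : R, 0 < h0 & forall x h, K x -> 0 < h -> h < h0 -> lap h f x < 0.
Proof.
move=> oU fH cK KU Hneg; apply: (compact_uniform (P := fun x h => lap h f x < 0)) => // x Kx.
have t0 := Hneg _ Kx; have Ux := KU _ Kx.
have e0 : 0 < - (\sum_i H i i x) / 3 by rewrite divr_gt0// oppr_gt0.
have [d1 d10 H1] := hess_trace_near fH Ux e0.
have [d2 d20 H2] := C2on_lap oU fH Ux e0.
exists (Num.min d1 d2); first by rewrite lt_min d10.
move=> y h xy h0; rewrite lt_min => /andP[hd1 hd2].
have B1 : box x d1 y by apply: le_box xy; rewrite ge_min lexx.
have B2 : box x d2 y by apply: le_box xy; rewrite ge_min lexx orbT.
have /ler_normlP[_ a1] := H1 _ B1.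
have /(_ 0) := H2 _ _ B2 h0 hd2; rewrite addr0 => /(_ _)/ler_normlP[].
  by move=> i; rewrite mxE normr0 ltW.
have hh : 0 < h ^+ 2 by rewrite exprn_gt0.
by move=> _; nra.
Qed.

(* The test functions [bump a] are cut-off Newtonian potentials smoothed at scale [sqrt a]; letting [a -> 0]
   after the lattice step [h] turns summation by parts into the mean value inequality. *)
Lemma mean_value_lattice : exists2 C : R, 0 < C & forall U u g H, open U -> C2on U u g H ->
  [set x | sqn x <= 1] `<=` U ->
  (forall x : 'rV[R]_4, sqn x <= 1 -> 0 < u x) ->
  (forall x : 'rV[R]_4, sqn x <= 1 -> \sum_i H i i x < 0) ->
  exists2 h0 : R, 0 < h0 & forall h, 0 < h -> h < h0 -> forall m o, covers o h m ->
    \sum_(z : 'rV['I_m.+2]_4 | sqn (lpt o h z) <= 25 / 36) h ^+ 4 * u (lpt o h z) <= C * u 0.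
Proof.
(* The estimates at the end give (52 * 81 + 2) / 6 < 703. *)
exists 1000; first by rewrite ltr0n.
move=> U u g H oU uH BU u0 Hneg.
have cB : compact [set x : 'rV[R]_4 | sqn x <= 1].
  have := @compact_sqn R 4 0 1.
  by rewrite (_ : [set x | sqn (x - 0) <= 1] = [set x | sqn x <= 1])//; apply/seteqP; split=> x /=; rewrite subr0.
have B0 : sqn (0 : 'rV[R]_4) <= 1 by rewrite sqn0.
have u00 : 0 < u 0 by exact: u0.
have cu x : sqn x <= 1 -> {for x, continuous u}.
  by move=> x1; apply: (C1on_continuous oU uH.1); exact: BU.
have [M M0 uM] : exists2 M : R, 0 < M & forall x, sqn x <= 1 -> u x <= M.
  have [||c cB1 cmax] := @compact_EVT_max _ R u [set x : 'rV[R]_4 | sqn x <= 1] _ cB.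
  - by exists 0.
  - apply/continuous_in_subspaceT => x; rewrite inE /= => x1; exact: cu.
  by exists (u c) => [|x x1]; [apply: u0; move: cB1; rewrite inE|apply: cmax; rewrite inE].
have [b b0 ub] : exists2 b : R, 0 < b & forall x, sqn x < b -> u x <= 2 * u 0.
  have [d d0 Hd] := continuous_box (cu 0 B0) u00.
  exists (d ^+ 2); first by rewrite exprn_gt0.
  move=> x xd; have := Hd x => /(_ _)/ltr_normlW; rewrite ltrBlDr => K.
  rewrite mulr_natl mulr2n ltW//; apply: K => i.
  by rewrite mxE subr0; apply: coord_lt; rewrite ?ltW.
(* Where |x|^2 >= b the kernel 8 a / t^3 is at most 8 a / b^3, so its total there, the lattice
   volume being at most 3^4 = 81, costs at most u(0). For a <= 1/36, 24 (1 - t) > 6 on |x|^2 <=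
   25/36. *)
have [a a0 [a1 a2]] : exists2 a : R, 0 < a & a <= 1 / 36 /\ M * (8 * a / b ^+ 3) * 81 <= u 0.
  pose t := u 0 * b ^+ 3 / (M * 8 * 81).
  have t0 : 0 < t by rewrite divr_gt0 ?mulr_gt0 ?exprn_gt0.
  exists (Num.min (1 / 36) t); first by rewrite lt_min t0 andbT divr_gt0.
  split; first by rewrite ge_min lexx.
  have mt : Num.min (1 / 36) t <= t by rewrite ge_min lexx orbT.
  have -> : u 0 = M * (8 * t / b ^+ 3) * 81 by rewrite /t; field; rewrite !gt_eqF.
  by rewrite ler_pM2r// ler_pM2l// ler_pM2r ?invr_gt0 ?exprn_gt0// ler_pM2l.
have [e e0 [e1 e2]] : exists2 e : R, 0 < e & e <= 1 /\ M * e * 81 <= u 0.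
  pose t := u 0 / (M * 81).
  have t0 : 0 < t by rewrite divr_gt0 ?mulr_gt0.
  exists (Num.min 1 t); first by rewrite lt_min t0 andbT.
  split; first by rewrite ge_min lexx.
  have -> : u 0 = M * t * 81 by rewrite /t; field; rewrite !gt_eqF.
  by rewrite ler_pM2r// ler_pM2l// ge_min lexx orbT.
have [h1 h10 Hh1] := lap_neg oU uH cB BU Hneg.
have [h2 h20 Hh2] : exists2 h2 : R, 0 < h2 & forall x h, sqn x <= 1 -> 0 < h -> h < h2 ->
    `|lap h (bump a) x - h ^+ 2 * \sum_i bump_hess a i i x| <= e * h ^+ 2.
  apply: (compact_uniform (P := fun x h => `|lap h (bump a) x - h ^+ 2 * \sum_i bump_hess a i i x| <= e * h ^+ 2) cB).
  move=> x _; have [d d0 Hd] := @C2on_lap R 4 setT _ _ _ x e openT (C2on_bump a0) I e0.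
  exists d => // y h xy h0 hd; have := Hd _ _ xy h0 hd 0; rewrite addr0; apply => i.
  by rewrite mxE normr0 ltW.
exists (Num.min (Num.min h1 h2) (Num.min 1 (a / 4))).
  by rewrite !lt_min h10 h20 divr_gt0// ltr01.
move=> h h0; rewrite !lt_min => /andP[/andP[hh1 hh2] /andP[hlt1 hlta]] m o cov.
have ha : 4 * h <= a by rewrite mulrC -ler_pdivlMr// ltW.
set pt := fun z : 'rV['I_m.+2]_4 => lpt o h z.
rewrite -[X in X <= _]/(\sum_(z | sqn (pt z) <= 25 / 36) h ^+ 4 * u (pt z)).
pose D z := \sum_i bump_hess a i i (pt z).
pose k z : R := if sqn (pt z) + a < 1 then 8 * a / (sqn (pt z) + a) ^+ 3 else 0.
have DE z : D z = (if sqn (pt z) + a < 1 then 24 * (1 - (sqn (pt z) + a)) + 8 * a else 0) - k z.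
  by rewrite /D /k bump_lap//; case: ifP => //; rewrite subr0.
have supp := bump_margin h0 (ltW hlt1) cov a0.
have hh : 0 < h ^+ 2 by rewrite exprn_gt0.
pose B z := sqn (pt z) < 1.
have onB (v : 'rV[R]_4 -> R) : \sum_z v (pt z) * lap h (bump a) (pt z) =
    \sum_(z | B z) v (pt z) * lap h (bump a) (pt z).
  rewrite [RHS]big_mkcond; apply: eq_bigr => z _; case: ifPn => // nB.
  by rewrite lap_bump_out ?mulr0// ?(ltW hlt1)// leNgt.
(* Summation by parts against u, whose discrete Laplacian is negative while the bump is
   nonnegative. *)
have A1 : \sum_(z | B z) u (pt z) * (D z - e) <= 0.
  rewrite -(pmulr_rle0 _ hh) mulr_sumr.
  apply: (@le_trans _ _ (\sum_z bump a (pt z) * lap h u (pt z))).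
    rewrite (sum_lap _ h0 supp) onB; apply: ler_sum => z Bz.
    have [s1 s0] : sqn (pt z) <= 1 /\ 0 < u (pt z) by split; [exact: ltW|exact/u0/ltW].
    have /ler_normlP[b1 b2] := Hh2 _ _ s1 h0 hh2; rewrite -/(D z) in b1 b2.
    by rewrite mulrCA ler_pM2l// mulrBr; lra.
  apply: sumr_le0 => z _; have [Bz|nB] := ltP (sqn (pt z)) 1.
    rewrite mulr_ge0_le0 ?bump_ge0//; apply/ltW/Hh1 => //; exact: ltW.
  by rewrite bump_eq0 ?mul0r//; lra.
pose N : R := #|[pred z | B z]|%:R.
have NE (c : R) : \sum_(z | B z) c = c * N by rewrite sumr_const -mulr_natr.
have N81 : N * h ^+ 4 <= 81.
  apply: le_trans (_ : 3 ^+ 4 <= 81); last by rewrite -natrX.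
  apply: le_trans (card_ball m.+2 o h0 (ltW hlt1)).
  apply: ler_wpM2r; first by rewrite exprn_ge0// ltW.
  rewrite ler_nat subset_leq_card//; apply/fintype.subsetP => z.
  rewrite !inE => Bz; apply/forallP => i; apply: coord_lt => //.
  by rewrite expr1n.
(* The same summation against the constant 1 has value 0. Hence the mass of the kernel [k] is at
   most that of the polynomial part, which is below 25, plus the error e <= 1. *)
have A2 : \sum_(z | B z) k z <= 26 * N.
  rewrite -NE -subr_ge0 -sumrB -(pmulr_rge0 _ hh) mulr_sumr.
  have E0 : \sum_z 1 * lap h (bump a) (pt z) = 0.
    rewrite -(sum_lap (fun=> 1) h0 supp) big1// => z _.
    by rewrite /lap big1 ?mulr0// => i _; rewrite mulr1 subrr.
  rewrite -[X in X <= _]E0 (onB (fun=> 1)); apply: ler_sum => z Bz; rewrite mul1r.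
  have /ler_normlP[b1 b2] := Hh2 _ _ (ltW Bz) h0 hh2; rewrite -/(D z) in b1 b2.
  have D25 : D z <= 25 - k z.
    rewrite DE lerD2r; case: ifP => // _; have := sqn_ge0 (pt z); lra.
  by nra.
have ab0 : 0 <= 8 * a / b ^+ 3.
  by rewrite divr_ge0//; [rewrite mulr_ge0//; exact: ltW|rewrite exprn_ge0//; exact: ltW].
(* The term u k is split at |x|^2 = b: inside, u <= 2 u(0); outside, the kernel is small and u <=
   M. *)
have A3 z : B z -> (if sqn (pt z) <= 25 / 36 then 6 * u (pt z) else 0) <=
    u (pt z) * (D z - e) + 2 * u 0 * k z + (M * (8 * a / b ^+ 3) + M * e).
  move=> Bz; have s1 : sqn (pt z) <= 1 by exact: ltW.
  have uM' := uM _ s1; have up := u0 _ s1.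
  have ue : u (pt z) * e <= M * e by rewrite ler_wpM2r// ltW.
  have Mab0 : 0 <= M * (8 * a / b ^+ 3) := mulr_ge0 (ltW M0) ab0.
  have sp : 0 < sqn (pt z) + a by rewrite ltr_wpDl// sqn_ge0.
  have k0 : 0 <= k z.
    rewrite /k; case: ifP => // _.
    by rewrite divr_ge0//; [rewrite mulr_ge0//; exact: ltW|rewrite exprn_ge0//; exact: ltW].
  have uk : u (pt z) * k z <= 2 * u 0 * k z + M * (8 * a / b ^+ 3).
    have [sb|sb] := ltP (sqn (pt z)) b.
      by rewrite ler_wpDr// ler_wpM2r// ub.
    rewrite ler_wpDl ?mulr_ge0// ?(ltW u00)// ler_pM// ?(ltW up)//.
    rewrite /k; case: ifP => // _; rewrite ler_pM2l ?mulr_gt0// lef_pV2 ?posrE ?exprn_gt0//.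
    by rewrite lerXn2r ?nnegrE ?(ltW b0) ?(ltW sp)// ler_wpDr// ltW.
  rewrite DE; case: ifPn => reg; case: ifPn => s.
  - by nra.
  - by exfalso; move: s reg a1; rewrite -leNgt; lra.
  - by nra.
  - by rewrite mulrBr; lra.
have : \sum_(z | B z) (if sqn (pt z) <= 25 / 36 then 6 * u (pt z) else 0) <=
    \sum_(z | B z) (u (pt z) * (D z - e) + 2 * u 0 * k z + (M * (8 * a / b ^+ 3) + M * e)).
  by apply: ler_sum; exact: A3.
rewrite big_split big_split /= -mulr_sumr NE -big_mkcondr /=.
have -> : \sum_(z | B z && (sqn (pt z) <= 25 / 36)) 6 * u (pt z) =
    6 * \sum_(z | sqn (pt z) <= 25 / 36) u (pt z).
  rewrite mulr_sumr; apply: eq_bigl => z; rewrite /B; case: (lerP (sqn (pt z)) (25 / 36)) => //=; last by rewrite andbF.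
  by move=> s; rewrite andbT; apply/idP; lra.
rewrite -mulr_sumr; set S := \sum_(z | _) u _; set S1 := \sum_(z | _) _ in A1 *; set S2 := \sum_(z | _) k _ in A2 *.
move=> le1.
have h40 : 0 < h ^+ 4 by rewrite exprn_gt0.
have N0 : 0 <= N by rewrite ler0n.
have le2 : 6 * S <= 52 * u 0 * N + (M * (8 * a / b ^+ 3) + M * e) * N by nra.
have c0 : 0 <= M * (8 * a / b ^+ 3) := mulr_ge0 (ltW M0) ab0.
have c1 : 0 <= M * e := mulr_ge0 (ltW M0) (ltW e0).
move: (M * (8 * a / b ^+ 3)) (M * e) a2 e2 le2 c0 c1 => c c' cu0 c'u0 le2 c0 c1.
have le3 : 6 * S * h ^+ 4 <= (52 * u 0 + c + c') * (N * h ^+ 4).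
  by rewrite mulrA; apply: ler_wpM2r; [exact: ltW|lra].
have le4 : (52 * u 0 + c + c') * (N * h ^+ 4) <= (52 * u 0 + c + c') * 81.
  by apply: ler_wpM2l; lra.
by rewrite mulrC; lra.
Qed.

End MeanValue.

(** * Contact points of sliding paraboloids *)

Section RankOne.
Context {R : realType}.

Lemma discriminant_le (A B C : R) :
  (forall a b, 0 <= a ^+ 2 * A + 2 * a * b * B + b ^+ 2 * C) -> B ^+ 2 <= A * C.
Proof.
move=> H.
have A0 : 0 <= A by have := H 1 0; rewrite expr1n expr0n /= !mulr0 !mul0r !addr0 mul1r.
have C0 : 0 <= C by have := H 0 1; rewrite expr1n expr0n /= !mulr0 !mul0r !add0r mul1r.
have [C_gt0|C_le0] := ltP 0 C.
  have := H C (- B); have -> : C ^+ 2 * A + 2 * C * - B * B + (- B) ^+ 2 * C = C * (A * C - B ^+ 2) by ring.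
  by rewrite pmulr_rge0// subr_ge0.
have {C0 C_le0} CE : C = 0 by apply/eqP; rewrite eq_le C0 C_le0.
rewrite CE mulr0; have [->|B0] := eqVneq B 0; first by rewrite expr0n.
have := H 1 (- (A + 1) / (2 * B)); rewrite CE.
have -> : 1 ^+ 2 * A + 2 * 1 * (- (A + 1) / (2 * B)) * B + (- (A + 1) / (2 * B)) ^+ 2 * 0 = -1.
  by field.
by rewrite oppr_ge0 ler10.
Qed.

(** The vector is a e_j + b e_l + c e_i. The formula persists when indices coincide, which spares
    case distinctions in [psd_rank_one]. *)
Lemma quadratic_form3 n (N : 'I_n -> 'I_n -> R) (i j l : 'I_n) (a b c : R) :
  (forall p q, N p q = N q p) ->
  exists v : 'rV[R]_n, \sum_p \sum_q v 0 p * v 0 q * N p q =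
    a ^+ 2 * N j j + b ^+ 2 * N l l + c ^+ 2 * N i i +
    2 * (a * b * N j l + a * c * N j i + b * c * N l i).
Proof.
move=> sN; exists (\row_p ((p == j)%:R * a + (p == l)%:R * b + (p == i)%:R * c)).
have inner (f : 'I_n -> R) : \sum_q ((q == j)%:R * a + (q == l)%:R * b + (q == i)%:R * c) * f q =
    a * f j + b * f l + c * f i.
  rewrite (eq_bigr (fun q => (q == j)%:R * (a * f q) + (q == l)%:R * (b * f q) + (q == i)%:R * (c * f q))).
    rewrite big_split /= big_split /=.
    by rewrite (sum_delta (fun q => a * f q)) (sum_delta (fun q => b * f q)) (sum_delta (fun q => c * f q)).
  by move=> q _; ring.
transitivity (\sum_p ((p == j)%:R * a + (p == l)%:R * b + (p == i)%:R * c) * (a * N p j + b * N p l + c * N p i)).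
  apply: eq_bigr => p _; rewrite -inner mulr_sumr; apply: eq_bigr => q _; rewrite !mxE; ring.
by rewrite inner (sN l j) (sN i j) (sN i l); ring.
Qed.

(* Only one eigenvalue of [N] can be large, as [2 sigma_2 N <= 2 c tr N]: up to a bounded Schur complement,
   [N] has rank one. *)
Lemma psd_rank_one n (N : 'I_n.+1 -> 'I_n.+1 -> R) (c : R) :
  (forall p q, N p q = N q p) ->
  (forall v : 'rV[R]_n.+1, 0 <= \sum_p \sum_q v 0 p * v 0 q * N p q) ->
  0 <= c -> (\sum_p N p p) ^+ 2 - \sum_p \sum_q N p q ^+ 2 <= 2 * c * \sum_p N p p ->
  exists i, [/\ forall j, `|N j i| <= N i i, N i i <= \sum_p N p p &
    forall j l, `|N j l - N j i * N i l / N i i| <= n.+1%:R * (2 * c)].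
Proof.
move=> sN psd c0 s2; have nc0 : 0 <= n.+1%:R * (2 * c) by rewrite !mulr_ge0.
set T := \sum_p N p p in s2 *.
have Q i j l a b d : 0 <= a ^+ 2 * N j j + b ^+ 2 * N l l + d ^+ 2 * N i i +
    2 * (a * b * N j l + a * d * N j i + b * d * N l i).
  by have [v <-] := quadratic_form3 i j l a b d sN.
have diag j : 0 <= N j j.
  by have := Q j j j 1 0 0; rewrite expr1n expr0n /= !mulr0 !mul0r !addr0 mul1r mulr0 addr0.
have minor j l : N j l ^+ 2 <= N j j * N l l.
  apply: discriminant_le => a b; have := Q j j l a b 0.
  by rewrite expr0n /= !mul0r !mulr0 !mul0r !addr0; lra.
have [i _ imax] := @arg_maxP _ R _ ord0 xpredT (fun p => N p p) isT.
have {}imax j : N j j <= N i i by exact: imax.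
have Ti : T <= n.+1%:R * N i i.
  by rewrite -[n.+1]card_ord mulr_natl -sumr_const ler_sum.
have iT : N i i <= T by rewrite /T (bigD1 i)//= lerDl sumr_ge0.
exists i; split=> //.
  move=> j; rewrite -ler_sqr ?nnegrE// real_normK ?num_real// (le_trans (minor _ _))//.
  by rewrite expr2 ler_wpM2r.
have [Ni0|Ni0] := eqVneq (N i i) 0.
  move=> j l; rewrite Ni0 invr0 mulr0 subr0.
  have : N j l ^+ 2 <= 0.
    rewrite (le_trans (minor _ _))// (_ : N j j = 0) ?mul0r//.
    by apply/eqP; rewrite eq_le diag -Ni0 imax.
  move=> N0; have -> : N j l = 0 by apply/eqP; rewrite -sqrf_eq0 eq_le N0 sqr_ge0.
  by rewrite normr0.
have Nip : 0 < N i i by rewrite lt_def Ni0 diag.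
pose S j l := N j l - N j i * N i l / N i i.
have Sminor j l : S j l ^+ 2 <= S j j * S l l.
  apply: discriminant_le => a b.
  (* This coefficient of e_i minimizes the form; the minimum is the form of the Schur complement
     [S]. *)
  have := Q i j l a b (- (a * N j i + b * N l i) / N i i).
  rewrite /S (sN i l) (sN i j).
  suff -> : a ^+ 2 * N j j + b ^+ 2 * N l l + (- (a * N j i + b * N l i) / N i i) ^+ 2 * N i i +
    2 * (a * b * N j l + a * (- (a * N j i + b * N l i) / N i i) * N j i +
      b * (- (a * N j i + b * N l i) / N i i) * N l i) =
    a ^+ 2 * (N j j - N j i * N j i / N i i) + 2 * a * b * (N j l - N j i * N l i / N i i) +
    b ^+ 2 * (N l l - N l i * N l i / N i i) by [].
  by field.
have Sdiag j : S j j <= n.+1%:R * (2 * c).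
  have [->|ji] := eqVneq j i.
    by rewrite /S mulfK// subrr.
  (* T^2 - sum N_pq^2 is the sum of all minors N_pp N_qq - N_pq^2, each nonnegative, so any single
     one is bounded by the total. *)
  have le1 : N i i * N j j - N i j ^+ 2 <= 2 * c * T.
    apply: le_trans s2.
    have -> : T ^+ 2 - \sum_p \sum_q N p q ^+ 2 = \sum_p \sum_q (N p p * N q q - N p q ^+ 2).
      rewrite expr2 mulr_suml -sumrB; apply: eq_bigr => p _.
      by rewrite mulr_sumr -sumrB.
    have pos p q : 0 <= N p p * N q q - N p q ^+ 2 by rewrite subr_ge0.
    apply: (@le_trans _ _ (\sum_q (N i i * N q q - N i q ^+ 2))).
      by rewrite [leRHS](bigD1 j)//= lerDl sumr_ge0.
    by rewrite [leRHS](bigD1 i)//= lerDl sumr_ge0// => p _; rewrite sumr_ge0.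
  have -> : S j j = (N i i * N j j - N i j ^+ 2) / N i i.
    by rewrite /S (sN j i); field.
  rewrite ler_pdivrMr// (le_trans le1)//.
  have -> : n.+1%:R * (2 * c) * N i i = 2 * c * (n.+1%:R * N i i) by ring.
  by rewrite ler_wpM2l// mulr_ge0.
move=> j l; rewrite -/(S j l) -ler_sqr ?nnegrE// real_normK ?num_real//.
rewrite (le_trans (Sminor _ _))// expr2.
have Sp k : 0 <= S k k.
  rewrite /S subr_ge0 ler_pdivrMr// (sN i k) -expr2 mulrC (le_trans (minor _ _))// mulrC//.
by rewrite ler_pM.
Qed.

End RankOne.

Section Fiber.
Context {R : realType}.

(* The [k] lie in a tube of bounded width and length [O(N i i + 1)] around the direction [N _ i]. *)
Lemma fiber_card M (Y : {set 'rV['I_M]_4}) (k0 : 'rV['I_M]_4) (N : 'I_4 -> 'I_4 -> R) (h B : R)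
    (D2 : nat) (xi err : 'rV['I_M]_4 -> 'I_4 -> R) (i : 'I_4) :
  0 < h -> (forall j l, N j l = N l j) -> (forall j, `|N j i| <= N i i) ->
  (forall j l, `|N j l - N j i * N i l / N i i| <= B) ->
  (forall k, k \in Y -> forall j, [/\ `|xi k j| <= h, `|err k j| <= h &
    16 * h * ((k 0 j)%:R - (k0 0 j)%:R) = \sum_l N j l * xi k l + err k j]) ->
  (4 * B + 2) / 8 + 1 <= D2%:R ->
  #|Y|%:R <= (N i i + 5) * (D2 ^ 4)%:R.
Proof.
move=> h0 sN Nmax NB HY HD.
have Ni0 : 0 <= N i i by apply: le_trans (Nmax i).
pose L := (Num.truncn (N i i / 4 + 1)).+1.
have t0 : 0 <= N i i / 4 + 1 by rewrite addr_ge0// divr_ge0.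
have L1 : N i i / 4 + 1 < L%:R by rewrite truncnS_gt.
have L2 : L%:R <= N i i / 4 + 2.
  by have := truncn_le (N i i / 4 + 1); rewrite t0 => /= tl; rewrite /L -natr1; lra.
pose al j := N j i / N i i.
have al1 j : `|al j| <= 1.
  have [E|Ni] := eqVneq (N i i) 0; first by rewrite /al E invr0 mulr0 normr0.
  rewrite /al normrM normfV (ger0_norm Ni0) ler_pdivrMr ?mul1r//.
  by rewrite lt_def Ni Ni0.
pose W := (4 * B + 2) / 16.
pose A (k : 'rV['I_M]_4) j : R := (k 0 j : 'I_M)%:R - (k0 0 j : 'I_M)%:R.
have sumle (k : 'rV['I_M]_4) (F : 'I_4 -> R) (C : R) : k \in Y -> (forall l, `|F l| <= C) ->
    `|\sum_l F l * xi k l| <= 4 * (C * h).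
  move=> kY FC; rewrite (le_trans (ler_norm_sum _ _ _))//.
  rewrite (@le_trans _ _ (\sum_(l < 4) C * h))//; last by rewrite sumr_const card_ord mulr_natl.
  by apply: ler_sum => l _; rewrite normrM ler_pM//; have [] := HY _ kY l.
have devi (k : 'rV['I_M]_4) : k \in Y -> `|A k i| < L%:R.
  move=> kY; have [_ e1 E] := HY _ kY i; apply: le_lt_trans L1.
  have h16 : 0 < 16 * h by rewrite mulr_gt0.
  rewrite -(ler_pM2l h16) -{1}(gtr0_norm h16) -normrM E.
  rewrite (le_trans (ler_normD _ _))//.
  have := sumle k (N i) (N i i) kY (fun l => _ : `|N i l| <= N i i).
  by move=> /(_ (fun l => eq_ind_r (fun t => `|t| <= N i i) (Nmax l) (sN i l))); nra.
(* Subtracting [al j] times the i-th equation replaces row j of N by its Schur complement, which is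
   bounded by B. *)
have dev (k : 'rV['I_M]_4) j : k \in Y -> `|A k j - al j * A k i| <= W.
  move=> kY; have [_ e1 E1] := HY _ kY j; have [_ e2 E2] := HY _ kY i.
  have h16 : 0 < 16 * h by rewrite mulr_gt0.
  rewrite -(ler_pM2l h16) -{1}(gtr0_norm h16) -normrM.
  have -> : 16 * h * (A k j - al j * A k i) =
      \sum_l (N j l - N j i * N i l / N i i) * xi k l + (err k j - al j * err k i).
    rewrite mulrBr E1 (mulrCA (16 * h)) E2 mulrDr mulr_sumr opprD addrACA -sumrB.
    by congr (_ + _); apply: eq_bigr => l _; rewrite /al; ring.
  rewrite (le_trans (ler_normD _ _))//.
  have b1 := sumle k (fun l => N j l - N j i * N i l / N i i) B kY (NB j).
  have b2 : `|err k j - al j * err k i| <= 2 * h.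
    rewrite (le_trans (ler_normB _ _))// mulr_natl mulr2n lerD// normrM.
    by rewrite -[leRHS]mul1r ler_pM.
  have -> : 16 * h * W = 4 * (B * h) + 2 * h by rewrite /W; field.
  exact: lerD.
pose key (k : 'rV['I_M]_4) : nat := absz ((k 0%R i : nat)%:Z - (k0 0%R i : nat)%:Z + L%:Z).
have keyE (k : 'rV['I_M]_4) : k \in Y -> (key k)%:R = A k i + L%:R /\ (key k < 2 * L)%N.
  move=> kY; have := devi k kY; rewrite ltr_norml => /andP[d1 d2].
  have c1 : - L%:Z < (k 0%R i : nat)%:Z - (k0 0%R i : nat)%:Z.
    by rewrite -(ltr_int R) rmorphB /= rmorphN /= -!pmulrn.
  have c2 : (k 0%R i : nat)%:Z - (k0 0%R i : nat)%:Z < L%:Z.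
    by rewrite -(ltr_int R) rmorphB /= -!pmulrn.
  have E : (key k)%:Z = (k 0%R i : nat)%:Z - (k0 0%R i : nat)%:Z + L%:Z.
    by rewrite /key gez0_abs//; lia.
  split; last by move: E c2; move: (key k) => q; lia.
  by rewrite pmulrn E rmorphD rmorphB /= -!pmulrn.
pose off (q : nat) j := Num.floor ((k0 0 j : 'I_M)%:R + al j * (q%:R - L%:R) - W).
have cY : (#|Y| <= (2 * L) * D2 ^ 4)%N.
  apply: (@card_tube 4 M Y key off) => [k kY|k kY j]; first by case: (keyE _ kY).
  have [E _] := keyE _ kY; rewrite /off E addrK /A.
  have /ler_normlP[b1 b2] := dev k j kY; rewrite /A in b1 b2.
  set t := _ - W; have [f1 f2] : (Num.floor t)%:~R <= t /\ t < (Num.floor t)%:~R + 1.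
    by have := floor_itv t; rewrite rmorphD /= => /andP[].
  apply/andP; split.
    by rewrite -(ler_int R) -pmulrn (le_trans f1)// /t; lra.
  rewrite -(ltr_int R) rmorphD /= -!pmulrn.
  have : (k 0 j : 'I_M)%:R <= t + 2 * W by rewrite /t; lra.
  have : 2 * W + 1 <= D2%:R by rewrite /W; lra.
  lra.
apply: (@le_trans _ _ ((2 * L) * D2 ^ 4)%:R); first by rewrite ler_nat.
rewrite natrM ler_wpM2r// natrM; lra.
Qed.

End Fiber.

Section Contact.
Context {R : realType}.
Implicit Types (x y : 'rV[R]_4) (U : set 'rV[R]_4).

Lemma is_derive_expRN (t : R) : is_derive t 1 (fun t : R => expR (- t)) (- expR (- t)).
Proof.
have := @is_derive1_comp R expR -%R t _ _ (is_derive_expR (- t)) (is_deriveNid t 1).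
by apply: is_derive_val; rewrite mulrN1.
Qed.

Lemma C2on_expRN U (w : 'rV[R]_4 -> R) g H : open U -> C2on U w g H ->
  C2on U (fun x => expR (- w x)) (fun i x => - expR (- w x) * g i x)
    (fun i j x => expR (- w x) * (g i x * g j x - H i j x)).
Proof.
move=> oU wH.
have := @C2on_comp R 4 U w g H (fun t => expR (- t)) (fun t => - expR (- t)) (fun t => expR (- t)) oU wH _.
have E : (fun (i j : 'I_4) x => expR (- w x) * g i x * g j x + - expR (- w x) * H i j x) =
    (fun i j x => expR (- w x) * (g i x * g j x - H i j x)).
  by apply/funext => i; apply/funext => j; apply/funext => x; ring.
rewrite E; apply => x _; split; first exact: is_derive_expRN.
  have := is_deriveN (is_derive_expRN (w x)); apply: is_derive_val; by rewrite opprK.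
apply/differentiable_continuous/derivable1_diffP; by case: (is_derive_expRN (w x)).
Qed.

Lemma C2on_expR U (w : 'rV[R]_4 -> R) g H : open U -> C2on U w g H ->
  C2on U (fun x => expR (w x)) (fun i x => expR (w x) * g i x)
    (fun i j x => expR (w x) * (g i x * g j x + H i j x)).
Proof.
move=> oU wH.
have := @C2on_comp R 4 U w g H expR expR expR oU wH _.
have E : (fun (i j : 'I_4) x => expR (w x) * g i x * g j x + expR (w x) * H i j x) =
    (fun i j x => expR (w x) * (g i x * g j x + H i j x)).
  by apply/funext => i; apply/funext => j; apply/funext => x; ring.
rewrite E; apply => x _; split; try exact: is_derive_expR.
exact: continuous_expR.
Qed.

(** Here s = psi and N = D^2 psi + 16. The left side of the quartic equation appears inside 2
    sigma_2(N); once s Q is bounded, the positive remaining terms are linear in s (Q - S) = tr N -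
    64. *)
Lemma hessian_trace_sq (h : 'I_4 -> 'I_4 -> R) (p : 'I_4 -> R) (s : R) :
  let N i j := s * (p i * p j - h i j) + 16 * (i == j)%:R in
  let S := \sum_i h i i in let Q := \sum_i p i ^+ 2 in
  (\sum_i N i i = s * (Q - S) + 64) /\
  (\sum_i N i i) ^+ 2 - \sum_i \sum_j N i j ^+ 2 =
    s ^+ 2 * (S ^+ 2 - \sum_i \sum_j h i j ^+ 2 + Q * S + 2 * \sum_i \sum_j h i j * (p i * p j)) +
    3 * s ^+ 2 * Q * (Q - S) - 3 * (s * Q) ^+ 2 + 96 * (s * (Q - S)) + 3072.
Proof.
move=> N S Q.
have trE : \sum_i N i i = s * (Q - S) + 64.
  rewrite (eq_bigr (fun i => s * (p i ^+ 2 - h i i) + 16)).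
    by rewrite big_split /= -mulr_sumr sumrB sumr_const card_ord -mulr_natl -/S -/Q; ring.
  by move=> i _; rewrite /N eqxx mulr1 expr2.
split=> //; rewrite trE.
have -> : \sum_i \sum_j N i j ^+ 2 =
    s ^+ 2 * (Q ^+ 2 - 2 * \sum_i \sum_j h i j * (p i * p j) + \sum_i \sum_j h i j ^+ 2) +
    32 * (s * (Q - S)) + 1024; last by ring.
  transitivity (\sum_i (s ^+ 2 * (p i ^+ 2 * Q - 2 * (\sum_j h i j * (p i * p j)) + \sum_j h i j ^+ 2) +
      (32 * (s * (p i ^+ 2 - h i i)) + 256))).
    apply: eq_bigr => i _.
    transitivity (\sum_j (s ^+ 2 * (p i ^+ 2 * p j ^+ 2 - 2 * (h i j * (p i * p j)) + h i j ^+ 2) +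
       (j == i)%:R * (32 * (s * (p i * p j - h i j)) + 256))).
      apply: eq_bigr => j _; rewrite /N (eq_sym i j).
      by have [->|_] := eqVneq j i; rewrite ?eqxx ?mul1r ?mulr1 ?mul0r ?mulr0; ring.
    rewrite big_split /= (sum_delta (fun j => 32 * (s * (p i * p j - h i j)) + 256)).
    by rewrite -mulr_sumr big_split /= sumrB -!mulr_sumr -/Q -[p i * p i]expr2.
  rewrite big_split big_split /= -mulr_sumr big_split /= sumrB -mulr_suml -!mulr_sumr sumrB.
  by rewrite sumr_const card_ord -mulr_natl -/S -/Q; ring.
Qed.

(** X minimizes psi + 8 |x - y|^2 on the ball of radius 1/2. At an interior minimum the gradient
    vanishes and the Hessian N is nonnegative; the bound on |y| forces X to be interior. *)
Lemma contact U (w : 'rV[R]_4 -> R) g H y : open U -> C2on U w g H ->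
  [set x | sqn x <= 1] `<=` U -> w 0 = 0 ->
  (forall x, sqn x <= 1 -> expR (w x) <= 2) ->
  (forall x, sqn x <= 1 -> \sum_i H i i x + \sum_i g i x ^+ 2 < 0) ->
  (forall x, sqn x <= 1 ->
    (\sum_i H i i x) ^+ 2 - \sum_i \sum_j H i j x ^+ 2 +
    (\sum_i g i x ^+ 2) * (\sum_i H i i x) + 2 * \sum_i \sum_j H i j x * (g i x * g j x) <= 1) ->
  sqn y <= (1 / 8) ^+ 2 ->
  exists X, let N i j := expR (- w X) * (g i X * g j X - H i j X) + 16 * (i == j)%:R in
   [/\ sqn X <= 1 / 4, 8 / 9 <= expR (w X), (forall i, 16 * y 0 i = 16 * X 0 i + - expR (- w X) * g i X),
    (forall v : 'rV[R]_4, 0 <= \sum_p \sum_q v 0 p * v 0 q * N p q) &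
    ((\sum_i N i i) ^+ 2 - \sum_i \sum_j N i j ^+ 2 <= 2 * 348 * \sum_i N i i /\
     \sum_i N i i <= 2 * - (\sum_i expR (w X) * (g i X * g i X + H i i X)) + 464)].
Proof.
move=> oU wH BU w0 w2 E1 E2 y8.
have psiH := C2on_expRN oU wH; set psi := fun x => expR (- w x) in psiH.
have FH := C2on_add psiH (C2on_scale 8 oU (C2on_sqn U y)).
set F := fun x => psi x + _ in FH.
pose K := [set x : 'rV[R]_4 | sqn (x - 0) <= 1 / 4].
have KB x : K x -> sqn x <= 1 by rewrite /K /= subr0; lra.
have K0 : K 0 by rewrite /K /= subr0 sqn0; lra.
have [||X KX Xmin] := @compact_EVT_min _ R F K _ (@compact_sqn R 4 0 (1 / 4)).
- by exists 0.
- apply/continuous_in_subspaceT => x; rewrite inE => Kx.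
  by apply: (C1on_continuous oU FH.1); exact/BU/KB.
rewrite inE in KX; have {}Xmin x : K x -> F X <= F x by move=> Kx; apply: Xmin; rewrite inE.
have FX : F X <= 9 / 8.
  apply: le_trans (Xmin _ K0) _; rewrite /F /psi w0 oppr0 expR0 sub0r sqnN.
  by move: y8; rewrite expr2; lra.
have psi2 x : sqn x <= 1 -> 1 / 2 <= psi x.
  move=> x1; rewrite /psi expRN -[1 / 2]invrK; have := w2 _ x1; have := expR_gt0 (w x).
  by move=> e0 e2; rewrite lef_pV2 ?posrE ?invr_gt0 ?divr_gt0// invf_div divr1.
(* At distance 1/2 from 0 one has |X - y| >= 3/8, so F >= 1/2 + 8 * 9/64 = 13/8, whereas F(0) <= 1 +
   8/64 = 9/8. *)
have Xin : sqn X < 1 / 4.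
  rewrite ltNge; apply/negP => X4.
  have far : 9 / 64 <= sqn (X - y).
    rewrite leNgt; apply/negP => Xy.
    have := @sqn_add_lt R 4 (X - y) y (3 / 8) (1 / 8) _ _ _ y8.
    rewrite subrK => /(_ _ _ _) K1; have : sqn X < (3 / 8 + 1 / 8) ^+ 2 by apply: K1; rewrite ?expr2; lra.
    by rewrite expr2; lra.
  have := psi2 _ (KB _ KX); move: FX; rewrite /F; lra.
have UX : U X by exact/BU/KB.
have [d d0 Hd] : exists2 d : R, 0 < d & box X d `<=` [set x | sqn (x - 0) < 1 / 4].
  by apply: open_box; [exact: (@open_sqn R 4 0 (1 / 4))|rewrite /= subr0].
have [grad hess] := C2on_min oU FH UX d0 (fun x xX => Xmin x (ltW (Hd x xX))).
have Xy : sqn (X - y) <= (5 / 8) ^+ 2.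
  have := @sqn_add R 4 X (- y) (1 / 2) (1 / 8); rewrite sqnN => /(_ _ _ _ y8) K1.
  have -> : 5 / 8 = 1 / 2 + 1 / 8 :> R by field.
  by apply: K1; rewrite ?expr2; lra.
have p0 : 0 < psi X by exact: expR_gt0.
have pX : psi X <= 9 / 8.
  by move: FX; rewrite /F; have := sqn_ge0 (X - y); lra.
have uX : expR (w X) = (psi X)^-1 by rewrite /psi expRN invrK.
exists X => N; have [trN trN2] := @hessian_trace_sq (fun i j => H i j X) (fun i => g i X) (psi X).
rewrite /= -/N in trN trN2.
set S := \sum_i H i i X in trN trN2; set Q := \sum_i g i X ^+ 2 in trN trN2.
have SQ : S + Q < 0 by exact/E1/KB.
have e2 := E2 _ (KB _ KX); rewrite -/S -/Q in e2.
have gradE i : - psi X * g i X = - 16 * (X 0 i - y 0 i).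
  by have := grad i; rewrite -/(psi X); lra.
(* psi grad w = 16 (X - y) with |X - y| <= 5/8. Together with psi >= 1/2 this gives psi Q <= 200. *)
have pQ : psi X ^+ 2 * Q <= 100.
  have -> : psi X ^+ 2 * Q = 256 * sqn (X - y).
    rewrite /Q /sqn !mulr_sumr; apply: eq_bigr => i _.
    have E : psi X * g i X = 16 * (X 0 i - y 0 i) by have := gradE i; lra.
    by rewrite -exprMn E !mxE; ring.
  by move: Xy; rewrite expr2; lra.
have pX2 : 1 / 2 <= psi X by exact/psi2/KB.
have Q0 : 0 <= Q by apply: sumr_ge0 => i _; exact: sqr_ge0.
have pQ2 : psi X * Q <= 200 by move: pQ; rewrite expr2; nra.
have pQ0 : 0 <= psi X * Q by rewrite mulr_ge0// ltW.
have psq : psi X ^+ 2 <= 2 by rewrite expr2; nra.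
have hessN (v : 'rV[R]_4) : 0 <= \sum_p \sum_q v 0 p * v 0 q * N p q.
  have := hess v; congr (0 <= _); apply: eq_bigr => p _; apply: eq_bigr => q _.
  by rewrite /N -/(psi X); ring.
split.
- by rewrite ltW.
- by rewrite uX -[8 / 9]invrK lef_pV2 ?posrE ?invr_gt0 ?divr_gt0// invf_div.
- by move=> i; have := gradE i; rewrite -/(psi X); lra.
- exact: hessN.
have T0 : 0 <= \sum_i N i i.
  apply: sumr_ge0 => i _; have := hessN (delta_mx 0 i).
  rewrite (bigD1 i)//= (bigD1 i)//= !mxE !eqxx !mul1r big1 ?addr0.
    rewrite big1 ?addr0// => j ji; rewrite big1// => k _; by rewrite !mxE (negPf ji) andbF !mul0r.
  by move=> j ji; rewrite !mxE (negPf ji) andbF mulr0 mul0r.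
have psQ : psi X ^+ 2 * - (S + Q) >= 0 by rewrite mulr_ge0 ?sqr_ge0// oppr_ge0 ltW.
have TE : \sum_i N i i - 64 = psi X * (Q - S) by rewrite trN; ring.
(* The constants are 2 * 348 = 3 * 200 + 96, from psi Q <= 200 in [trN2], and 464 = 2 * 200 + 64,
   from psi^2 <= 2 and [trN]. *)
split.
  rewrite trN2.
  set E := S ^+ 2 - _ + _ + _ in e2 *.
  have le1 : psi X ^+ 2 * E <= 2 by have := sqr_ge0 (psi X); nra.
  have -> : 3 * psi X ^+ 2 * Q * (Q - S) = 3 * (psi X * Q) * (\sum_i N i i - 64) by rewrite TE; ring.
  rewrite -TE.
  move: (psi X * Q) (\sum_i N i i) pQ2 pQ0 T0 => q T q2 q0 t0.
  have := sqr_ge0 q; nra.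
have -> : \sum_i expR (w X) * (g i X * g i X + H i i X) = (psi X)^-1 * (S + Q).
  by rewrite -mulr_sumr big_split /= uX addrC.
have -> : \sum_i N i i = psi X ^+ 2 * ((psi X)^-1 * - (S + Q)) * 1 + 2 * (psi X * Q) + 64.
  by rewrite trN; field; rewrite gt_eqF.
have : 0 <= (psi X)^-1 * - (S + Q) by rewrite mulr_ge0 ?invr_ge0 ?oppr_ge0 ?ltW.
rewrite mulrN; set t := _^-1 * _ => t0; nra.
Qed.

End Contact.

(** * Counting vertices by the cells of their contact points *)

Section Key.
Context {R : realType}.
Implicit Types (x y o : 'rV[R]_4) (U : set 'rV[R]_4).

Lemma C1on_lin_uniform U f g K (e : R) : open U -> (forall i : 'I_4, C1on U (f i) (g i)) -> compact K ->
  K `<=` U -> 0 < e ->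
  exists2 h0 : R, 0 < h0 & forall x h, K x -> 0 < h -> h < h0 ->
    forall xi : 'rV[R]_4, (forall i, `|xi 0 i| <= h) ->
    forall i, `|f i (x + xi) - f i x - \sum_j xi 0 j * g i j x| <= e * h.
Proof.
move=> oU fg cK KU e0.
apply: (compact_uniform (P := fun x h => forall xi : 'rV[R]_4, (forall i, `|xi 0 i| <= h) ->
    forall i, `|f i (x + xi) - f i x - \sum_j xi 0 j * g i j x| <= e * h)) => // x Kx.
have /choice[D HD] : forall i, exists d : R, 0 < d /\ forall y (xi : 'rV[R]_4) (h : R), box x d y -> 0 < h -> h < d ->
    (forall i, `|xi 0 i| <= h) ->
    `|f i (y + xi) - f i y - \sum_j xi 0 j * g i j y| <= e * h.
  by move=> i; have [d d0 Hd] := C1on_lin oU (fg i) (KU _ Kx) e0; exists d.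
exists (\big[Num.min/1]_i D i).
  by apply/bigmin_gtP; split=> [|i _]; [exact: ltr01|case: (HD i)].
move=> y h xy h0 hd xi xih i; apply: (HD i).2 => //; first by apply: le_box xy; exact: bigmin_le.
by apply: (lt_le_trans hd); exact: bigmin_le.
Qed.

Lemma lap_uniform U f g (H : 'I_4 -> 'I_4 -> 'rV[R]_4 -> R) K (e : R) : open U -> C2on U f g H -> compact K ->
  K `<=` U -> 0 < e ->
  exists2 h0 : R, 0 < h0 & forall x h, K x -> 0 < h -> h < h0 ->
    forall xi : 'rV[R]_4, (forall i, `|xi 0 i| <= h) ->
    `|lap h f (x + xi) - h ^+ 2 * \sum_i H i i x| <= e * h ^+ 2.
Proof.
move=> oU fH cK KU e0.
apply: (compact_uniform (P := fun x h => forall xi : 'rV[R]_4, (forall i, `|xi 0 i| <= h) ->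
    `|lap h f (x + xi) - h ^+ 2 * \sum_i H i i x| <= e * h ^+ 2)) => // x Kx.
have [d d0 Hd] := C2on_lap oU fH (KU _ Kx) e0.
by exists d => // y h xy h0 hd xi; exact: Hd.
Qed.

Lemma cont_uniform (f : 'rV[R]_4 -> R) K (e : R) : (forall x, K x -> {for x, continuous f}) -> compact K -> 0 < e ->
  exists2 h0 : R, 0 < h0 & forall x h, K x -> 0 < h -> h < h0 ->
    forall xi : 'rV[R]_4, (forall i, `|xi 0 i| <= h) -> `|f (x + xi) - f x| <= e.
Proof.
move=> cf cK e0.
apply: (compact_uniform (P := fun x h => forall xi : 'rV[R]_4, (forall i, `|xi 0 i| <= h) ->
    `|f (x + xi) - f x| <= e)) => // x Kx.
have e20 : 0 < e / 2 by rewrite divr_gt0.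
have [d d0 Hd] := continuous_box (cf _ Kx) e20.
exists (d / 2); first by rewrite divr_gt0.
move=> y h xy h0 hd xi xih.
have b1 : box x d y by apply: le_box xy; rewrite ler_pdivrMr// ler_pMr ?ler1n.
have b2 : box x d (y + xi).
  rewrite (splitr d); apply: (box_sub xy) => i.
  by rewrite mxE addrAC subrr add0r (le_lt_trans (xih i)).
have /ltr_normlP[a1 a2] := Hd _ b1; have /ltr_normlP[a3 a4] := Hd _ b2.
by apply/ler_normlP; split; lra.
Qed.

Lemma compact_sqn0 (r : R) : compact [set x : 'rV[R]_4 | sqn x <= r].
Proof.
have := @compact_sqn R 4 0 r.
rewrite (_ : [set x | sqn (x - 0) <= r] = [set x | sqn x <= r])//.
by apply/seteqP; split=> x /=; rewrite subr0.
Qed.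

Definition cell_index m o (h : R) x : 'rV['I_m.+2]_4 :=
  \row_i inord (Num.truncn ((x 0 i - o 0 i) / h)).

Lemma cell_indexP m o (h : R) x : 0 < h -> covers o h m -> (forall i, `|x 0 i| <= 1) ->
  cell (lpt o h (cell_index m o h x)) h x.
Proof.
move=> h0 cov x1 i; have [c1 c2] := cov i; have := x1 i; rewrite ler_norml => /andP[x2 x3].
have t0 : 0 <= (x 0 i - o 0 i) / h by rewrite divr_ge0 ?(ltW h0)//; lra.
have tm : (x 0 i - o 0 i) / h < m.+2%:R.
  have : (x 0 i - o 0 i) / h < m%:R by rewrite ltr_pdivrMr//; lra.
  by move=> /lt_le_trans; apply; rewrite ler_nat; lia.
rewrite !mxE inordK; last by rewrite truncn_lt_nat.
have := truncn_itv t0; rewrite ler_pdivlMr// ltr_pdivrMr// => /andP[a b].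
apply/andP; split; first lra.
by move: b; rewrite -natr1 mulrDl mul1r; lra.
Qed.

Lemma y_grid M (h : R) (k : 'rV['I_M]_4) : 0 < h -> M%:R * h <= 1 / 8 ->
  sqn (lpt (const_mx (- (1 / 16))) h k) <= (1 / 8) ^+ 2.
Proof.
move=> h0 Mh.
rewrite (@le_trans _ _ (\sum_(i < 4) (1 / 16 : R) ^+ 2))//; last first.
  by rewrite sumr_const card_ord -[_ *+ 4]mulr_natl !expr2; lra.
apply: ler_sum => i _; rewrite !mxE -real_normK ?num_real//.
rewrite ler_sqr ?nnegrE//.
have k1 : (k 0%R i : nat)%:R * h <= M%:R * h by rewrite ler_wpM2r ?(ltW h0)// ler_nat ltnW.
have k0 : 0 <= (k 0%R i : nat)%:R * h by rewrite mulr_ge0 ?ler0n ?ltW.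
by rewrite ler_norml mulrC; apply/andP; split; lra.
Qed.

Lemma sub_coord x y i : (x - y) 0 i = x 0 i - y 0 i.
Proof. by rewrite !mxE. Qed.

Lemma cell_index_near m o (h : R) x : 0 < h -> covers o h m -> sqn x <= 1 ->
  forall i, `|(lpt o h (cell_index m o h x) - x) 0 i| <= h.
Proof.
move=> h0 cov x1 i.
have X1 j : `|x 0 j| <= 1 by apply: coord_le => //; rewrite expr1n.
have := cell_indexP h0 cov X1 i; rewrite sub_coord => /andP[p1 p2].
by rewrite ler_norml; apply/andP; split; lra.
Qed.

Lemma cell_index_eq m o (h : R) x y : 0 < h -> covers o h m -> sqn x <= 1 -> sqn y <= 1 ->
  cell_index m o h x = cell_index m o h y -> forall i, `|(x - y) 0 i| <= h.
Proof.
move=> h0 cov x1 y1 xy i.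
have X1 j : `|x 0 j| <= 1 by apply: coord_le => //; rewrite expr1n.
have Y1 j : `|y 0 j| <= 1 by apply: coord_le => //; rewrite expr1n.
have := cell_indexP h0 cov X1 i; have := cell_indexP h0 cov Y1 i.
rewrite xy sub_coord => /andP[p1 p2] /andP[p3 p4].
by rewrite ler_norml; apply/andP; split; lra.
Qed.

Lemma sqn_near x p (h : R) : 0 < h -> h < 1 / 64 -> sqn x <= 1 / 4 ->
  (forall i, `|(p - x) 0 i| <= h) -> sqn p <= 5 / 16.
Proof.
move=> h0 hh x4 px.
have -> : p = x + (p - x) by rewrite addrC subrK.
apply: le_trans (_ : (1 / 2 + 2 * h) ^+ 2 <= _).
  apply: sqn_add; rewrite ?mulr_gt0 ?divr_gt0//.
    by apply: le_trans x4 _; rewrite expr2; lra.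
  apply: (@le_trans _ _ (\sum_(i < 4) h ^+ 2)).
    by apply: ler_sum => i _; rewrite -real_normK ?num_real// ler_sqr ?nnegrE// ltW.
  by rewrite sumr_const card_ord -[_ *+ 4]mulr_natl exprMn; nra.
by nra.
Qed.

(** Subtracting the gradient equations of two vertices with contact points in one cell gives 16 h (k
    - k0) = N (X_k - X_k0) + err, with all increments at most h. This is the input of [fiber_card],
    with B = 4 * (2 * 348) from [psd_rank_one]. *)
Lemma contact_fiber_le (U : set 'rV[R]_4) (w : 'rV[R]_4 -> R) g H M m o (h : R) D2
    (X : 'rV['I_M]_4 -> 'rV[R]_4) k0 (xg := fun j x => - expR (- w x) * g j x)
    (N := fun i j => expR (- w (X k0)) * (g i (X k0) * g j (X k0) - H i j (X k0)) + 16 * (i == j)%:R) :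
  open U -> C2on U w g H -> U (X k0) -> 0 < h -> covers o h m -> (forall k, sqn (X k) <= 1 / 4) ->
  (4 * (4 * (2 * 348)) + 2) / 8 + 1 <= D2%:R :> R ->
  (forall k i, 16 * lpt (const_mx (- (1 / 16))) h k 0 i = 16 * X k 0 i + xg i (X k)) ->
  (forall xi : 'rV[R]_4, (forall i, `|xi 0 i| <= h) -> forall j,
    `|xg j (X k0 + xi) - xg j (X k0) -
      \sum_l xi 0 l * (expR (- w (X k0)) * (g j (X k0) * g l (X k0) - H j l (X k0)))| <= 1 * h) ->
  (forall v : 'rV[R]_4, 0 <= \sum_p \sum_q v 0 p * v 0 q * N p q) ->
  (\sum_i N i i) ^+ 2 - \sum_i \sum_j N i j ^+ 2 <= 2 * 348 * \sum_i N i i ->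
  #|[set k | cell_index m o h (X k) == cell_index m o h (X k0)]%SET|%:R <= (\sum_i N i i + 5) * (D2 ^ 4)%:R.
Proof.
move=> oU wH UX h0 cov X4 HD2 yX Hh1 psdN s2N.
have X1 k : sqn (X k) <= 1 by apply: le_trans (X4 k) _; lra.
have sN i j : N i j = N j i.
  by rewrite /N (C2on_sym i j oU wH UX) (mulrC (g i _)) (eq_sym i j).
have [i [Nmax NiT NB]] := @psd_rank_one R 3 N 348 sN psdN (ler0n _ 348) s2N.
pose xi k j := (X k - X k0) 0 j.
pose err k j := xg j (X k) - xg j (X k0) -
  \sum_l (X k - X k0) 0 l * (expR (- w (X k0)) * (g j (X k0) * g l (X k0) - H j l (X k0))).
have := @fiber_card R M [set k | cell_index m o h (X k) == cell_index m o h (X k0)]%SET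
  k0 N h (4 * (2 * 348)) D2 xi err i h0 sN Nmax NB _ HD2.
move=> F; apply: le_trans (F _) _; last by rewrite ler_wpM2r ?ler0n// lerD2r.
move=> k; rewrite inE => /eqP zk j.
have xih := cell_index_eq h0 cov (X1 k) (X1 k0) zk.
split; first exact: xih.
  have := Hh1 _ xih j; rewrite mul1r /err.
  by rewrite [X k0 + _]addrC subrK.
have := yX k j; have := yX k0 j; rewrite ![lpt _ _ _ 0 _]mxE [const_mx _ 0 _]mxE => e2 e1.
have -> : 16 * h * ((k 0%R j)%:R - (k0 0%R j)%:R) = 16 * (X k 0 j - X k0 0 j) + (xg j (X k) - xg j (X k0)).
  by lra.
rewrite /err /N (eq_bigr (fun l => (X k - X k0) 0 l * (expR (- w (X k0)) * (g j (X k0) * g l (X k0) - H j l (X k0))) +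
   (l == j)%:R * (16 * (X k - X k0) 0 l))).
  by rewrite big_split /= (sum_delta (fun l => 16 * (X k - X k0) 0 l)) sub_coord; ring.
by move=> l _; rewrite /xi (eq_sym j l); ring.
Qed.

Lemma bump_le4 x : bump (1 / 4) x <= 4 :> R.
Proof.
have s0 := sqn_ge0 x; rewrite /bump /bumpG ler_pdivrMr; last lra.
have p0 : 0 <= Num.max 0 (1 - sqn x - 1 / 4) :> R by rewrite le_max lexx.
have p1 : Num.max 0 (1 - sqn x - 1 / 4) <= 1 :> R by rewrite ge_max ler01 /=; lra.
have := exprn_ile1 3 p0 p1; lra.
Qed.

Lemma bump_ge8 x : sqn x <= 5 / 16 -> 1 <= 8 * bump (1 / 4) x :> R.
Proof.
move=> s5; have s0 := sqn_ge0 x; rewrite /bump /bumpG mulrA ler_pdivlMr; last lra.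
have p1 : 7 / 16 <= Num.max 0 (1 - sqn x - 1 / 4) :> R by rewrite le_max; apply/orP; right; lra.
have p0 : 0 <= 7 / 16 :> R by rewrite divr_ge0.
have : (7 / 16) ^+ 3 <= Num.max 0 (1 - sqn x - 1 / 4) ^+ 3 :> R by rewrite lerXn2r ?nnegrE// (le_trans p0).
lra.
Qed.

(** Each count is multiplied by 8 times the bump, which is at least 1 on the occupied cells; then
    the Laplacian is moved from u to the bump. Since the bump is at most 4 and minus its Laplacian
    at most q h^2, the constant is 8 (4 p + 2 q). *)
Lemma mass_sum m (n : 'rV['I_m.+2]_4 -> nat) (u : 'rV[R]_4 -> R) (h C p q : R) o :
  0 < h -> h < 1 / 64 -> covers o h m -> 0 < C -> 0 < p ->
  (forall x, 0 < u x) ->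
  (forall z : 'rV['I_m.+2]_4, sqn (lpt o h z) <= 1 -> lap h u (lpt o h z) < 0) ->
  (forall z : 'rV['I_m.+2]_4, sqn (lpt o h z) <= 1 ->
     - lap h (bump (1 / 4)) (lpt o h z) <= q * h ^+ 2) ->
  (forall z : 'rV['I_m.+2]_4, (0 < n z)%N -> sqn (lpt o h z) <= 5 / 16 /\
    h ^+ 2 * (n z)%:R <= C * (- 2 * lap h u (lpt o h z) + p * h ^+ 2 * u (lpt o h z))) ->
  \sum_(z : 'rV['I_m.+2]_4) (n z)%:R <=
   C * (p * 32 + 16 * q) * \sum_(z : 'rV['I_m.+2]_4 | sqn (lpt o h z) < 1) u (lpt o h z).
Proof.
move=> h0 hh cov C0 p0 u0 Lneg Lb nz.
have h20 : 0 < h ^+ 2 by rewrite exprn_gt0.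
have a0 : 0 < 1 / 4 :> R by rewrite divr_gt0.
have h1 : h <= 1 by lra.
pose b (z : 'rV['I_m.+2]_4) : R := bump (1 / 4) (lpt o h z).
pose L (z : 'rV['I_m.+2]_4) : R := lap h u (lpt o h z).
pose l (z : 'rV['I_m.+2]_4) : R := lap h (bump (1 / 4)) (lpt o h z).
pose uu (z : 'rV['I_m.+2]_4) : R := u (lpt o h z).
have b0 z : 0 <= b z by exact: bump_ge0.
have uu0 z : 0 < uu z by exact: u0.
have step z : h ^+ 2 * (n z)%:R <= 8 * C * (- 2 * (b z * L z) + p * h ^+ 2 * (b z * uu z)).
  have [z1|z1] := leP (sqn (lpt o h z)) 1; last first.
    have [/nz[z5 _]|] := ltnP 0 (n z); first by move: z1 z5; lra.
    rewrite leqn0 => /eqP ->; rewrite mulr0 /b bump_eq0; last lra.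
    by rewrite !mul0r !mulr0 addr0 mulr0.
  have T0 : 0 <= - 2 * L z + p * h ^+ 2 * uu z.
    have : 0 <= p * h ^+ 2 * uu z by rewrite (mulr_ge0 (mulr_ge0 (ltW p0) (ltW h20)) (ltW (uu0 z))).
    have := Lneg _ z1; rewrite -/(L z); lra.
  rewrite (_ : 8 * C * _ = 8 * b z * (C * (- 2 * L z + p * h ^+ 2 * uu z))); last by ring.
  have CT : 0 <= C * (- 2 * L z + p * h ^+ 2 * uu z) by rewrite mulr_ge0// ltW.
  have [/nz[z5 nC]|] := ltnP 0 (n z).
    by apply: le_trans nC _; rewrite -/(L z) -/(uu z) ler_peMl// bump_ge8.
  by rewrite leqn0 => /eqP ->; rewrite mulr0 mulr_ge0// mulr_ge0.
have step2 z : u (lpt o h z) * (- 2 * l z + p * h ^+ 2 * b z) * 8 <=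
   if sqn (lpt o h z) < 1 then h ^+ 2 * (p * 32 + 16 * q) * uu z else 0.
  case: ifPn => z1.
    have lz := Lb _ (ltW z1); have bz := bump_le4 (lpt o h z).
    rewrite -/(uu z) -/(b z) -/(l z) in lz bz *.
    rewrite mulrC mulrCA mulrC ler_pM2r//.
    have := ler_wpM2l (ltW (mulr_gt0 p0 h20)) bz; lra.
  rewrite -leNgt in z1.
  rewrite /b bump_eq0; last lra.
  by rewrite /l lap_bump_out// ?mulr0 ?addr0 ?mulr0 ?mul0r//; lra.
rewrite -(ler_pM2l h20) mulr_sumr.
apply: le_trans (ler_sum _ (fun z _ => step z)) _.
rewrite -mulr_sumr big_split /= -!mulr_sumr.
have sl := @sum_lap R 4 m o h _ u h0 (bump_margin h0 h1 cov a0).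
have -> : \sum_z b z * L z = \sum_z u (lpt o h z) * l z by exact: sl.
have -> : 8 * C * (- 2 * \sum_z u (lpt o h z) * l z + p * h ^+ 2 * \sum_z b z * uu z) =
    C * \sum_z (u (lpt o h z) * (- 2 * l z + p * h ^+ 2 * b z) * 8).
  rewrite [in RHS](eq_bigr (fun z => 8 * (- 2 * (u (lpt o h z) * l z) + p * h ^+ 2 * (b z * uu z)))).
    by rewrite -[in RHS]mulr_sumr [in RHS]big_split /= -!mulr_sumr; ring.
  by move=> z _; rewrite /uu; ring.
rewrite [leRHS]mulrCA -[leRHS]mulrA ler_pM2l//.
apply: le_trans (ler_sum _ (fun z _ => step2 z)) _.
by rewrite -big_mkcond /= -mulr_sumr mulrA [_ * h ^+ 2]mulrC.
Qed.

End Key.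

Section ContactMass.
Context {R : realType}.
Implicit Types (x y o : 'rV[R]_4) (U : set 'rV[R]_4).

(** The constant terms and the error in 2 l add up to 464 + 5 + 2 = 471. They are absorbed by p v
    because v >= 8/9 - 1/4 > 1/2 and p = 2 * 471. *)
Lemma fiber_arith (h C L l u p : R) : 0 < h -> 0 < C -> p = 942 -> 8 / 9 <= u ->
  `|l - h ^+ 2 * L| <= 1 * h ^+ 2 -> forall v, `|v - u| <= 1 / 4 ->
  h ^+ 2 * ((2 * - L + 464 + 5) * C) <= C * (- 2 * l + p * h ^+ 2 * v).
Proof.
move=> h0 C0 -> u8; rewrite mul1r => /ler_normlP[l1 l2] v /ler_normlP[v1 v2].
rewrite mulrA [_ * C]mulrC ler_pM2l//.
have h2 : 0 < h ^+ 2 by rewrite exprn_gt0.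
have v3 : 23 / 36 <= v by lra.
have := ler_wpM2l (ltW h2) v3; nra.
Qed.

(** For a = 1/4 the kernel 8 a / (t + a)^3 is at most 8 / a^2 = 128; the discretization error adds
    1. *)
Lemma bump_lap_arith (t h l : R) : 0 <= t ->
  - (l - h ^+ 2 * (if t + 1 / 4 < 1 then 24 * (1 - (t + 1 / 4)) + 8 * (1 / 4) - 8 * (1 / 4) / (t + 1 / 4) ^+ 3
    else 0)) <= 1 * h ^+ 2 -> - l <= 129 * h ^+ 2.
Proof.
move=> t0; have h2 : 0 <= h ^+ 2 by exact: sqr_ge0.
case: ifP => t1 l1; last by lra.
have s3 : (1 / 4) ^+ 3 <= (t + 1 / 4) ^+ 3 by rewrite lerXn2r ?nnegrE//; lra.
have s30 : 0 < (t + 1 / 4) ^+ 3 by rewrite exprn_gt0//; lra.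
have q : 8 * (1 / 4) / (t + 1 / 4) ^+ 3 <= 128 by rewrite ler_pdivrMr//; lra.
have : - 128 <= 24 * (1 - (t + 1 / 4)) + 8 * (1 / 4) - 8 * (1 / 4) / (t + 1 / 4) ^+ 3 by lra.
by move=> /(ler_wpM2l h2); lra.
Qed.

(* Aleksandrov-Bakelman-Pucci argument: slide the paraboloids [t - 8 |x - y|^2], [y] in a small lattice cube,
   from below against [exp (- w)]. The admissible-cone inequality bounds the number of [y] touching in a given
   cell by [C (1 + trace)], and the trace is dominated by [- lap (exp w)], which can be summed by parts. *)
Lemma contact_mass : exists2 c0 : R, 0 < c0 & forall U (w : 'rV[R]_4 -> R) g H, open U -> C2on U w g H ->
  [set x | sqn x <= 1] `<=` U -> w 0 = 0 ->
  (forall x, sqn x <= 1 -> expR (w x) <= 2) ->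
  (forall x, sqn x <= 1 -> \sum_i H i i x + \sum_i g i x ^+ 2 < 0) ->
  (forall x, sqn x <= 1 ->
    (\sum_i H i i x) ^+ 2 - \sum_i \sum_j H i j x ^+ 2 +
    (\sum_i g i x ^+ 2) * (\sum_i H i i x) + 2 * \sum_i \sum_j H i j x * (g i x * g j x) <= 1) ->
  exists2 h0 : R, 0 < h0 & forall h, 0 < h -> h < h0 -> forall m o, covers o h m ->
    c0 <= \sum_(z : 'rV['I_m.+2]_4 | sqn (lpt o h z) < 1) h ^+ 4 * expR (w (lpt o h z)).
Proof.
have [D2 HD2] : exists D2 : nat, (4 * (4 * (2 * 348)) + 2) / 8 + 1 <= D2%:R :> R.
  by exists (Num.truncn ((4 * (4 * (2 * 348)) + 2) / 8 + 1 : R)).+1; rewrite ltW// truncnS_gt.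
pose C : R := (D2 ^ 4)%:R.
have C0 : 0 < C.
  have : 0 < D2%:R :> R by apply: lt_le_trans HD2; lra.
  by rewrite /C natrX => ?; rewrite exprn_gt0.
have [p p942 pE] : exists2 p : R, 0 < p & p = 942 by exists 942; rewrite ?ltr0n.
pose Q : R := p * 32 + 16 * 129.
have Q0 : 0 < Q by rewrite addr_gt0 ?mulr_gt0.
exists ((1 / 16) ^+ 4 / (C * Q)); first by rewrite divr_gt0 ?exprn_gt0 ?mulr_gt0 ?divr_gt0.
move=> U w g H oU wH BU w0 w2 E1 E2.
pose K := [set x : 'rV[R]_4 | sqn x <= 1 / 4]; pose B := [set x : 'rV[R]_4 | sqn x <= 1].
have cK : compact K by exact: compact_sqn0.
have cB : compact B by exact: compact_sqn0.
have KU : K `<=` U by move=> x Kx; apply: BU; move: Kx; rewrite /K /=; lra.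
have uH := C2on_expR oU wH.
have [h1 h10 Hh1] := @C1on_lin_uniform _ _ _ _ _ 1 oU (C2on_expRN oU wH).2 cK KU ltr01.
have [h2 h20 Hh2] := lap_uniform oU uH cK KU ltr01.
have [h3 h30 Hh3] := @cont_uniform R (fun x => expR (w x)) K (1 / 4)
  (fun x Kx => C1on_continuous oU uH.1 (KU _ Kx)) cK (divr_gt0 ltr01 (ltr0Sn R 3)).
have uneg x : sqn x <= 1 -> \sum_i expR (w x) * (g i x * g i x + H i i x) < 0.
  move=> x1; rewrite -mulr_sumr big_split /= pmulr_rlt0 ?expR_gt0// addrC.
  by under [X in _ + X]eq_bigr do rewrite -expr2; exact: E1.
have [h4 h40 Hh4] := lap_neg oU uH cB BU uneg.
have a0 : 0 < 1 / 4 :> R by rewrite divr_gt0.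
have [h5 h50 Hh5] := @lap_uniform R setT _ _ _ B 1 openT (C2on_bump a0) cB (fun _ _ => I) ltr01.
exists (Num.min (Num.min (Num.min h1 h2) (Num.min h3 h4)) (Num.min h5 (1 / 64))).
  by rewrite !lt_min h10 h20 h30 h40 h50 divr_gt0.
move=> h h0; rewrite !lt_min => /andP[/andP[/andP[hh1 hh2] /andP[hh3 hh4]] /andP[hh5 hh6]] m o cov.
have hlt1 : h <= 1 by lra.
(* The vertex cube then has side M h between 1/16 and 1/8: small enough for [contact], yet with M^4
   vertices its volume stays bounded below. *)
pose M := Num.truncn (1 / (8 * h)).
have h80 : 0 < 8 * h by rewrite mulr_gt0.
have t0 : 0 <= 1 / (8 * h) by rewrite divr_ge0// ltW.
have Mh : M%:R * h <= 1 / 8.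
  have := truncn_le (1 / (8 * h)); rewrite t0 ler_pdivlMr// -/M => /= ?; lra.
have Mh2 : 1 / 16 <= M%:R * h.
  have := truncnS_gt (1 / (8 * h)); rewrite ltr_pdivrMr// -/M -natr1 => ?; lra.
pose yy (k : 'rV['I_M]_4) := lpt (const_mx (- (1 / 16))) h k.
have /choice[X HX] : forall k : 'rV['I_M]_4, exists X, let N i j := expR (- w X) * (g i X * g j X - H i j X) + 16 * (i == j)%:R in
   [/\ sqn X <= 1 / 4, 8 / 9 <= expR (w X), (forall i, 16 * yy k 0 i = 16 * X 0 i + - expR (- w X) * g i X),
    (forall v : 'rV[R]_4, 0 <= \sum_p \sum_q v 0 p * v 0 q * N p q) &
    ((\sum_i N i i) ^+ 2 - \sum_i \sum_j N i j ^+ 2 <= 2 * 348 * \sum_i N i i /\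
     \sum_i N i i <= 2 * - (\sum_i expR (w X) * (g i X * g i X + H i i X)) + 464)].
  by move=> k; apply: (contact oU wH) => //; exact: y_grid.
have X4 k : sqn (X k) <= 1 / 4 by case: (HX k).
have X1 k : sqn (X k) <= 1 by apply: le_trans (X4 k) _; rewrite ler_pdivrMr// mul1r ler1n.
pose zz k := cell_index m o h (X k).
pose pt (z : 'rV['I_m.+2]_4) := lpt o h z.
pose lapu z := lap h (fun x => expR (w x)) (pt z).
pose n z := #|[set k | zz k == z]%SET|.
have fiber z : (0 < n z)%N -> sqn (pt z) <= 5 / 16 /\
    h ^+ 2 * (n z)%:R <= C * (- 2 * lapu z + p * h ^+ 2 * expR (w (pt z))).
  rewrite card_gt0 => /set0Pn[k0]; rewrite inE => /eqP zk0; rewrite -zk0.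
  have p0 := cell_index_near h0 cov (X1 k0).
  split; first exact: sqn_near p0.
  have [_ X08 yX0 psdN [s2N trN]] := HX k0.
  have yX k : forall i, 16 * yy k 0 i = 16 * X k 0 i + - expR (- w (X k)) * g i (X k) by case: (HX k).
  have F := contact_fiber_le oU wH (KU _ (X4 k0)) h0 cov X4 HD2 yX (Hh1 _ _ (X4 k0) h0 hh1) psdN s2N.
  apply: le_trans (_ : h ^+ 2 * ((2 * - (\sum_i expR (w (X k0)) * (g i (X k0) * g i (X k0) + H i i (X k0))) + 464 + 5) * C) <= _).
    rewrite ler_pM2l ?exprn_gt0//; apply: le_trans F _.
    by rewrite ler_pM2r// lerD2r.
  have ptE : pt (zz k0) = X k0 + (pt (zz k0) - X k0) by rewrite addrC subrK.
  have := Hh3 _ _ (X4 k0) h0 hh3 _ p0; have := Hh2 _ _ (X4 k0) h0 hh2 _ p0.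
  rewrite -ptE -/(lapu _) => l1 v1.
  exact: (fiber_arith h0 C0 pE X08 l1 v1).
(* Every vertex has a chosen contact point, hence exactly one cell. *)
have Mn : (M ^ 4)%:R = \sum_z (n z)%:R :> R.
  rewrite -natr_sum; congr (_%:R).
  rewrite -[in LHS](card_ord M) -(card_mx _ 1 4) -sum1_card (partition_big zz xpredT)//=.
  by apply: eq_bigr => z _; rewrite sum1dep_card.
have Lneg z : sqn (pt z) <= 1 -> lapu z < 0 by move=> z1; exact: Hh4.
have Lb z : sqn (pt z) <= 1 -> - lap h (bump (1 / 4)) (pt z) <= 129 * h ^+ 2.
  move=> z1; have e0 i : `|(0 : 'rV[R]_4) 0 i| <= h by rewrite mxE normr0 ltW.
  have := Hh5 _ _ z1 h0 hh5 0 e0; rewrite addr0 bump_lap// => /ler_normlP[b1 _].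
  exact: bump_lap_arith (sqn_ge0 (pt z)) b1.
have S := @mass_sum R m n (fun x => expR (w x)) h C p 129 o h0 hh6 cov C0 p942
  (fun x => expR_gt0 (w x)) Lneg Lb fiber.
rewrite -mulr_sumr ler_pdivrMr; last exact: mulr_gt0.
have h4p : 0 < h ^+ 4 by rewrite exprn_gt0.
apply: le_trans (_ : h ^+ 4 * (M ^ 4)%:R <= _).
  rewrite natrX -exprMn [h * _]mulrC lerXn2r// nnegrE.
    by rewrite divr_ge0.
  by rewrite mulr_ge0// ltW.
by rewrite -[leRHS]mulrA ler_pM2l// Mn [leRHS]mulrC.
Qed.

End ContactMass.

(** * Rescaling and the choice of the maximum point *)

Section Scaled.
Context {R : realType}.
Implicit Types (x y o p : 'rV[R]_4) (U : set 'rV[R]_4).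

Lemma lpt_scale m o p (h d : R) (z : 'rV['I_m]_4) :
  lpt (d^-1 *: (o - p)) (h / d) z = d^-1 *: (lpt o h z - p).
Proof. by apply/rowP => i; rewrite !mxE; ring. Qed.

Lemma sqn_scale x (d r : R) : 0 < d -> (sqn (d^-1 *: x) < r) = (sqn x < r * d ^+ 2).
Proof.
by move=> d0; rewrite sqnZ -ltr_pdivrMr ?exprn_gt0// exprVn mulrC.
Qed.

Lemma sqn_scale_le x (d r : R) : 0 < d -> (sqn (d^-1 *: x) <= r) = (sqn x <= r * d ^+ 2).
Proof.
by move=> d0; rewrite sqnZ -ler_pdivrMr ?exprn_gt0// exprVn mulrC.
Qed.

(** The pointwise inequality that replaces Jensen's: integrating it at a suitable level t turns a
    lower bound for the mass of u into one for u^4. *)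
Lemma tangent_le (t a : R) : 0 < t -> 0 <= a -> a <= t + a ^+ 4 / t ^+ 3.
Proof.
move=> t0 a0; have [at1|ta] := leP a t.
  by rewrite (le_trans at1)// lerDl divr_ge0 ?exprn_ge0// ltW.
apply: le_trans (_ : a ^+ 4 / t ^+ 3 <= _); last by rewrite lerDr ltW.
rewrite ler_pdivlMr ?exprn_gt0// [a ^+ 4]exprS ler_wpM2l//.
by rewrite lerXn2r ?nnegrE// ltW.
Qed.

Lemma mass4_ge m o (h c0 : R) (u : 'rV[R]_4 -> R) : 0 < h -> h <= 1 -> 0 < c0 ->
  (forall x, 0 <= u x) ->
  c0 <= \sum_(z : 'rV['I_m]_4 | sqn (lpt o h z) < 1) h ^+ 4 * u (lpt o h z) ->
  (c0 / 162) ^+ 3 * (c0 / 2) <=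
    \sum_(z : 'rV['I_m]_4 | sqn (lpt o h z) < 1) h ^+ 4 * u (lpt o h z) ^+ 4.
Proof.
(* The lattice volume is at most 81, so the part below level t uses at most 81 t = c0 / 2. *)
move=> h0 h1 c00 u0 Hc; pose t := c0 / 162.
have t0 : 0 < t by rewrite divr_gt0.
have h4 : 0 < h ^+ 4 by rewrite exprn_gt0.
have tc : t * 3 ^+ 4 = c0 / 2 by rewrite /t; field.
have card : \sum_(z : 'rV['I_m]_4 | sqn (lpt o h z) < 1) h ^+ 4 <= 3 ^+ 4.
  apply: le_trans (card_ball m o h0 h1).
  rewrite sumr_const -[leLHS]mulr_natl ler_wpM2r ?(ltW h4)// ler_nat.
  apply: subset_leq_card; apply/fintype.subsetP => z; rewrite !inE unfold_in => z1.
  by apply/forallP => i; apply: coord_lt => //; rewrite expr1n.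
have : c0 <= t * 3 ^+ 4 +
    (\sum_(z : 'rV['I_m]_4 | sqn (lpt o h z) < 1) h ^+ 4 * u (lpt o h z) ^+ 4) / t ^+ 3.
  apply: le_trans Hc _.
  apply: (@le_trans _ _ (\sum_(z : 'rV['I_m]_4 | sqn (lpt o h z) < 1)
     (t * h ^+ 4 + h ^+ 4 * u (lpt o h z) ^+ 4 / t ^+ 3))).
    apply: ler_sum => z _; rewrite (mulrC t) -mulrA -mulrDr ler_pM2l//.
    exact: tangent_le.
  rewrite big_split /=; apply: lerD; last by rewrite mulr_suml.
  by rewrite -mulr_sumr ler_pM2l.
rewrite tc -lerBlDl {1}(splitr c0) addrK => Hs.
by rewrite [leLHS]mulrC -ler_pdivlMr// exprn_gt0.
Qed.

Lemma quartic_scale n (d : R) (G : 'I_n -> R) (M : 'I_n -> 'I_n -> R) :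
  (\sum_i d ^+ 2 * M i i) ^+ 2 - \sum_i \sum_j (d ^+ 2 * M i j) ^+ 2 +
    (\sum_i (d * G i) ^+ 2) * (\sum_i d ^+ 2 * M i i) +
    2 * \sum_i \sum_j d ^+ 2 * M i j * (d * G i * (d * G j)) =
  d ^+ 4 * ((\sum_i M i i) ^+ 2 - \sum_i \sum_j M i j ^+ 2 +
    (\sum_i G i ^+ 2) * (\sum_i M i i) + 2 * \sum_i \sum_j M i j * (G i * G j)).
Proof.
have e1 : \sum_i d ^+ 2 * M i i = d ^+ 2 * \sum_i M i i by rewrite mulr_sumr.
have e2 : \sum_i \sum_j (d ^+ 2 * M i j) ^+ 2 = d ^+ 4 * \sum_i \sum_j M i j ^+ 2.
  by rewrite mulr_sumr; apply: eq_bigr => i _; rewrite mulr_sumr; apply: eq_bigr => j _; ring.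
have e3 : \sum_i (d * G i) ^+ 2 = d ^+ 2 * \sum_i G i ^+ 2.
  by rewrite mulr_sumr; apply: eq_bigr => i _; ring.
have e4 : \sum_i \sum_j d ^+ 2 * M i j * (d * G i * (d * G j)) =
    d ^+ 4 * \sum_i \sum_j M i j * (G i * G j).
  by rewrite mulr_sumr; apply: eq_bigr => i _; rewrite mulr_sumr; apply: eq_bigr => j _; ring.
by rewrite e1 e2 e3 e4; ring.
Qed.

(** [contact_mass] applied to w(p + d y) - w(p), for which the quartic expression is multiplied by
    d^4. The mass of u serves the Harnack inequality, that of u^4 the bound by the integral. *)
Lemma local_mass : exists2 c0 : R, 0 < c0 & forall U (w : 'rV[R]_4 -> R) g H p (d T : R),
  open U -> C2on U w g H -> 0 < d -> [set x | sqn (x - p) <= d ^+ 2] `<=` U ->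
  (forall x, sqn (x - p) <= d ^+ 2 -> expR (w x) <= 2 * expR (w p)) ->
  (forall x, sqn (x - p) <= d ^+ 2 -> \sum_i H i i x + \sum_i g i x ^+ 2 < 0) ->
  (forall x, sqn (x - p) <= d ^+ 2 ->
    (\sum_i H i i x) ^+ 2 - \sum_i \sum_j H i j x ^+ 2 +
    (\sum_i g i x ^+ 2) * (\sum_i H i i x) + 2 * \sum_i \sum_j H i j x * (g i x * g j x) <= T) ->
  d ^+ 4 * T <= 1 ->
  exists2 h0 : R, 0 < h0 & forall h, 0 < h -> h < h0 -> forall m o,
    covers (d^-1 *: (o - p)) (h / d) m ->
    c0 * (d ^+ 4 * expR (w p)) <=
      \sum_(z : 'rV['I_m.+2]_4 | sqn (lpt o h z - p) < d ^+ 2) h ^+ 4 * expR (w (lpt o h z)) /\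
    c0 * (d ^+ 4 * expR (w p) ^+ 4) <=
      \sum_(z : 'rV['I_m.+2]_4 | sqn (lpt o h z - p) < d ^+ 2) h ^+ 4 * expR (w (lpt o h z)) ^+ 4.
Proof.
have [c0 c00 Hc] := @contact_mass R.
pose c1 := (c0 / 162) ^+ 3 * (c0 / 2).
have c10 : 0 < c1 by rewrite mulr_gt0 ?exprn_gt0 ?divr_gt0.
exists (Num.min c0 c1); first by rewrite lt_min c00.
move=> U w g H p d T oU wH d0 BU w2 E1 E2 dT.
have aE x : p + d *: (d^-1 *: (x - p)) = x by rewrite scalerA divff ?gt_eqF// scale1r addrC subrK.
have inB y : sqn y <= 1 -> sqn (p + d *: y - p) <= d ^+ 2.
  by move=> y1; rewrite addrC addKr sqnZ ler_piMr// exprn_ge0// ltW.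
pose V := [set y | U (p + d *: y)].
have oV : open V.
  apply: open_comp oU => y _.
  by apply: continuousD; [exact: cst_continuous|exact: scaler_continuous].
pose W y := w (p + d *: y) - w p.
have WH : C2on V W (fun i y => d * g i (p + d *: y)) (fun i j y => d ^+ 2 * H i j (p + d *: y)).
  have [a1 a2] := C2on_affine p d oU wH; split; last exact: a2.
  by apply: (C1on_ext (C1on_add a1 (C1on_cst (- w p)))) => // i y; rewrite addr0.
have [|||y y1|y y1|h0 h00 Hh0] := Hc V W _ _ oV WH.
- by move=> y y1; apply: BU; exact: inB.
- by rewrite /W scaler0 addr0 subrr.
- by move=> y y1; rewrite /W expRB ler_pdivrMr ?expR_gt0//; apply: w2; exact: inB.
- have := E1 _ (inB _ y1); rewrite -(pmulr_rlt0 _ (exprn_gt0 2 d0)) mulrDr.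
  rewrite !mulr_sumr.
  by under [X in _ + X]eq_bigr do rewrite -exprMn.
- have E := E2 _ (inB _ y1); apply: le_trans dT; rewrite -(ler_pM2l (exprn_gt0 4 d0)) in E.
  by rewrite quartic_scale.
exists (Num.min (d * h0) d); first by rewrite lt_min mulr_gt0.
move=> h hp; rewrite lt_min => /andP[hh hd] m o cov.
have hd0 : 0 < h / d by rewrite divr_gt0.
have S := Hh0 (h / d) hd0 _ m _ cov.
have {}S := S _; rewrite ltr_pdivrMr// mulrC in S; have {}S := S hh.
have S4 := mass4_ge hd0 _ c00 (fun y => expR_ge0 (W y)) S.
have {}S4 : c1 <= _ := S4 _; rewrite ler_pdivrMr// mul1r in S4; have {}S4 := S4 (ltW hd).
have E k : \sum_(z : 'rV['I_m.+2]_4 | sqn (lpt o h z - p) < d ^+ 2) h ^+ 4 * expR (w (lpt o h z)) ^+ k =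
    d ^+ 4 * expR (w p) ^+ k * \sum_(z : 'rV['I_m.+2]_4 | sqn (lpt (d^-1 *: (o - p)) (h / d) z) < 1)
       (h / d) ^+ 4 * expR (W (lpt (d^-1 *: (o - p)) (h / d) z)) ^+ k.
  rewrite mulr_sumr; apply: eq_big => z; first by rewrite lpt_scale sqn_scale// mul1r.
  move=> _; rewrite lpt_scale /W aE expRB !expr_div_n.
  by field; rewrite expf_neq0 ?gt_eqF ?expR_gt0.
have dp k : 0 <= d ^+ 4 * expR (w p) ^+ k by rewrite mulr_ge0 ?exprn_ge0 ?expR_ge0 ?(ltW d0).
split.
  have := E 1%N; under eq_bigr do rewrite expr1; move=> ->; rewrite expr1 mulrC.
  apply: ler_wpM2l; first exact: dp 1%N.
  by apply: le_trans (_ : c0 <= _); rewrite ?ge_min ?lexx.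
rewrite E mulrC; apply: ler_wpM2l; first exact: dp.
by apply: le_trans S4; rewrite ge_min lexx orbT.
Qed.

End Scaled.

(** * From lattice sums to integrals, and a common lattice *)

Section Assembly.
Context {R : realType}.
Implicit Types (x y o p : 'rV[R]_4) (U : set 'rV[R]_4).

Lemma cell_inj m o (h : R) (z1 z2 : 'rV['I_m]_4) x : 0 < h ->
  cell (lpt o h z1) h x -> cell (lpt o h z2) h x -> z1 = z2.
Proof.
move=> h0 c1 c2; apply/rowP => i; apply/val_inj => /=.
have := c1 i; have := c2 i; rewrite !mxE => /andP[a2 b2] /andP[a1 b1].
have key (a b : nat) : o 0 i + h * a%:R <= x 0 i -> x 0 i < o 0 i + h * b%:R + h -> (a <= b)%N.
  move=> xa xb; have : h * a%:R < h * (b.+1)%:R by rewrite -natr1 mulrDr mulr1; lra.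
  by rewrite ltr_pM2l// ltr_nat ltnS.
by apply/eqP; rewrite eqn_leq (key _ _ a1 b2) (key _ _ a2 b1).
Qed.

(** A positive continuous function varies by less than a factor 2 on small cells near a compact
    ball, so half the corner value is a lower bound and no infimum over cells is needed. *)
Lemma riemann_lower D (f : 'rV[R]_4 -> R) p (d : R) : open D ->
  (forall x, sqn (x - p) <= d ^+ 2 -> D x) -> (forall x, D x -> {for x, continuous f}) ->
  (forall x, 0 < f x) ->
  exists2 h0 : R, 0 < h0 & forall h, 0 < h -> h < h0 -> forall m o,
    ((\sum_(z : 'rV['I_m.+2]_4 | (sqn (lpt o h z - p) < d ^+ 2)%R) h ^+ 4 * (f (lpt o h z) / 2))%:E <=
      integral4 D (fun x => (f x)%:E))%E.
Proof.
move=> oD BD cf f0.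
have [h0 h00 Hh0] : exists2 h0 : R, 0 < h0 & forall x (h : R), sqn (x - p) <= d ^+ 2 -> 0 < h -> h < h0 ->
    forall y, box x h y -> D y /\ f x / 2 <= f y.
  apply: (compact_uniform (P := fun x h => forall y, box x h y -> D y /\ f x / 2 <= f y)
    (A := [set x | sqn (x - p) <= d ^+ 2])); first exact: compact_sqn.
  move=> x xd; have Dx := BD _ xd.
  have [d1 d10 H1] := open_box oD Dx.
  have [d2 d20 H2] := continuous_box (cf _ Dx) (divr_gt0 (f0 x) (ltr0n R 6)).
  exists (Num.min (d1 / 2) (d2 / 2)); first by rewrite lt_min !divr_gt0.
  move=> y h xy hp; rewrite lt_min => /andP[hd1 hd2] v yv.
  have xyd k : 0 < k -> h < k / 2 -> Num.min (d1 / 2) (d2 / 2) <= k / 2 -> box x k v.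
    move=> k0 hk mk; rewrite (splitr k); apply: (box_sub (le_box mk xy)).
    by apply: le_box yv; exact: ltW.
  split; first by apply: H1; apply: xyd => //; rewrite ge_min lexx.
  have /ltr_normlP[a1 a2] : `|f v - f x| < f x / 6.
    by apply: H2; apply: xyd => //; rewrite ge_min lexx orbT.
  have /ltr_normlP[a3 a4] : `|f y - f x| < f x / 6.
    apply: H2; apply: le_box xy; rewrite ge_min; apply/orP; right.
    by rewrite ler_pdivrMr// ler_pMr// ler1n.
  lra.
exists (h0 / 2); first by rewrite divr_gt0.
move=> h hp hh m o.
have h2 : 2 * h < h0 by move: hh; rewrite ltr_pdivlMr// mulrC.
apply: (@riemann_le_integral4 _ _ _ (fun z => lpt o h z)) => //.
- by move=> x; rewrite lee_fin ltW.
- by move=> z1 z2 x _ _; exact: cell_inj.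
- by move=> z _; rewrite divr_ge0// ltW.
- move=> z x zp xc; rewrite lee_fin.
  apply: (Hh0 _ (2 * h) (ltW zp)) => //; first by rewrite mulr_gt0.
  by move=> i; have /andP[c1 c2] := xc i; rewrite ltr_norml; apply/andP; split; lra.
Qed.

Lemma mean_value_scaled : exists2 C : R, 0 < C & forall U (u : 'rV[R]_4 -> R) g H p (d : R),
  open U -> C2on U u g H -> 0 < d -> [set x | sqn (x - p) <= d ^+ 2] `<=` U ->
  (forall x, U x -> 0 < u x) -> (forall x, U x -> \sum_i H i i x < 0) ->
  exists2 h0 : R, 0 < h0 & forall h, 0 < h -> h < h0 -> forall m o,
    covers (d^-1 *: (o - p)) (h / d) m ->
    \sum_(z : 'rV['I_m.+2]_4 | sqn (lpt o h z - p) <= 25 / 36 * d ^+ 2) h ^+ 4 * u (lpt o h z) <=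
      C * (d ^+ 4 * u p).
Proof.
have [C C0 HC] := @mean_value_lattice R.
exists C => // U u g H p d oU uH d0 BU u0 Hneg.
have aE x : p + d *: (d^-1 *: (x - p)) = x by rewrite scalerA divff ?gt_eqF// scale1r addrC subrK.
have inU y : sqn y <= 1 -> U (p + d *: y).
  by move=> y1; apply: BU => /=; rewrite addrC addKr sqnZ ler_piMr// exprn_ge0// ltW.
have oV : open [set y | U (p + d *: y)].
  apply: open_comp oU => y _.
  by apply: continuousD; [exact: cst_continuous|exact: scaler_continuous].
have [|y y1|y y1|h0 h00 Hh0] := HC _ _ _ _ oV (C2on_affine p d oU uH).
- by move=> y y1; exact: inU.
- exact/u0/inU.
- by rewrite -mulr_sumr pmulr_rlt0 ?exprn_gt0//; exact/Hneg/inU.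
exists (d * h0); first by rewrite mulr_gt0.
move=> h hp hh m o cov.
have hd0 : 0 < h / d by rewrite divr_gt0.
have hdh : h / d < h0 by rewrite ltr_pdivrMr// mulrC.
have := Hh0 _ hd0 hdh _ _ cov; rewrite scaler0 addr0 => S.
have -> : \sum_(z : 'rV['I_m.+2]_4 | sqn (lpt o h z - p) <= 25 / 36 * d ^+ 2) h ^+ 4 * u (lpt o h z) =
   d ^+ 4 * \sum_(z : 'rV['I_m.+2]_4 | sqn (lpt (d^-1 *: (o - p)) (h / d) z) <= 25 / 36)
       (h / d) ^+ 4 * u (p + d *: lpt (d^-1 *: (o - p)) (h / d) z).
  rewrite mulr_sumr; apply: eq_big => z; first by rewrite lpt_scale sqn_scale_le.
  by move=> _; rewrite lpt_scale aE; field; rewrite gt_eqF.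
by rewrite mulrCA ler_pM2l// exprn_gt0.
Qed.

(** The lattice is chosen before [p] and [d]: the Harnack inequality compares sums over two
    different balls of the same lattice. *)
Lemma covers_ex (L h : R) : 0 < h -> exists m o, forall p (d : R), 0 < d ->
  (forall i, `|p 0 i| + 2 * d <= L) -> covers (d^-1 *: (o - p)) (h / d) m.
Proof.
move=> h0; exists (Num.truncn (2 * L / h)).+1, (const_mx (- L)) => p d d0 pL i.
have := pL i; rewrite -lerBrDr ler_norml => /andP[l1 l2].
have m1 : 2 * L < h * (Num.truncn (2 * L / h)).+1%:R.
  by rewrite [ltRHS]mulrC -ltr_pdivrMr// truncnS_gt.
rewrite !mxE; split.
  by rewrite mulrC ler_pdivrMr//; lra.
rewrite [d^-1 * _]mulrC [h / d]mulrC -[X in _ <= _ + X]mulrA [X in _ <= _ + X]mulrC -mulrDl.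
rewrite ler_pdivlMr//; lra.
Qed.

End Assembly.

Section MaxPoint.
Context {R : realType}.
Implicit Types (x y o p c : 'rV[R]_4) (U : set 'rV[R]_4).

(** Unlike [sqn_add], the bound keeps |x|^2 itself, so that the weights in [max_point] can be
    compared at two points. *)
Lemma sqn_add_weight x y (a b : R) : 0 < a -> 0 < b -> sqn x <= a ^+ 2 -> sqn y <= b ^+ 2 ->
  sqn (x + y) <= sqn x + 2 * (a * b) + b ^+ 2.
Proof.
move=> a0 b0 xa yb.
have xy : sqn (x + y) <= (1 + b / a) * sqn x + (1 + a / b) * sqn y.
  rewrite /sqn !mulr_sumr -big_split; apply: ler_sum => i _; rewrite !mxE /=.
  move: (x 0 i) (y 0 i) => s t.
  have : 0 <= (b * s - a * t) ^+ 2 / (a * b) by rewrite divr_ge0 ?sqr_ge0// mulr_ge0 ?ltW.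
  have -> : (b * s - a * t) ^+ 2 / (a * b) = b / a * s ^+ 2 + a / b * t ^+ 2 - 2 * s * t.
    by field; rewrite !gt_eqF.
  by move=> ?; rewrite !mulrDl !mul1r sqrrD mulr2n; lra.
apply: le_trans xy _.
have h1 : b / a * sqn x <= a * b.
  by apply: (@le_trans _ _ (b / a * a ^+ 2)); [rewrite ler_pM2l ?divr_gt0|
    rewrite le_eqVlt; apply/orP; left; apply/eqP; field; rewrite gt_eqF].
have h2 : (1 + a / b) * sqn y <= b ^+ 2 + a * b.
  apply: (@le_trans _ _ ((1 + a / b) * b ^+ 2)); first by rewrite ler_pM2l// addr_gt0 ?divr_gt0.
  by rewrite le_eqVlt; apply/orP; left; apply/eqP; field; rewrite gt_eqF.
by rewrite mulrDl mul1r; lra.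
Qed.

Lemma max_point (u : 'rV[R]_4 -> R) c (r : R) : 0 < r ->
  (forall x, sqn (x - c) <= (3 / 2 * r) ^+ 2 -> {for x, continuous u}) ->
  (forall x, 0 < u x) ->
  exists p (d : R), [/\ 0 < d, d <= 9 / 128 * r,
    (forall x, sqn (x - p) <= d ^+ 2 -> sqn (x - c) <= (3 / 2 * r) ^+ 2 /\ u x <= 2 * u p) &
    (forall x, sqn (x - c) <= r ^+ 2 -> u x * (5 / 4 * r ^+ 2) ^+ 4 <= (32 * r * d) ^+ 4 * u p)].
Proof.
move=> r0 cu u0; pose K := [set x | sqn (x - c) <= (3 / 2 * r) ^+ 2].
pose b x := (3 / 2 * r) ^+ 2 - sqn (x - c).
have cF x : K x -> {for x, continuous (fun x => b x ^+ 4 * u x)}.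
  move=> Kx; apply: continuousM; last exact: cu.
  have cb : {for x, continuous b}.
    by apply: continuousB; [exact: cst_continuous|exact: continuous_sqn].
  apply: (@continuous_comp _ _ _ b (fun t : R => t ^+ 4)) => //; exact: exprn_continuous.
have Kc : K c by rewrite /K /= subrr sqn0 sqr_ge0.
have [||p] := @EVT_max_rV R 4 (fun x => b x ^+ 4 * u x) K _ (@compact_sqn R 4 c _).
- by exists c.
- by apply/continuous_in_subspaceT => x; rewrite inE; exact: cF.
rewrite inE => Kp; have {}Kp : sqn (p - c) <= (3 / 2 * r) ^+ 2 by [].
move=> pmax; have {}pmax x : K x -> b x ^+ 4 * u x <= b p ^+ 4 * u p by move=> Kx; apply: pmax; rewrite inE.
have bp0 : 0 < b p.
  rewrite lt_neqAle subr_ge0 Kp andbT eq_sym; apply/eqP => bp.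
  have := pmax _ Kc; rewrite bp expr0n mul0r leNgt mulr_gt0// exprn_gt0//.
  by rewrite /b subrr sqn0 subr0 exprn_gt0// mulr_gt0 ?divr_gt0.
have bp1 : b p <= 9 / 4 * r ^+ 2 by have := sqn_ge0 (p - c); rewrite /b exprMn; lra.
(* On B_d(p) the weight drops by at most 3 r d + d^2 <= 4 r d = b(p) / 8, and (7/8)^4 > 1/2 yields u
   <= 2 u(p). *)
pose d := b p / (32 * r).
have d0 : 0 < d by rewrite divr_gt0 ?mulr_gt0.
have dE : 32 * r * d = b p by rewrite /d; field; rewrite gt_eqF.
have dr : d <= 9 / 128 * r.
  by rewrite -(ler_pM2l (mulr_gt0 (ltr0n R 32) r0)) dE; move: bp1; rewrite expr2; lra.
have dd : d ^+ 2 <= 9 / 128 * (r * d) by rewrite expr2 [leRHS]mulrA ler_pM2r.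
exists p, d; split=> // x.
  move=> xp.
  have a0 : 0 < 3 / 2 * r by rewrite mulr_gt0 ?divr_gt0.
  have := sqn_add_weight a0 d0 Kp xp; rewrite addrC addrA subrK => xc.
  have rd : 0 < r * d by rewrite mulr_gt0.
  have bx : 7 / 8 * b p <= b x.
    rewrite -dE; move: dE; rewrite /b => dE'; lra.
  have Kx : K x by rewrite /K /= -subr_ge0 -/(b x); lra.
  split; first exact: Kx.
  have b4 : (7 / 8 * b p) ^+ 4 <= b x ^+ 4 by rewrite lerXn2r ?nnegrE//; lra.
  have bp4 : 0 < b p ^+ 4 by rewrite exprn_gt0.
  have := le_trans (ler_wpM2r (ltW (u0 x)) b4) (pmax _ Kx).
  rewrite exprMn mulrAC [b p ^+ 4 * _]mulrC ler_pM2r// => h4.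
  have := u0 x; lra.
move=> xr.
have Kx : K x.
  by apply: le_trans xr _; rewrite exprMn ler_peMl ?sqr_ge0//; lra.
rewrite dE; apply: le_trans (pmax _ Kx); rewrite mulrC ler_pM2r//.
rewrite lerXn2r ?nnegrE//.
- by rewrite mulr_ge0 ?sqr_ge0.
- by rewrite subr_ge0; exact: Kx.
- by rewrite /b exprMn; lra.
Qed.

End MaxPoint.

(** * The two estimates and the theorem *)

Section Core.
Context {R : realType}.
Implicit Types (x y o p c : 'rV[R]_4) (U : set 'rV[R]_4).

Lemma fourth_root (q : R) : 0 < q -> exists2 s : R, 0 < s & s ^+ 4 = q.
Proof.
move=> q0; exists (Num.sqrt (Num.sqrt q)); first by rewrite !sqrtr_gt0.
by rewrite (exprM _ 2 2) !sqr_sqrtr ?sqrtr_ge0// ltW.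
Qed.

Lemma coord_sum_le x i : `|x 0 i| <= \sum_j `|x 0 j|.
Proof. by rewrite (bigD1 i)//= lerDl sumr_ge0. Qed.

Lemma sub_sum_le (I : finType) (P Q : pred I) (F : I -> R) : (forall i, P i -> Q i) ->
  (forall i, 0 <= F i) -> \sum_(i | P i) F i <= \sum_(i | Q i) F i.
Proof.
move=> PQ F0; rewrite big_mkcond [leRHS]big_mkcond; apply: ler_sum => i _.
by case: ifP => [/PQ ->//|_]; case: ifP.
Qed.

Lemma growth_exponents (Q r d u v : R) : 0 < r -> 0 < d -> d <= r -> 0 <= Q -> 0 <= u -> 0 <= v ->
  u * r ^+ 4 <= Q * (d ^+ 4 * v) -> u ^+ 4 * r ^+ 4 <= Q ^+ 4 * (d ^+ 4 * v ^+ 4).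
Proof.
move=> r0 d0 dr Q0 u0 v0 h.
have [r4 d4] : 0 <= r ^+ 4 /\ 0 <= d ^+ 4 by rewrite !exprn_ge0// ltW.
have r12 : 0 < r ^+ 12 by rewrite exprn_gt0.
rewrite -(ler_pM2r r12).
have : (u * r ^+ 4) ^+ 4 <= (Q * (d ^+ 4 * v)) ^+ 4.
  by rewrite lerXn2r ?nnegrE ?(mulr_ge0 u0 r4) ?(mulr_ge0 Q0 (mulr_ge0 d4 v0)).
rewrite (_ : (u * r ^+ 4) ^+ 4 = u ^+ 4 * r ^+ 4 * r ^+ 12); last by ring.
rewrite (_ : (Q * (d ^+ 4 * v)) ^+ 4 = Q ^+ 4 * (d ^+ 4 * v ^+ 4) * d ^+ 12); last by ring.
move=> /le_trans; apply; apply: ler_wpM2l.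
  by apply: mulr_ge0; rewrite ?mulr_ge0 ?exprn_ge0// ltW.
by rewrite lerXn2r ?nnegrE// ltW.
Qed.

Lemma growth_base (r d u v : R) : 0 < r ->
  u * (5 / 4 * r ^+ 2) ^+ 4 <= (32 * r * d) ^+ 4 * v -> u * r ^+ 4 <= (32 * (4 / 5)) ^+ 4 * (d ^+ 4 * v).
Proof.
move=> r0 h; have k0 : 0 < (5 / 4) ^+ 4 * r ^+ 4 by rewrite mulr_gt0 ?exprn_gt0 ?divr_gt0.
rewrite -(ler_pM2r k0).
rewrite (_ : u * r ^+ 4 * _ = u * (5 / 4 * r ^+ 2) ^+ 4); last by ring.
apply: le_trans h _.
have E : 32 = 32 * (4 / 5) * (5 / 4) :> R by field.
rewrite {1}E; move: (32 * (4 / 5)) (5 / 4) => a b.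
by rewrite le_eqVlt; apply/orP; left; apply/eqP; ring.
Qed.

Lemma core_estimate : exists eps C : R, [/\ 0 < eps, 0 < C &
  forall c (r S : R) (w : 'rV[R]_4 -> R) g H, 0 < r -> 0 < S -> C2on (eball c (4 * r)) w g H ->
  (forall x, eball c (4 * r) x -> \sum_i H i i x + \sum_i g i x ^+ 2 < 0) ->
  (forall x, eball c (2 * r) x ->
    (\sum_i H i i x) ^+ 2 - \sum_i \sum_j H i j x ^+ 2 +
    (\sum_i g i x ^+ 2) * (\sum_i H i i x) + 2 * \sum_i \sum_j H i j x * (g i x * g j x)
    <= 2 * S * expR (4 * w x)) ->
  (S%:E * integral4 (eball c (2 * r)) (fun x => (expR (4 * w x))%:E) < eps%:E)%E ->
  (forall x, eball c r x ->
    ((expR (w x) ^+ 4 * r ^+ 4)%:E <= C%:E * integral4 (eball c (2 * r)) (fun x => (expR (4 * w x))%:E))%E) /\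
  (forall x y, eball c r x -> eball c r y -> expR (w x) <= C * expR (w y))].
Proof.
have [c0 c00 Hm] := @local_mass R; have [C1 C10 Hmv] := @mean_value_scaled R.
have [Q Q0 QE] : exists2 Q : R, 0 < Q & Q = (32 * (4 / 5)) ^+ 4.
  by exists ((32 * (4 / 5)) ^+ 4); rewrite ?exprn_gt0 ?mulr_gt0 ?divr_gt0.
pose Ca := Q ^+ 4 * (2 / c0); pose Cb := Q * (C1 / c0 * 3 ^+ 4).
have Ca0 : 0 < Ca by rewrite mulr_gt0 ?exprn_gt0 ?divr_gt0.
have Cb0 : 0 < Cb by exact: mulr_gt0 Q0 (mulr_gt0 (divr_gt0 C10 c00) (exprn_gt0 _ (ltr0n R 3))).
exists (c0 / 64), (Ca + Cb); split; rewrite ?divr_gt0 ?addr_gt0//.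
move=> c r S w g H r0 S0 wH E1 E2; set I := integral4 _ _ => SI.
have r20 : 0 < 2 * r by rewrite mulr_gt0.
have r40 : 0 < 4 * r by rewrite mulr_gt0.
have oball (k : R) : 0 < k -> open (eball c k).
  move=> k0; rewrite (_ : eball c k = [set x | sqn (x - c) < k ^+ 2]); first exact: open_sqn.
  by apply/seteqP; split=> x /(eball_sqn _ _ k0).
have oU := oball _ r40.
have b24 x : eball c (2 * r) x -> eball c (4 * r) x.
  by move=> /(eball_sqn _ _ r20) h; apply/eball_sqn => //; apply: (lt_le_trans h); nra.
have b32 x : sqn (x - c) <= (3 / 2 * r) ^+ 2 -> eball c (2 * r) x.
  by move=> h; apply/eball_sqn => //; apply: (le_lt_trans h); nra.
have cw x : eball c (4 * r) x -> {for x, continuous (fun x => expR (w x))}.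
  by move=> Ux; exact: (C1on_continuous oU (C2on_expR oU wH).1 Ux).
have [p [d [d0 dr Hball Hx]]] := max_point r0 (fun x h => cw x (b24 _ (b32 _ h))) (fun x => expR_gt0 (w x)).
have dr1 : d <= r by apply: le_trans dr _; nra.
pose v := expR (w p); have v0 : 0 < v by exact: expR_gt0.
have v40 : 0 < v ^+ 4 by rewrite exprn_gt0.
have expR4 x : expR (4 * w x) = expR (w x) ^+ 4 by rewrite -expRM_natl.
(* On this ball u <= 2 v, so the right side 2 S u^4 of the equation is at most 32 S v^4. *)
have local (e : R) : 0 < e -> e <= d -> e ^+ 4 * (32 * S * v ^+ 4) <= 1 ->
  exists2 h0 : R, 0 < h0 & forall h, 0 < h -> h < h0 -> forall m o,
    covers (e^-1 *: (o - p)) (h / e) m ->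
    c0 * (e ^+ 4 * v) <=
      \sum_(z : 'rV['I_m.+2]_4 | sqn (lpt o h z - p) < e ^+ 2) h ^+ 4 * expR (w (lpt o h z)) /\
    c0 * (e ^+ 4 * v ^+ 4) <=
      \sum_(z : 'rV['I_m.+2]_4 | sqn (lpt o h z - p) < e ^+ 2) h ^+ 4 * expR (w (lpt o h z)) ^+ 4.
  move=> e0 ed eS.
  have be x : sqn (x - p) <= e ^+ 2 -> sqn (x - p) <= d ^+ 2.
    by move=> h; apply: le_trans h _; rewrite lerXn2r ?nnegrE// ltW.
  apply: (Hm _ _ _ _ _ _ (32 * S * v ^+ 4) oU wH e0) => //.
  - by move=> x /be /Hball[h _]; exact/b24/b32.
  - by move=> x /be /Hball[].
  - by move=> x /be /Hball[h _]; exact/E1/b24/b32.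
  - move=> x /be /Hball[h ux]; apply: le_trans (E2 _ (b32 _ h)) _.
    have : expR (w x) ^+ 4 <= (2 * v) ^+ 4 by rewrite lerXn2r ?nnegrE ?expR_ge0// mulr_ge0// ltW.
    move=> /(ler_wpM2l (ltW S0)); rewrite expR4 exprMn; lra.
have energy (e : R) : 0 < e -> e <= d -> e ^+ 4 * (32 * S * v ^+ 4) <= 1 ->
    ((c0 / 2 * (e ^+ 4 * v ^+ 4))%:E <= I)%E.
  move=> e0 ed eS; have [h1 h10 H1] := local _ e0 ed eS.
  have bD x : sqn (x - p) <= e ^+ 2 -> eball c (2 * r) x.
    move=> h; have [] // := Hball x _; last by move=> h' _; exact: b32.
    by apply: le_trans h _; rewrite lerXn2r ?nnegrE// ltW.
  have c4 x : eball c (2 * r) x -> {for x, continuous (fun x => expR (4 * w x))}.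
    move=> /b24/cw h; have -> : (fun x => expR (4 * w x)) = (fun x => expR (w x) ^+ 4).
      by apply/funext => z; exact: expR4.
    by apply: (@continuous_comp _ _ _ (fun x => expR (w x)) (fun t : R => t ^+ 4)) => //; exact: exprn_continuous.
  have [h2 h20 H2] := riemann_lower (oball _ r20) bD c4 (fun x => expR_gt0 _).
  pose h := Num.min h1 h2 / 2.
  have hp : 0 < h by rewrite divr_gt0// lt_min h10.
  have /andP[hh1 hh2] : (h < h1) && (h < h2).
    by rewrite -lt_min ltr_pdivrMr// ltr_pMr ?ltr1n// lt_min h10.
  have [m [a cov]] := covers_ex (\sum_j `|p 0 j| + 2 * e) hp.
  have [_ L] := H1 h hp hh1 m a (cov _ _ e0 (fun i => lerD (coord_sum_le p i) (lexx _))).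
  apply: le_trans (H2 h hp hh2 m a).
  rewrite lee_fin -mulrA mulrCA mulrC.
  under eq_bigr do rewrite expR4 mulrA.
  by rewrite -mulr_suml ler_pM2r.
(* Otherwise some e <= d gives equality, and the energy bound at radius e reads S I >= S (c0 / 2) /
   (32 S) = c0 / 64, contrary to the smallness assumption. *)
have dS : d ^+ 4 * (32 * S * v ^+ 4) <= 1.
  rewrite leNgt; apply/negP => big.
  have d40 : 0 < d ^+ 4 by rewrite exprn_gt0.
  have q0 : 0 < (32 * S * v ^+ 4)^-1 by rewrite invr_gt0 !mulr_gt0.
  have [e e0 e4] := fourth_root q0.
  have ed : e <= d.
    rewrite -(ler_pXn2r (ltn0Sn 3)) ?nnegrE ?(ltW e0) ?(ltW d0)// e4.
    by rewrite -[leLHS]mul1r ler_pdivrMr ?mulr_gt0// ltW.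
  have := energy e e0 ed; rewrite e4 mulVf ?gt_eqF ?mulr_gt0// lexx => /(_ isT).
  move=> /(lee_wpmul2l (ltW S0 : (0 <= S%:E)%E)) /le_lt_trans /(_ SI).
  rewrite -EFinM lte_fin ltNge => /negP; apply.
  by rewrite le_eqVlt; apply/orP; left; apply/eqP; field; rewrite !gt_eqF.
have main x : eball c r x -> expR (w x) * r ^+ 4 <= Q * (d ^+ 4 * v).
  by move=> /(eball_sqn _ _ r0) h; rewrite QE; apply: growth_base => //; apply: Hx; exact: ltW.
have CaE (t : \bar R) : (0 <= t -> Ca%:E * t <= (Ca + Cb)%:E * t)%E.
  by move=> t0; apply: lee_wpmul2r => //; rewrite lee_fin lerDl ltW.
split.
  move=> x xr.
  have g4 := growth_exponents r0 d0 dr1 (ltW Q0) (expR_ge0 _) (ltW v0) (main x xr).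
  have E := energy _ d0 (lexx d) dS.
  have I0 : (0 <= I)%E by apply: le_trans E; rewrite lee_fin !mulr_ge0 ?exprn_ge0// ltW.
  apply: le_trans (CaE _ I0).
  apply: (@le_trans _ _ (Ca%:E * (c0 / 2 * (d ^+ 4 * v ^+ 4))%:E)%E).
    rewrite -EFinM lee_fin; apply: le_trans g4 _.
    by rewrite le_eqVlt; apply/orP; left; apply/eqP; rewrite /Ca; field; rewrite gt_eqF.
  by apply: lee_wpmul2l => //; rewrite lee_fin ltW.
move=> x y xr yr.
have [h1 h10 H1] := local _ d0 (lexx d) dS.
have y0 : sqn (y - c) < r ^+ 2 by exact/eball_sqn.
have cy : sqn (c - y) <= r ^+ 2 by rewrite -sqnN opprB ltW.
have r30 : 0 < 3 * r by rewrite mulr_gt0.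
have uH := C2on_expR oU wH.
(* The ball of radius 3 r about y stays in the domain, and its part of radius (5/6) 3 r = 3 r / 2 +
   r contains the ball of radius 3 r / 2 about c, hence the ball of radius d about p. *)
have [|||h2 h20 H2] := Hmv _ _ _ _ y (3 * r) oU uH r30.
- move=> z /= zy; apply/eball_sqn => //.
  rewrite (_ : z - c = (y - c) + (z - y)); last by rewrite [RHS]addrC addrA subrK.
  rewrite (_ : 4 * r = r + 3 * r); last by ring.
  exact: sqn_add_lt.
- by move=> z _; exact: expR_gt0.
- move=> z Uz; rewrite -mulr_sumr pmulr_rlt0 ?expR_gt0// big_split /= addrC.
  by under [X in _ + X]eq_bigr do rewrite -expr2; exact: E1.
pose h := Num.min h1 h2 / 2.
have hp : 0 < h by rewrite divr_gt0// lt_min h10.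
have /andP[hh1 hh2] : (h < h1) && (h < h2).
  by rewrite -lt_min ltr_pdivrMr// ltr_pMr ?ltr1n// lt_min h10.
have [m [a cov]] := covers_ex (\sum_j `|p 0 j| + \sum_j `|y 0 j| + 2 * d + 2 * (3 * r)) hp.
have n0 (q : 'rV[R]_4) : 0 <= \sum_j `|q 0 j| :> R by rewrite sumr_ge0.
have covp : covers (d^-1 *: (a - p)) (h / d) m.
  by apply: cov => // i; have := coord_sum_le p i; have := n0 y; lra.
have covy : covers ((3 * r)^-1 *: (a - y)) (h / (3 * r)) m.
  by apply: cov => // i; have := coord_sum_le y i; have := n0 p; lra.
have [L _] := H1 h hp hh1 m a covp; have M := H2 h hp hh2 m a covy.
have {}L : c0 * (d ^+ 4 * v) <= C1 * ((3 * r) ^+ 4 * expR (w y)).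
  apply: le_trans L _; apply: le_trans M.
  apply: sub_sum_le => z.
    move=> /ltW /Hball[zc _].
    rewrite (_ : lpt a h z - y = (lpt a h z - c) + (c - y)); last by rewrite addrA subrK.
    rewrite (_ : 25 / 36 * (3 * r) ^+ 2 = (3 / 2 * r + r) ^+ 2); last by field.
    by apply: sqn_add => //; rewrite mulr_gt0 ?divr_gt0.
  by rewrite mulr_ge0 ?expR_ge0 ?exprn_ge0// ltW.
have r4 : 0 < r ^+ 4 by rewrite exprn_gt0.
have B : expR (w x) <= Cb * expR (w y).
  rewrite -(ler_pM2r r4); apply: le_trans (main x xr) _.
  have := ler_wpM2l (ltW (divr_gt0 Q0 c00)) L.
  rewrite (_ : Q / c0 * (c0 * _) = Q * (d ^+ 4 * v)); last by field; rewrite gt_eqF.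
  by move=> /le_trans; apply; rewrite le_eqVlt; apply/orP; left; apply/eqP; rewrite /Cb; ring.
by apply: le_trans B _; rewrite ler_pM2r ?expR_gt0// lerDr ltW.
Qed.

End Core.

Theorem theorem1 (R : realType) :
  exists eps1 Cstar : R, 0 < eps1 /\ 0 < Cstar /\
  forall (c : 'rV[R]_4) (r : R) (K w : 'rV[R]_4 -> R),
    0 < r ->
    (forall x, eball c (4 * r) x -> 0 <= K x) ->
    (0 <= ereal_inf [set (K x)%:E | x in eball c (2 * r)])%E ->
    (ereal_sup [set (K x)%:E | x in eball c (2 * r)] < +oo)%E ->
    admissible_solution (eball c (4 * r)) K w ->
    (ereal_sup [set (K x)%:E | x in eball c (2 * r)] *
       integral4 (eball c (2 * r)) (fun x => (expR (4 * w x))%:E)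
     < eps1%:E)%E ->
    (ereal_sup [set (expR (w x))%:E | x in eball c r] <=
       Cstar%:E *
       poweR ((r ^- 4)%:E *
              integral4 (eball c (2 * r)) (fun x => (expR (4 * w x))%:E))
             (4^-1 : R))%E /\
    (ereal_sup [set (expR (w x))%:E | x in eball c r] <=
       Cstar%:E * ereal_inf [set (expR (w x))%:E | x in eball c r])%E.
Proof.
have [eps [C [eps0 C0 core]]] := @core_estimate R.
(* Both estimates share this constant: the first needs C <= (C + 1)^4, which may fail for C
   itself. *)
exists eps, (C + 1); split=> //; split; first by rewrite addr_gt0.
move=> c r K w r0 _ _ supK adm SI.
have r40 : 0 < 4 * r by rewrite mulr_gt0.
have r20 : 0 < 2 * r by rewrite mulr_gt0.
have oU : open (eball c (4 * r)).
  rewrite (_ : eball c _ = [set x | sqn (x - c) < (4 * r) ^+ 2]); first exact: open_sqn.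
  by apply/seteqP; split=> x /(eball_sqn _ _ r40).
have cU k : 0 < k -> eball c k c.
  by move=> k0; apply/eball_sqn => //; rewrite subrr sqn0 exprn_gt0.
have [g [H [wH E]]] := conf_equation oU adm.
set A := [set (K x)%:E | x in eball c (2 * r)] in supK SI.
have KA x : eball c (2 * r) x -> ((K x)%:E <= ereal_sup A)%E.
  by move=> Bx; apply: ereal_sup_ubound; exists x.
(* The cone condition makes sup K positive, so smallness of its product with the integral forces the
   integral to be finite. *)
have Kc : 0 < K c by have [[_ ?] <-] := adm.2 _ (cU _ r40).
have [S SE] : exists S : R, ereal_sup A = S%:E.
  case: (ereal_sup A) supK (KA _ (cU _ r20)) => [S|//|//] _ _; first by exists S.
have S0 : 0 < S by rewrite -lte_fin -SE; apply: lt_le_trans (KA _ (cU _ r20)); rewrite lte_fin.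
rewrite SE in SI KA.
have E1 x : eball c (4 * r) x -> \sum_i H i i x + \sum_i g i x ^+ 2 < 0 by move=> /E[].
have E2 x : eball c (2 * r) x ->
    (\sum_i H i i x) ^+ 2 - \sum_i \sum_j H i j x ^+ 2 +
    (\sum_i g i x ^+ 2) * (\sum_i H i i x) + 2 * \sum_i \sum_j H i j x * (g i x * g j x)
    <= 2 * S * expR (4 * w x).
  move=> Bx; have Ux : eball c (4 * r) x.
    by move: Bx => /(eball_sqn _ _ r20) h; apply/eball_sqn => //; apply: (lt_le_trans h); nra.
  rewrite (E _ Ux).2 ler_wpM2r ?expR_ge0// ler_pM2l// -lee_fin; exact: KA.
have [M Hk] := core c r S w g H r0 S0 wH E1 E2 SI.
set I := integral4 _ _ in SI M *.
have I0 : (0 <= I)%E by apply: integral_ge0 => x _; rewrite lee_fin expR_ge0.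
have [i IE] : exists i : R, I = i%:E.
  case: I I0 SI {M} => [i|//|//]; first by exists i.
  by move=> _; rewrite gt0_muley ?lte_fin.
rewrite IE lee_fin in I0; split.
  apply: ge_ereal_sup => _ [x Bx <-]; have := M _ Bx; rewrite IE -!EFinM !lee_fin => h.
  set a := r ^- 4 * i; pose v := a `^ 4^-1.
  have a0 : 0 <= a by rewrite mulr_ge0// invr_ge0 exprn_ge0// ltW.
  have v4 : v ^+ 4 = a by rewrite -powR_mulrn ?powR_ge0// -powRrM mulVf// powRr1.
  rewrite -/a -/v -(ler_pXn2r (ltn0Sn 3)) ?nnegrE ?expR_ge0 ?mulr_ge0 ?powR_ge0 ?addr_ge0 ?(ltW C0)//.
  rewrite exprMn v4 -(ler_pM2r (exprn_gt0 4 r0)).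
  rewrite (_ : _ * a * r ^+ 4 = (C + 1) ^+ 4 * i); last by rewrite /a; field; rewrite gt_eqF.
  apply: le_trans h _; rewrite ler_wpM2r//.
  apply: le_trans (_ : (C + 1) <= _); first by rewrite lerDl.
  by apply: ler_eXnr => //; rewrite lerDr ltW.
have C10 : 0 < C + 1 by rewrite addr_gt0.
apply: ge_ereal_sup => _ [x Bx <-].
have -> : (expR (w x))%:E = ((C + 1)%:E * (expR (w x) / (C + 1))%:E)%E.
  by rewrite -EFinM mulrC divfK// gt_eqF.
apply: lee_wpmul2l; first by rewrite lee_fin ltW.
apply: le_ereal_inf_tmp => _ [y By <-]; rewrite lee_fin ler_pdivrMr//.
by apply: le_trans (Hk _ _ Bx By) _; rewrite [leRHS]mulrC ler_pM2r ?expR_gt0// lerDl.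
Qed.
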